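(* The following decision problem is NP-complete: given a bipartite graph $G$ with maximum degree $\Delta(G)\le 6$, decide whether $sr(G)=2$.
   Context: All graphs are finite, simple and undirected. For a set $E'$ of edges of a graph, the subgraph induced by $E'$ is the graph whose edge set is $E'$ and whose vertex set is the set of endpoints of edges in $E'$. A graph is semiregular if there is an integer $d$ such that every vertex has degree $d$ or $d+1$. The semiregular number $sr(G)$ of a graph $G$ is the minimum number of subsets into which $E(G)$ can be partitioned so that the subgraph induced by each subset is semiregular. *)

(* Defs.v *)
From mathcomp Require Import all_boot.
Set Implicit Arguments. Unset Strict Implicit. Unset Printing Implicit Defensive.

(* Graph notions (simple graphs on a finite vertex type V, given by a  *)
(* symmetric irreflexive relation e).  Edges are 2-element sets.       *)
Section Graphs.
Variable V : finType.

Definition edge_set (e : rel V) : {set {set V}} :=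
  [set [set x; y] | x in V, y in V & e x y].

Definition edeg (F : {set {set V}}) (v : V) : nat := #|[set X in F | v \in X]|.

Definition endpoints (F : {set {set V}}) : {set V} := \bigcup_(X in F) X.

Definition semiregular_edges (F : {set {set V}}) : Prop :=
  exists d : nat, forall v, v \in endpoints F -> edeg F v = d \/ edeg F v = d.+1.

Definition sr_partitionable (e : rel V) (k : nat) : Prop :=
  exists f : {set V} -> 'I_k,
    forall i : 'I_k, semiregular_edges [set X in edge_set e | f X == i].

Definition sr_is (e : rel V) (k : nat) : Prop :=
  sr_partitionable e k /\ forall j, j < k -> ~ sr_partitionable e j.

Definition bipartite (e : rel V) : Prop :=
  exists A : {set V}, forall x y, e x y -> (x \in A) != (y \in A).

Definition maxdeg_le (e : rel V) (D : nat) : Prop :=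
  forall x, #|[set y | e x y]| <= D.

End Graphs.

(* A standard computation model: deterministic single-tape Turing     *)
(* machines with tape alphabet {0,1,blank} (blank = None).             *)
Inductive move := MLeft | MRight | MStay.

Record TM := {
  tm_state : finType;
  tm_start : tm_state;
  tm_halt : tm_state -> bool;
  tm_accept : tm_state -> bool;
  tm_delta : tm_state -> option bool -> tm_state * option bool * move }.

(* configuration: state, reversed left part, scanned symbol, right part *)
Definition config (M : TM) : Type :=
  (tm_state M * seq (option bool) * option bool * seq (option bool))%type.

Definition tm_init (M : TM) (x : seq bool) : config M :=
  match x with
  | [::] => (tm_start M, [::], None, [::])
  | b :: x' => (tm_start M, [::], Some b, map Some x')
  end.

Definition tm_step (M : TM) (c : config M) : config M :=
  let: (q, l, a, r) := c in
  if tm_halt q then c else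
  let: (q', w, m) := tm_delta q a in
  match m with
  | MStay => (q', l, w, r)
  | MLeft => match l with
             | [::] => (q', [::], w, r)
             | b :: l' => (q', l', b, w :: r)
             end
  | MRight => match r with
              | [::] => (q', w :: l, None, [::])
              | b :: r' => (q', w :: l, b, r')
              end
  end.

Definition tm_run (M : TM) (x : seq bool) (t : nat) : config M :=
  iter t (@tm_step M) (tm_init M x).

Definition cfg_state (M : TM) (c : config M) : tm_state M :=
  let: (q, _, _, _) := c in q.

Definition cfg_output (M : TM) (c : config M) : seq bool :=
  let: (_, _, a, r) := c in
  let s := a :: r in
  map (odflt false) (take (find (fun o => o == None) s) s).

Definition poly_decides (M : TM) (L : seq bool -> Prop) : Prop :=
  exists k : nat, forall x : seq bool,
    let c := tm_run M x (size x ^ k + k) in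
    tm_halt (cfg_state c) /\ (tm_accept (cfg_state c) <-> L x).

Definition poly_computes (M : TM) (f : seq bool -> seq bool) : Prop :=
  exists k : nat, forall x : seq bool,
    let c := tm_run M x (size x ^ k + k) in
    tm_halt (cfg_state c) /\ cfg_output c = f x.

Definition in_P (L : seq bool -> Prop) : Prop := exists M : TM, poly_decides M L.

Definition pair_enc (x c : seq bool) : seq bool :=
  flatten [seq [:: false; b] | b <- x] ++ [:: true; true] ++ c.

Definition in_NP (L : seq bool -> Prop) : Prop :=
  exists (Lv : seq bool -> Prop) (k : nat), in_P Lv /\
    forall x, L x <-> exists c : seq bool, size c <= size x ^ k + k /\ Lv (pair_enc x c).

Definition poly_reduces (L1 L2 : seq bool -> Prop) : Prop :=
  exists f : seq bool -> seq bool,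
    (exists M : TM, poly_computes M f) /\ forall x, L1 x <-> L2 (f x).

Definition NP_hard (L : seq bool -> Prop) : Prop :=
  forall L', in_NP L' -> poly_reduces L' L.

Definition NP_complete (L : seq bool -> Prop) : Prop := in_NP L /\ NP_hard L.

Definition adj_enc (n : nat) (e : rel 'I_n) : seq bool :=
  [seq e i j | i <- enum 'I_n, j <- enum 'I_n].

Definition SR2_BIP6 (x : seq bool) : Prop :=
  exists (n : nat) (e : rel 'I_n),
    [/\ x = adj_enc e, symmetric e & irreflexive e] /\
    [/\ bipartite e, maxdeg_le e 6 & sr_is e 2].

(* Main.v *)
(* Polynomial time.  Every function on words needed here is given by an arithmetic term
   built from the bits of the input with addition, truncated subtraction and bounded
   sums.  The values of such a term are polynomially bounded, so it can be evaluated in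
   unary on stacks interleaved on a single tape.

   Hardness.  The computations of a polynomial time machine on [pair_enc x c], for all
   certificates [c], are described by a 3CNF formula whose literals are such terms.  In
   the graph of the formula, each variable is a cycle of vertices of degree 2 and 3, and
   each constraint is a vertex of degree 4 or 6 joined to vertices of degree 3 on the
   cycles of its variables.  The degrees that occur force both classes of a partition
   into two semiregular subgraphs to have degrees 2 and 3.  So vertices of degree 2 and 3
   are monochromatic, every cycle has one colour, and a constraint sees both colours
   equally often. *)
Require Import Defs.
From mathcomp Require Import all_boot.
From mathcomp Require Import zify.
From Stdlib Require Import FunctionalExtensionality.
Set Implicit Arguments. Unset Strict Implicit. Unset Printing Implicit Defensive.

(** * Structured tape programs *)

(** No two machines are ever composed: the whole reduction, and the whole verifier, is given by
    terms compiled once. This shapes the constructions. A clause, a literal, a vertex or a matrix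
    entry is found by division and remainder from its number, never by searching a list. In
    particular every variable gets one occurrence for each slot of each constraint, so no list of
    its actual occurrences has to be computed; an occurrence without a constraint just has degree 2
    on its cycle, and vertex numbers that denote nothing are isolated, which semiregularity ignores.

    The two classes of a partition are interchangeable, so a partition determines an assignment only
    up to complement. Hence truth and falsity are themselves variables, and opposite literals are
    tied together by constraints. A constraint with six slots has three true ones; one false slot
    and two free slots turn this into a demand that at least one of the other three be true. Degree
    6 next to degree 2 also excludes that a single class suffices. *)

Definition tape := nat -> option bool.

Definition upd (T : tape) (h : nat) (w : option bool) : tape :=
  fun p => if p == h then w else T p.

(** The predecessor is truncated: a left move in cell 0 stays there, as in [tm_step] with an empty
    left part. *)
Definition mv (m : move) (h : nat) : nat :=
  match m with MLeft => h.-1 | MRight => h.+1 | MStay => h end.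

Lemma upd_id (T : tape) h : upd T h (T h) = T.
Proof. by apply: functional_extensionality => p; rewrite /upd; case: eqP => [->|]. Qed.

Definition cfg_pos (M : TM) (c : config M) : nat := let: (_, l, _, _) := c in size l.

(** Functions identify right parts that differ by trailing blanks, so the fresh blank that [tm_step]
    supplies at the right end changes nothing here. *)
Definition cfg_tape (M : TM) (c : config M) : tape :=
  let: (_, l, a, r) := c in nth None (rev l ++ a :: r).

Definition astep (M : TM) (c : tm_state M * nat * tape) : tm_state M * nat * tape :=
  let: (q, h, T) := c in
  if tm_halt q then c else
  let: (q', w, m) := tm_delta q (T h) in (q', mv m h, upd T h w).

Definition cfg_abs (M : TM) (c : config M) := (cfg_state c, cfg_pos c, cfg_tape c).

Lemma nth_upd (u r : seq (option bool)) a w :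
  upd (nth None (u ++ a :: r)) (size u) w = nth None (u ++ w :: r).
Proof.
apply: functional_extensionality => p; rewrite /upd !nth_cat.
case: ltngtP => [//|lt_up|->]; last by rewrite subnn.
by case E: (p - size u) => [|i] //; move: E lt_up; lia.
Qed.

Lemma cfg_abs_step (M : TM) (c : config M) : cfg_abs (tm_step c) = astep (cfg_abs c).
Proof.
case: c => [[[q l] a] r]; rewrite /cfg_abs /=.
have Ta : nth None (rev l ++ a :: r) (size l) = a.
  by rewrite nth_cat size_rev ltnn subnn.
rewrite Ta; case: (tm_halt q) => //; case: (tm_delta q a) => [[q' w] m].
rewrite -[in upd _ (size l) _](size_rev l) nth_upd.
case: m => /=.
- case: l Ta => [|b l] Ta //=; congr (_, _, _).
  by rewrite rev_cons cat_rcons.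
- case: r Ta => [|b r] Ta /=; congr (_, _, _); rewrite rev_cons cat_rcons //.
  apply: functional_extensionality => p; rewrite !nth_cat.
  by case: ltnP => // _; case: (p - _) => [|[|k]] //=; rewrite nth_nil.
- by [].
Qed.

Lemma cfg_abs_init (M : TM) (x : seq bool) :
  cfg_abs (tm_init M x) = (tm_start M, 0, onth x).
Proof.
have onthE : onth x = nth None (map Some x).
  by apply: functional_extensionality => p; rewrite onthE.
by rewrite onthE; case: x {onthE} => [|b x] //=; congr (_, _, _);
  apply: functional_extensionality => -[|[|p]] /=; rewrite ?nth_nil.
Qed.

Lemma cfg_abs_run (M : TM) (x : seq bool) t :
  cfg_abs (tm_run M x t) = iter t (@astep M) (tm_start M, 0, onth x).
Proof.
rewrite /tm_run; elim: t => [|t IH]; first exact: cfg_abs_init.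
by rewrite !iterS cfg_abs_step IH.
Qed.

(** The range includes [i = size o], where [onth o i] is blank: this cell is what ends the
    output. *)
Lemma cfg_output_abs (M : TM) (c : config M) q h T (o : seq bool) :
  cfg_abs c = (q, h, T) -> (forall i, i <= size o -> T (h + i) = onth o i) ->
  cfg_output c = o.
Proof.
case: c => [[[q' l] a] r]; rewrite /cfg_abs /cfg_output => -[_ <- <-].
rewrite /cfg_pos /cfg_tape; move: (a :: r) => s To.
have so i : i <= size o -> nth None s i = onth o i.
  by move=> /To <-; rewrite nth_cat size_rev ltnNge leq_addr /= addKn.
elim: o s so {To} => [|b o IH] s so.
  by case: s so => [|[b|] s] // so; have := so 0 isT.
case: s so => [|a' s] so; first by have := so 0 isT.
have /= -> := so 0 isT; rewrite /=; congr cons.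
by apply: IH => i lei; have := so i.+1 lei.
Qed.

Inductive prog :=
| Act of (option bool -> option bool * move)
| Seq of prog & prog
| If of (option bool -> bool) & prog & prog
| While of (option bool -> bool) & prog.

(** [If] and [While] own an extra state [None], in which the scanned symbol is tested by a step that
    leaves the tape alone. *)
Fixpoint pst (p : prog) : finType :=
  match p with
  | Act _ => unit
  | Seq p1 p2 => (pst p1 + pst p2)%type
  | If _ p1 p2 => option (pst p1 + pst p2)%type
  | While _ p1 => option (pst p1)
  end.

Fixpoint pstart (p : prog) : pst p :=
  match p return pst p with
  | Act _ => tt
  | Seq p1 p2 => inl (pstart p1)
  | If _ p1 p2 => None
  | While _ p1 => None
  end.

(* A next state [None] means leaving the program. *)
Fixpoint pdelta (p : prog) : pst p -> option bool -> option (pst p) * option bool * move :=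
  match p return pst p -> option bool -> option (pst p) * option bool * move with
  | Act f => fun _ s => (None, (f s).1, (f s).2)
  | Seq p1 p2 => fun a s =>
      match a with
      | inl a1 => let: (o, w, m) := pdelta a1 s in
          (Some (if o is Some a' then inl a' else inr (pstart p2)), w, m)
      | inr a2 => let: (o, w, m) := pdelta a2 s in
          (if o is Some a' then Some (inr a') else None, w, m)
      end
  | If b p1 p2 => fun a s =>
      match a with
      | None => (Some (Some (if b s then inl (pstart p1) else inr (pstart p2))), s, MStay)
      | Some (inl a1) => let: (o, w, m) := pdelta a1 s in
          (if o is Some a' then Some (Some (inl a')) else None, w, m)
      | Some (inr a2) => let: (o, w, m) := pdelta a2 s in
          (if o is Some a' then Some (Some (inr a')) else None, w, m)
      end
  | While b p1 => fun a s =>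
      match a with
      | None => (if b s then Some (Some (pstart p1)) else None, s, MStay)
      | Some a1 => let: (o, w, m) := pdelta a1 s in
          (Some (if o is Some a' then Some a' else None), w, m)
      end
  end.

Definition dstep (S : Type) (d : S -> option bool -> option S * option bool * move)
    (c : option S * (nat * tape)) : option S * (nat * tape) :=
  if c.1 is Some a then
    let: (h, T) := c.2 in
    let: (o, w, m) := d a (T h) in (o, (mv m h, upd T h w))
  else c.

(** [d'] runs a copy of [d] along [f], with leaving redirected to [e]. The time is only bounded by
    [t] because [dstep] idles once [d] has left, whereas the copy has to be stopped at that very
    moment, as it may go on from [e]. *)
Lemma dstep_sim (S S' : Type) (d : S -> option bool -> option S * option bool * move)
    (d' : S' -> option bool -> option S' * option bool * move) (f : S -> S') (e : option S') :
  (forall a s, d' (f a) s = (if (d a s).1.1 is Some a' then Some (f a') else e, (d a s).1.2, (d a s).2)) ->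
  forall t a c c', iter t (dstep d) (Some a, c) = (None, c') ->
  exists2 t', t' <= t & iter t' (dstep d') (Some (f a), c) = (e, c').
Proof.
move=> df; elim=> [|t IH] a [h T] c' //; rewrite iterSr /dstep /= -!/(dstep _).
have := df a (T h); case: (d a (T h)) => [[[a'|] w] m] /= dfa.
  by move=> /IH[t' le_t' run]; exists t'.+1 => //; rewrite iterSr {2}/dstep /= dfa.
have -> c0 : iter t (dstep d) (None, c0) = (None, c0) by elim: t {IH} => //= t ->.
by case=> <-; exists 1 => //=; rewrite /dstep /= dfa.
Qed.

Definition exec (p : prog) (c c' : nat * tape) (t : nat) : Prop :=
  exists2 t', t' <= t & iter t' (dstep (@pdelta p)) (Some (pstart p), c) = (None, c').

Lemma exec_le p c c' t1 t2 : exec p c c' t1 -> t1 <= t2 -> exec p c c' t2.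
Proof. by case=> t le_t run le12; exists t => //; apply: leq_trans le_t le12. Qed.

Lemma exec_act f h T : exec (Act f) (h, T) (mv (f (T h)).2 h, upd T h (f (T h)).1) 1.
Proof. by exists 1. Qed.

Lemma exec_seq p1 p2 c c1 c2 t1 t2 :
  exec p1 c c1 t1 -> exec p2 c1 c2 t2 -> exec (Seq p1 p2) c c2 (t1 + t2).
Proof.
case=> u1 le1 run1 [u2 le2 run2].
have [v1 lev1 {}run1] := @dstep_sim _ _ (@pdelta p1) (@pdelta (Seq p1 p2)) inl (Some (inr (pstart p2)))
   ltac:(by move=> a s /=; case: (pdelta a s) => [[[a'|] w] m]) _ _ _ _ run1.
have [v2 lev2 {}run2] := @dstep_sim _ _ (@pdelta p2) (@pdelta (Seq p1 p2)) inr None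
   ltac:(by move=> a s /=; case: (pdelta a s) => [[[a'|] w] m]) _ _ _ _ run2.
by exists (v2 + v1); [lia | rewrite iterD run1 run2].
Qed.

Lemma exec_if_true (b : option bool -> bool) p1 p2 h (T : tape) c t :
  b (T h) -> exec p1 (h, T) c t -> exec (If b p1 p2) (h, T) c t.+1.
Proof.
move=> bT [u le run].
have [v lev {}run] := @dstep_sim _ _ (@pdelta p1) (@pdelta (If b p1 p2)) (Some \o inl) None
   ltac:(by move=> a s /=; case: (pdelta a s) => [[[a'|] w] m]) _ _ _ _ run.
by exists v.+1; [lia | rewrite iterSr {2}/dstep /= bT /= upd_id].
Qed.

Lemma exec_if_false (b : option bool -> bool) p1 p2 h (T : tape) c t :
  ~~ b (T h) -> exec p2 (h, T) c t -> exec (If b p1 p2) (h, T) c t.+1.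
Proof.
move=> /negbTE bT [u le run].
have [v lev {}run] := @dstep_sim _ _ (@pdelta p2) (@pdelta (If b p1 p2)) (Some \o inr) None
   ltac:(by move=> a s /=; case: (pdelta a s) => [[[a'|] w] m]) _ _ _ _ run.
by exists v.+1; [lia | rewrite iterSr {2}/dstep /= bT /= upd_id].
Qed.

Lemma exec_while_false (b : option bool -> bool) p h (T : tape) : ~~ b (T h) -> exec (While b p) (h, T) (h, T) 1.
Proof. by move=> /negbTE bT; exists 1 => //=; rewrite /dstep /= bT /= upd_id. Qed.

Lemma exec_while_true (b : option bool -> bool) p h (T : tape) c c' t t' : b (T h) -> exec p (h, T) c t ->
  exec (While b p) c c' t' -> exec (While b p) (h, T) c' (t + t').+1.
Proof.
move=> bT [u le run] [u' le' run'].
have [v lev {}run] := @dstep_sim _ _ (@pdelta p) (@pdelta (While b p)) Some (Some None)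
   ltac:(by move=> a s /=; case: (pdelta a s) => [[[a'|] w] m]) _ _ _ _ run.
exists ((u' + v).+1); first lia.
by rewrite iterSr {2}/dstep /= bT /= upd_id iterD run.
Qed.

(* After leaving [p] the machine halts, accepting iff the scanned symbol is [true]. *)
Definition tm_of (p : prog) : TM := {|
  tm_state := (pst p + option bool)%type;
  tm_start := inl (pstart p);
  tm_halt := fun q => if q is inr (Some _) then true else false;
  tm_accept := fun q => if q is inr (Some true) then true else false;
  tm_delta := fun q s =>
    match q with
    | inl a => let: (o, w, m) := pdelta a s in
        (if o is Some a' then inl a' else inr None, w, m)
    | inr _ => (inr (Some (s == Some true)), s, MStay)
    end |}.

(** The strict bound pays for the step in which [inr None] reads the scanned cell and enters the
    halting state that records the answer. *)
Lemma tm_of_run p x h T t u : exec p (0, onth x) (h, T) t -> t < u ->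
  cfg_abs (tm_run (tm_of p) x u) = (inr (Some (T h == Some true)), h, T).
Proof.
case=> t1 le1 run lt_u; rewrite cfg_abs_run /=.
have [t2 le2 run2] : exists2 t2, t2 <= t1 &
    iter t2 (@astep (tm_of p)) (inl (pstart p), 0, onth x) = (inr None, h, T).
  move: run {le1}; elim: t1 (pstart p) 0 (onth x) => [|t1 IH] a h1 T1 //.
  rewrite iterSr {2}/dstep /=; case E: (pdelta a (T1 h1)) => [[[a'|] w] m] run.
    have [t2 le2 {}run] := IH _ _ _ run; exists t2.+1 => //.
    by rewrite iterSr {2}/astep /= E.
  have halted c0 : iter t1 (dstep (@pdelta p)) (None, c0) = (None, c0).
    by elim: t1 {IH run} => //= t1 ->.
  by move: run; rewrite halted => -[<- <-]; exists 1 => //=; rewrite E.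
have -> : u = (u - t2.+1) + t2.+1 by lia.
rewrite iterD iterS run2 /= upd_id.
by elim: (u - _) => //= k ->.
Qed.

(** * Stacks interleaved on a tape *)

Fixpoint mov (m : move) (n : nat) : prog :=
  if n is n'.+1 then Seq (Act (fun s => (s, m))) (mov m n') else Act (fun s => (s, MStay)).

Lemma exec_mov m n h T : exec (mov m n) (h, T) (iter n (mv m) h, T) n.+1.
Proof.
elim: n h => [|n IH] h; first by have := exec_act (fun s => (s, MStay)) h T; rewrite /= upd_id.
rewrite iterSr; apply: (exec_seq (t1 := 1)) (IH _).
by have := exec_act (fun s => (s, m)) h T; rewrite /= upd_id.
Qed.

Lemma exec_movR n h T : exec (mov MRight n) (h, T) (h + n, T) n.+1.
Proof.
have -> : h + n = iter n (mv MRight) h by elim: n => [|n /= <-]; rewrite ?addn0 ?addnS.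
exact: exec_mov.
Qed.

Lemma exec_movL n h T : exec (mov MLeft n) (h, T) (h - n, T) n.+1.
Proof.
have -> : h - n = iter n (mv MLeft) h by elim: n => [|n /= <-]; rewrite ?subn0 ?subnS.
exact: exec_mov.
Qed.

Lemma exec_write w h T : exec (Act (fun=> (w, MStay))) (h, T) (h, upd T h w) 1.
Proof. exact: exec_act. Qed.

Lemma exec_walkR (b : option bool -> bool) n h (T : tape) r :
  (forall j, j < r -> b (T (h + j * n))) -> ~~ b (T (h + r * n)) ->
  exec (While b (mov MRight n)) (h, T) (h + r * n, T) (r * n.+2).+1.
Proof.
elim: r h => [|r IH] h bT bF; first by rewrite mul0n addn0 in bF *; apply: exec_while_false.
have := bT 0 isT; rewrite mul0n addn0 => b0.
apply: exec_le (exec_while_true b0 (exec_movR _ _ _) _) _.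
- rewrite mulSn addnA; apply: IH => [j lt_jr|]; last by rewrite -addnA -mulSn.
  by rewrite -addnA -mulSn; apply: bT.
- by rewrite mulSn; lia.
Qed.

Lemma exec_walkL (b : option bool -> bool) n h (T : tape) r :
  (forall j, j < r -> b (T (h + j.+1 * n))) -> ~~ b (T h) ->
  exec (While b (mov MLeft n)) (h + r * n, T) (h, T) (r * n.+2).+1.
Proof.
elim: r => [|r IH] bT bF; first by rewrite mul0n addn0 in bF *; apply: exec_while_false.
apply: exec_le (exec_while_true (bT r _) (exec_movL _ _ _) _) _ => //.
- have -> : h + r.+1 * n - n = h + r * n by rewrite mulSn; lia.
  by apply: IH => // j lt_jr; apply: bT; lia.
- by rewrite mulSn; lia.
Qed.

Definition blank (s : option bool) : bool := ~~ isSome s.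

Definition set_nth_fun (s : nat -> seq bool) i v : nat -> seq bool :=
  fun k => if k == i then v else s k.

Section Tracks.

(* [K] stacks (bottom first) are interleaved on the tape from cell [O] on; stack 0
   consists of a single bit marking [O]. *)
Variables (K O : nat) (lft : tape).
Hypothesis K_gt0 : 0 < K.

Definition lay (s : nat -> seq bool) : tape := fun p =>
  if p < O then lft p
  else onth (s ((p - O) %% K)) ((p - O) %/ K).

Lemma lay_at s i j : i < K -> lay s (O + i + j * K) = onth (s i) j.
Proof.
move=> lt_iK; rewrite /lay ltnNge -addnA leq_addr /= addKn addnC.
by rewrite modnMDl modn_small // divnMDl // divn_small // addn0.
Qed.

Lemma upd_lay s s' i j w : i < K -> (forall k, k != i -> s' k = s k) ->
  (forall j', onth (s' i) j' = if j' == j then w else onth (s i) j') ->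
  upd (lay s) (O + i + j * K) w = lay s'.
Proof.
move=> lt_iK s'N s'i; apply: functional_extensionality => p; rewrite /upd.
case: eqP => [->|neq_p]; first by rewrite lay_at // s'i eqxx.
rewrite /lay; case: ltnP => // le_Op.
have := divn_eq (p - O) K; set q := _ %/ _; set r := _ %% _ => Ep.
case: (eqVneq r i) => [Er|neq_r]; last by rewrite s'N.
rewrite Er s'i; case: eqP => // Eq; case: neq_p; rewrite -Er -Eq; lia.
Qed.

Definition goto i : prog := Seq (mov MRight i) (While isSome (mov MRight K)).
(** Column 0 is blank above its bottom cell, so jumping left by [K] over blanks stops exactly at
    [O]. *)
Definition home i : prog := Seq (mov MLeft i) (While blank (mov MLeft K)).
Definition visit i j : prog := Seq (goto i) (Seq (mov MRight j) (mov MLeft i)).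

Definition push i b : prog := Seq (goto i) (Seq (Act (fun=> (Some b, MStay))) (home i)).
Definition clear i : prog :=
  Seq (mov MRight i)
    (Seq (While isSome (Seq (Act (fun=> (None, MStay))) (mov MRight K))) (home i)).
(* The tests read stack [j] just above the height of stack [i]: this compares their
   heights, and looks up a bit of [j] at a given index. *)
Definition tif i j (b : option bool -> bool) p q : prog :=
  Seq (visit i j) (If b (Seq (home j) p) (Seq (home j) q)).
Definition twhile i j (b : option bool -> bool) p : prog :=
  Seq (visit i j) (Seq (While b (Seq (home j) (Seq p (visit i j)))) (home j)).

(** One generous bound for any single stack operation at heights up to [H], walks out and back
    included. *)
Definition unit_time H := 10 * (K.+4 * H.+2).

Lemma exec_goto s i : i < K ->
  exec (goto i) (O, lay s) (O + i + size (s i) * K, lay s) (K.+2 * (size (s i)).+2).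
Proof.
move=> lt_iK; apply: exec_le (exec_seq (exec_movR _ _ _) (exec_walkR _ _)) _.
- by move=> j lt_j; rewrite lay_at // onthTE.
- by rewrite lay_at // onthTE ltnn.
- by lia.
Qed.

Lemma exec_home s i j : i < K -> s 0 = [:: true] ->
  exec (home i) (O + i + j * K, lay s) (O, lay s) (K.+2 * j.+2).
Proof.
move=> lt_iK s0; apply: exec_le (exec_seq (exec_movL _ _ _) _) _.
- have -> : O + i + j * K - i = O + j * K by lia.
  apply: exec_walkL => [j' _|].
  + by have := lay_at s j'.+1 K_gt0; rewrite addn0 => ->; rewrite s0 /blank onthTE.
  + by have := lay_at s 0 K_gt0; rewrite !addn0 => ->; rewrite s0.
- by lia.
Qed.

Lemma exec_visit s i j : i < K -> j < K ->
  exec (visit i j) (O, lay s) (O + j + size (s i) * K, lay s) (K.+2 * (size (s i)).+4).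
Proof.
move=> lt_iK lt_jK.
apply: exec_le (exec_seq (exec_goto _ lt_iK) (exec_seq (exec_movR _ _ _) _)) _.
  have -> : O + j + size (s i) * K = O + i + size (s i) * K + j - i by lia.
  exact: exec_movL.
by lia.
Qed.

Definition runs p s s' t := exec p (O, lay s) (O, lay s') t.

Lemma runs_le p s s' t t' : runs p s s' t -> t <= t' -> runs p s s' t'.
Proof. exact: exec_le. Qed.

Lemma runs_seq p q s s1 s2 t1 t2 :
  runs p s s1 t1 -> runs q s1 s2 t2 -> runs (Seq p q) s s2 (t1 + t2).
Proof. exact: exec_seq. Qed.

Lemma runs_push s i b H : 0 < i < K -> s 0 = [:: true] -> size (s i) <= H ->
  runs (push i b) s (set_nth_fun s i (rcons (s i) b)) (unit_time H).
Proof.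
move=> /andP[i_gt0 lt_iK] s0 le_H; set s' := set_nth_fun _ _ _.
apply: exec_le (exec_seq (exec_goto _ lt_iK) (exec_seq (exec_write _ _ _) _)) _.
- rewrite (@upd_lay _ s') //; first last.
  + move=> j; rewrite /s' /set_nth_fun eqxx !onthE map_rcons nth_rcons size_map.
    by case: ltngtP => // lt_j; rewrite nth_default // size_map ltnW.
  + by move=> k /negbTE neq_k; rewrite /s' /set_nth_fun neq_k.
  by apply: exec_home => //; rewrite /s' /set_nth_fun; case: eqP i_gt0 => // <-.
- by rewrite /unit_time; nia.
Qed.

Lemma runs_clear s i H : 0 < i < K -> s 0 = [:: true] -> size (s i) <= H ->
  runs (clear i) s (set_nth_fun s i [::]) (unit_time H).
Proof.
move=> /andP[i_gt0 lt_iK] s0 le_H.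
(* Stack [i] is erased from the bottom up, so the intermediate tapes are not of the form [lay s]; in
   [L k] its cells below level [k] are blank. *)
pose L k : tape := fun p =>
  if (p < O + k * K) && (O <= p) && ((p - O) %% K == i) then None else lay s p.
have L0 : L 0 = lay s.
  by apply: functional_extensionality => p; rewrite /L mul0n addn0; case: ltnP => //= lt_p; rewrite leqNgt lt_p.
have Lend : L (size (s i)) = lay (set_nth_fun s i [::]).
  apply: functional_extensionality => p; rewrite /L /lay.
  case: (ltnP p O) => [|le_Op]; first by rewrite andbF.
  rewrite /set_nth_fun andbT; case: (eqVneq ((p - O) %% K) i) => [Ei|]; last by rewrite andbF.
  rewrite andbT onth0n; case: ltnP => // le_p.
  by rewrite Ei onth_default // leq_divRL //; lia.
have Lstep k : upd (L k) (O + i + k * K) None = L k.+1.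
  apply: functional_extensionality => p; rewrite /upd /L.
  case: eqP => [->|neq_p].
    have -> : O + i + k * K < O + k.+1 * K by rewrite mulSn; lia.
    have -> : O + i + k * K - O = k * K + i by lia.
    by rewrite modnMDl modn_small // eqxx -addnA leq_addr.
  case: (ltnP p O) => [|le_Op]; first by rewrite !andbF.
  case: (eqVneq ((p - O) %% K) i) => [Ei|]; last by rewrite !andbF.
  rewrite !andbT; suff -> : (p < O + k * K) = (p < O + k.+1 * K) by [].
  have Ep := divn_eq (p - O) K; rewrite Ei in Ep.
  apply/idP/idP; rewrite mulSn; first by lia.
  move=> lt_p; rewrite ltnNge; apply/negP => le_p.
  have Eq : (p - O) %/ K = k.
    apply/eqP; rewrite eqn_leq leq_divRL // -ltnS ltn_divLR // mulSn; apply/andP; split; lia.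
  by rewrite Eq in Ep; lia.
have Lat k j : k <= j -> L k (O + i + j * K) = onth (s i) j.
  move=> le_kj; rewrite /L; case: ltnP => /=; last by rewrite lay_at.
  by have := leq_mul le_kj (leqnn K); lia.
have loop r k : r + k = size (s i) ->
    exec (While isSome (Seq (Act (fun=> (None, MStay))) (mov MRight K)))
      (O + i + k * K, L k) (O + i + size (s i) * K, L (size (s i))) (r * K.+3).+1.
  elim: r k => [|r IH] k Ek.
    by rewrite -Ek add0n; apply: exec_while_false; rewrite Lat // onthTE; lia.
  apply: exec_le (exec_while_true _ (exec_seq (exec_write _ _ _) (exec_movR _ _ _)) _) _.
  - by rewrite Lat // onthTE; lia.
  - by rewrite Lstep -addnA -mulSnr; apply: IH; lia.
  - by rewrite mulSn; lia.
apply: exec_le (exec_seq (exec_movR _ _ _) (exec_seq _ _)) _.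
- by move: (loop (size (s i)) 0 (addn0 _)); rewrite mul0n addn0 L0; apply.
- by rewrite Lend; apply: exec_home => //; rewrite /set_nth_fun; case: eqP i_gt0 => // <-.
- by rewrite /unit_time; nia.
Qed.

Lemma runs_tif_true s s' i j (b : option bool -> bool) p q t H :
  i < K -> j < K -> s 0 = [:: true] -> size (s i) <= H ->
  b (onth (s j) (size (s i))) -> runs p s s' t -> runs (tif i j b p q) s s' (unit_time H + t).
Proof.
move=> lt_iK lt_jK s0 le_H bT rp.
apply: exec_le (exec_seq (exec_visit _ lt_iK lt_jK) (exec_if_true _ _ (exec_seq (exec_home _ _ _) rp))) _ => //.
  by rewrite lay_at.
by rewrite /unit_time; nia.
Qed.

Lemma runs_tif_false s s' i j (b : option bool -> bool) p q t H :
  i < K -> j < K -> s 0 = [:: true] -> size (s i) <= H ->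
  ~~ b (onth (s j) (size (s i))) -> runs q s s' t -> runs (tif i j b p q) s s' (unit_time H + t).
Proof.
move=> lt_iK lt_jK s0 le_H bT rp.
apply: exec_le (exec_seq (exec_visit _ lt_iK lt_jK) (exec_if_false _ _ (exec_seq (exec_home _ _ _) rp))) _ => //.
  by rewrite lay_at.
by rewrite /unit_time; nia.
Qed.

(** The sequence of stack contents [s 0], ..., [s r] plays the part of the loop invariant. The
    factor is [r.+1] to pay for the first visit and the final return. *)
Lemma runs_twhile (s : nat -> nat -> seq bool) r i j (b : option bool -> bool) p t H :
  i < K -> j < K -> (forall k, k <= r -> s k 0 = [:: true]) ->
  (forall k, k <= r -> size (s k i) <= H) ->
  (forall k, k < r -> b (onth (s k j) (size (s k i)))) ->
  ~~ b (onth (s r j) (size (s r i))) ->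
  (forall k, k < r -> runs p (s k) (s k.+1) t) ->
  runs (twhile i j b p) (s 0) (s r) (r.+1 * (t + unit_time H)).
Proof.
move=> lt_iK lt_jK s0 le_H bT bF rp.
set V := K.+4 * H.+4.
have loop d k : d + k = r ->
    exec (While b (Seq (home j) (Seq p (visit i j))))
      (O + j + size (s k i) * K, lay (s k)) (O + j + size (s r i) * K, lay (s r)) (d * (t + 3 * V)).+1.
  elim: d k => [|d IH] k Ek.
    by rewrite -Ek add0n in bF *; apply: exec_while_false; rewrite lay_at.
  have lt_kr : k < r by lia.
  apply: exec_le (exec_while_true _ (exec_seq (exec_home _ lt_jK _) (exec_seq (rp _ lt_kr) (exec_visit _ lt_iK lt_jK))) (IH _ _)) _.
  - by rewrite lay_at // bT.
  - by rewrite s0 // ltnW.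
  - by lia.
  - have /leP := le_H _ (ltnW lt_kr); have /leP := le_H _ lt_kr; rewrite /V mulSn.
    by move=> /leP H1 /leP H2; nia.
apply: exec_le (exec_seq (exec_visit _ lt_iK lt_jK) (exec_seq (loop r 0 (addn0 _)) (exec_home _ lt_jK (s0 _ (leqnn _))))) _.
have /leP := le_H _ (leq0n _); have /leP := le_H _ (leqnn _).
move=> /leP H1 /leP H2; rewrite /unit_time -/V mulSn.
have : K.+2 * (size (s 0 i)).+4 + K.+2 * (size (s r i)).+2 + 1 <= 3 * V by rewrite /V; nia.
have : 3 * V <= 10 * (K.+4 * H.+2) by rewrite /V; nia.
by set X := _ * _; set Y := _ * _ => h1 h2; nia.
Qed.

End Tracks.

(** * Arithmetic terms with bounded sums *)

Inductive term :=
| TVar of nat | TOne | TLen | TBit of term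
| TAdd of term & term | TSub of term & term | TSum of term & term.

Definition scons (i : nat) (e : nat -> nat) : nat -> nat :=
  fun k => if k is k'.+1 then e k' else i.

Fixpoint eval (x : seq bool) (t : term) (e : nat -> nat) : nat :=
  match t with
  | TVar k => e k
  | TOne => 1
  | TLen => size x
  | TBit t => nth false x (eval x t e)
  | TAdd t u => eval x t e + eval x u e
  | TSub t u => eval x t e - eval x u e
  | TSum t u => \sum_(i < eval x t e) eval x u (scons i e)
  end.

(** The base is at least 2 even for [M = 0], so a larger exponent absorbs constants and sums. *)
Definition poly_bounded (f : nat -> nat) := exists k, forall M, f M <= M.+2 ^ k.

Lemma poly_bounded_const c : poly_bounded (fun=> c).
Proof.
exists c => M; apply: leq_trans (leq_trans (ltnW (ltn_expl c (ltnSn 1))) _) => //.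
by case: c => // c; rewrite leq_exp2r.
Qed.

Lemma poly_bounded_id : poly_bounded id.
Proof. by exists 1 => M; rewrite expn1; lia. Qed.

Lemma poly_bounded_mul f g :
  poly_bounded f -> poly_bounded g -> poly_bounded (fun M => f M * g M).
Proof. by move=> [a fa] [b gb]; exists (a + b) => M; rewrite expnD leq_mul. Qed.

Lemma poly_bounded_add f g :
  poly_bounded f -> poly_bounded g -> poly_bounded (fun M => f M + g M).
Proof.
move=> [a fa] [b gb]; exists (a + b).+1 => M.
apply: leq_trans (leq_add (fa M) (gb M)) _.
have le_a : M.+2 ^ a <= M.+2 ^ (a + b) by rewrite leq_exp2l ?leq_addr.
have le_b : M.+2 ^ b <= M.+2 ^ (a + b) by rewrite leq_exp2l ?leq_addl.
by rewrite expnS; apply: leq_trans (leq_add le_a le_b) _; rewrite addnn -mul2n leq_mul.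
Qed.

Lemma poly_bounded_pow2 f k : poly_bounded f -> poly_bounded (fun M => (f M).+2 ^ k).
Proof.
move=> /poly_bounded_add/(_ (poly_bounded_const 2))[a fa]; exists (a * k) => M.
by rewrite expnM; case: k => // k; rewrite leq_exp2r // -addn2.
Qed.

Lemma poly_bounded_S f : poly_bounded f -> poly_bounded (fun M => (f M).+1).
Proof.
by move=> /poly_bounded_add/(_ (poly_bounded_const 1))[k fk]; exists k => M; rewrite -addn1.
Qed.

Ltac poly_bound := repeat first
  [ apply: poly_bounded_const | apply: poly_bounded_id | apply: poly_bounded_add
  | apply: poly_bounded_mul | apply: poly_bounded_pow2 | apply: poly_bounded_S ].

(** [M] bounds the input length and all variables at once: under [TSum] the induction hypothesis is
    used with [M] enlarged by the range of the index. *)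
Lemma eval_bounded t : exists k, forall x e M, size x <= M -> (forall i, e i <= M) ->
  eval x t e <= M.+2 ^ k.
Proof.
elim: t => [i|||t [k1 IH1]|t [k1 IH1] u [k2 IH2]|t [k1 IH1] u [k2 IH2]|t [k1 IH1] u [k2 IH2]] /=.
- by exists 1 => x e M _ eM; rewrite expn1; have := eM i; lia.
- by exists 0.
- by exists 1 => x e M; rewrite expn1; lia.
- by exists 0 => x e M; case: nth.
- have [k Bk] : poly_bounded (fun M => M.+2 ^ k1 + M.+2 ^ k2) by poly_bound.
  exists k => x e M xM eM; apply: leq_trans (Bk M).
  by rewrite leq_add ?IH1 ?IH2.
- by exists k1 => x e M xM eM; apply: leq_trans (leq_subr _ _) (IH1 _ _ _ _ _).
- have [k Bk] : poly_bounded (fun M => M.+2 ^ k1 * (M + M.+2 ^ k1).+2 ^ k2) by poly_bound.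
  exists k => x e M xM eM; apply: leq_trans (Bk M).
  have le1 := IH1 x e M xM eM; apply: leq_trans (leq_mul le1 (leqnn _)).
  rewrite -[X in _ <= X * _]card_ord -sum_nat_const.
  apply: leq_sum => i _; apply: IH2; first by lia.
  by case=> [|j] /=; [have := ltn_ord i; lia | have := eM j; lia].
Qed.

Lemma rcons_nseq n (b : bool) : rcons (nseq n b) b = nseq n.+1 b.
Proof. by elim: n => //= n ->. Qed.

Definition add_true (s : nat -> seq bool) d n := set_nth_fun s d (s d ++ nseq n true).

Ltac tracks := apply: functional_extensionality => ?; rewrite /add_true /set_nth_fun;
  repeat (case: eqP => ?); subst; rewrite ?cats0 ?rcons_cat ?rcons_nseq ?addn1 //; try lia.

(** * Compilation of terms into stack programs *)

Section Code.
Variable K : nat.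

Definition inc i := push K i true.
Definition skip := Act (fun s => (s, MStay)).

(** Stack [a] must survive. The counter [fr] is raised, together with [d], until the cell of [a]
    just above the height of [fr] is blank, that is, until both heights agree. *)
Definition copy a fr d := Seq (twhile K fr a isSome (Seq (inc fr) (inc d))) (clear K fr).

(* [code t r fr d] adds the value of [t] to the unary counter [d]; variable [i] is
   kept in track [r i], and the tracks from [fr] on are free. *)
Fixpoint code (t : term) (r : nat -> nat) (fr d : nat) : prog :=
  match t with
  | TVar k => copy (r k) fr d
  | TOne => inc d
  | TLen => copy 1 fr d
  | TBit t => Seq (code t r fr.+1 fr)
      (Seq (tif K fr 1 (fun s => s == Some true) (inc d) skip) (clear K fr))
  | TAdd t u => Seq (code t r fr d) (code u r fr d)
  | TSub t u => Seq (code t r fr.+2 fr) (Seq (code u r fr.+2 fr.+1)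
      (Seq (twhile K fr.+1 fr isSome (Seq (inc fr.+1) (inc d)))
        (Seq (clear K fr) (clear K fr.+1))))
  | TSum t u => Seq (code t r fr.+2 fr)
      (Seq (twhile K fr.+1 fr isSome (Seq (code u (scons fr.+1 r) fr.+2 d) (inc fr.+1)))
        (Seq (clear K fr) (clear K fr.+1)))
  end.

Fixpoint width (t : term) : nat :=
  match t with
  | TOne => 0
  | TVar _ | TLen => 1
  | TBit t => (width t).+1
  | TAdd t u => maxn (width t) (width u)
  | TSub t u | TSum t u => (maxn (width t) (width u)).+2
  end.

Hypothesis K_gt1 : 1 < K.

Let K_gt0 : 0 < K := ltnW K_gt1.

Lemma runs_skip {O lft} s : runs K O lft skip s s 1.
Proof. exact: (exec_mov MRight 0). Qed.

Lemma runs_inc {O lft} s i H : 0 < i < K -> s 0 = [:: true] -> size (s i) <= H ->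
  runs K O lft (inc i) s (add_true s i 1) (unit_time K H).
Proof. by move=> iK s0 le_H; rewrite /add_true cats1; apply: runs_push. Qed.

(** The invariant between fragments of [code]. A variable is the height of its stack; [M] bounds all
    stacks, hence also the input and the environment. *)
Record ready (x : seq bool) (e r : nat -> nat) (fr : nat) (s : nat -> seq bool) M : Prop := {
  ready_gt1 : 1 < fr;
  ready_r : forall i, r i < fr;
  ready_e : forall i, size (s (r i)) = e i;
  ready_fr : forall i, fr <= i -> s i = [::];
  ready_0 : s 0 = [:: true];
  ready_1 : s 1 = x;
  ready_M : forall i, size (s i) <= M }.

Lemma ready_eM x e r fr s M : ready x e r fr s M -> forall i, e i <= M.
Proof. by move=> rd i; rewrite -(ready_e rd) (ready_M rd). Qed.

Lemma ready_x x e r fr s M : ready x e r fr s M -> size x <= M.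
Proof. by move=> rd; rewrite -(ready_1 rd) (ready_M rd). Qed.

Lemma ready_fresh x e r fr s M : ready x e r fr s M -> forall c, fr <= c -> forall i, r i != c.
Proof. by move=> rd c le_c i; have := ready_r rd i; lia. Qed.

Lemma ready_add x e r fr d fr' s M n : ready x e r fr s M -> fr <= fr' ->
  1 < d < fr' -> (forall i, r i != d) -> ready x e r fr' (add_true s d n) (M + n).
Proof.
case=> gt1 r_ok e_ok fr_ok s0 s1 sM le_fr d_ok rd; split; rewrite /add_true /set_nth_fun.
- by lia.
- by move=> i; apply: leq_trans le_fr.
- by move=> i; rewrite (negbTE (rd i)).
- by move=> i le_i; case: eqP => [?|_]; [lia | apply: fr_ok; lia].
- by case: eqP => // ?; lia.
- by case: eqP => // ?; lia.
- move=> i; case: eqP => [_|_]; last by have := sM i; lia.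
  by rewrite size_cat size_nseq leq_add2r.
Qed.

Lemma ready_weaken x e r fr fr' s M M' :
  ready x e r fr s M -> fr <= fr' -> M <= M' -> ready x e r fr' s M'.
Proof.
case=> gt1 r_ok e_ok fr_ok s0 s1 sM le_fr le_M; split=> // [|i|i le_i|i].
- by lia.
- exact: leq_trans le_fr.
- by apply: fr_ok; lia.
- exact: leq_trans le_M.
Qed.

Lemma runs_copy {O lft} s a fr d M : a < fr -> fr < K -> 1 < d < fr -> a != d -> s fr = [::] ->
  s 0 = [:: true] -> (forall i, size (s i) <= M) ->
  runs K O lft (copy a fr d) s (add_true s d (size (s a)))
    (M.+1 * (unit_time K M + unit_time K (M + M) + unit_time K M) + unit_time K M).
Proof.
move=> lt_a lt_fr d_ok /eqP neq_ad sfr s0 sM.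
pose S k := add_true (add_true s d k) fr k.
have neq_fd : d <> fr by lia.
have neq_af : a <> fr by lia.
have Sfr k : S k fr = nseq k true by rewrite /S /add_true /set_nth_fun eqxx; case: eqP => [?|_]; [lia | rewrite sfr].
have Sa k : S k a = s a by rewrite /S /add_true /set_nth_fun; case: eqP => // _; case: eqP.
have S0 k : S k 0 = [:: true].
  by rewrite /S /add_true /set_nth_fun; case: eqP => [|_]; [lia | case: eqP => [|_]; [lia |]].
have SM k : size (S k d) <= M + k.
  rewrite /S /add_true /set_nth_fun; case: eqP => // _; rewrite eqxx.
  by rewrite size_cat size_nseq leq_add2r.
apply: runs_le (runs_seq (s1 := S (size (s a))) (t1 := (size (s a)).+1 * (unit_time K M + unit_time K (M + M) + unit_time K M))
  (t2 := unit_time K M) _ _) _.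
- have -> : s = S 0 by rewrite /S; tracks.
  rewrite (_ : size (S 0 a) = size (s a)); last by rewrite Sa.
  apply: runs_twhile => //; try lia.
  + by move=> k le_k; rewrite Sfr size_nseq; apply: leq_trans le_k (sM a).
  + by move=> k lt_k; rewrite Sfr size_nseq Sa onthTE.
  + by rewrite Sfr size_nseq Sa onthTE ltnn.
  + move=> k lt_k; have -> : S k.+1 = add_true (add_true (S k) fr 1) d 1.
      by rewrite /S; tracks; rewrite cats1 ?rcons_cat rcons_nseq.
    apply: runs_seq; apply: runs_inc; rewrite ?S0 //; try lia.
    * by rewrite Sfr size_nseq; apply: leq_trans (ltnW lt_k) (sM a).
    * by rewrite /add_true /set_nth_fun; case: eqP => // ?; lia.
    * rewrite {1}/add_true /set_nth_fun; case: eqP => // _; apply: leq_trans (SM k) _.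
      by have := sM a; lia.
- have -> : add_true s d (size (s a)) = set_nth_fun (S (size (s a))) fr [::].
    by rewrite /S; tracks.
  by apply: runs_clear; rewrite ?S0 ?Sfr ?size_nseq //; lia.
- by rewrite leq_add2r leq_mul2r ltnS sM orbT.
Qed.

(** The exponent depends on [t] and [K] alone: inside a loop the induction hypothesis is applied
    with a bound [V M], polynomial in [M], that covers every stack during the loop. The final stacks
    are described exactly, so all auxiliary tracks are empty again. *)
Lemma code_ok t : exists k, forall O lft x s e r fr d M,
  ready x e r fr s M -> 1 < d < fr -> (forall i, r i != d) -> fr + width t <= K ->
  runs K O lft (code t r fr d) s (add_true s d (eval x t e)) (M.+2 ^ k).
Proof.
elim: t => [i|||t [k1 IH1]|t [k1 IH1] u [k2 IH2]|t [k1 IH1] u [k2 IH2]|t [k1 IH1] u [k2 IH2]] /=.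
- have [k Bk] : poly_bounded (fun M => M.+1 * (unit_time K M + unit_time K (M + M) + unit_time K M) + unit_time K M).
    by rewrite /unit_time; poly_bound.
  exists k => O lft x s e r fr d M rd d_ok rd_d le_K; apply: runs_le (Bk M).
  have lt_ri := ready_r rd i; rewrite -(ready_e rd i); apply: runs_copy => //; first by lia.
  + exact: ready_fr rd _ _.
  + exact: ready_0 rd.
  + exact: ready_M rd.
- have [k Bk] : poly_bounded (unit_time K) by rewrite /unit_time; poly_bound.
  exists k => O lft x s e r fr d M rd d_ok rd_d le_K; apply: runs_le (Bk M).
  by apply: runs_inc; [lia | exact: ready_0 rd | exact: ready_M rd _].
- have [k Bk] : poly_bounded (fun M => M.+1 * (unit_time K M + unit_time K (M + M) + unit_time K M) + unit_time K M).
    by rewrite /unit_time; poly_bound.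
  exists k => O lft x s e r fr d M rd d_ok rd_d le_K; apply: runs_le (Bk M).
  rewrite -(ready_1 rd); apply: runs_copy => //; try lia.
  + exact: ready_fr rd _ _.
  + exact: ready_0 rd.
  + exact: ready_M rd.
- have [kv valB] := eval_bounded t.
  pose V M := M + M.+2 ^ kv.
  have [k Bk] : poly_bounded (fun M => M.+2 ^ k1 + (unit_time K (V M) + unit_time K (V M) + unit_time K (V M) + 1)).
    by rewrite /unit_time /V; poly_bound.
  exists k => O lft x s e r fr d M rd d_ok rd_d le_K; apply: runs_le (Bk M).
  have frr := ready_fresh rd; have v_le := valB _ _ _ (ready_x rd) (ready_eM rd).
  set v := eval x t e in v_le *; set s1 := add_true s fr v.
  have rd1 : ready x e r fr.+1 s1 (V M).
    by apply: ready_weaken (ready_add v rd (leqnSn _) _ (frr _ _)) _ _; rewrite /V; lia.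
  have s1fr : s1 fr = nseq v true by rewrite /s1 /add_true /set_nth_fun eqxx (ready_fr rd).
  have s10 := ready_0 rd1; have s1M := ready_M rd1.
  apply: runs_seq.
    by apply: (IH1 O lft x) (ready_weaken rd (leqnSn _) (leqnn _)) _ (frr _ _) _; lia.
  have -> : unit_time K (V M) + unit_time K (V M) + unit_time K (V M) + 1 = unit_time K (V M) + (unit_time K (V M) + 1) + unit_time K (V M) by lia.
  have test : (onth (s1 1) (size (s1 fr)) == Some true) = nth false x v.
    by rewrite (ready_1 rd1) s1fr size_nseq -odflt_onth; case: onth => // -[].
  apply: (runs_seq (s1 := add_true s1 d (nth false x v))).
    case E: (nth false x v) test => test.
      apply: runs_tif_true; rewrite ?test ?s10 //; try lia.
      apply: runs_le (runs_inc _ _ (s1M d)) _; rewrite ?s10 //; lia.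
    apply: runs_tif_false; rewrite ?test ?s10 //; try lia.
    have -> : add_true s1 d false = s1 by tracks.
    by apply: runs_le (runs_skip _) _; lia.
  have -> : add_true s d (nth false x v) = set_nth_fun (add_true s1 d (nth false x v)) fr [::].
    by rewrite /s1; tracks; rewrite (ready_fr rd).
  apply: runs_clear; rewrite /add_true /set_nth_fun //; try lia.
    by case: eqP => //; lia.
  by case: eqP => [|_]; [lia | exact: s1M].
- have [kv valB] := eval_bounded t.
  pose V M := M + M.+2 ^ kv.
  have [k Bk] : poly_bounded (fun M => M.+2 ^ k1 + (V M).+2 ^ k2) by rewrite /V; poly_bound.
  exists k => O lft x s e r fr d M rd d_ok rd_d le_K; apply: runs_le (Bk M).
  have frr := ready_fresh rd; have v_le := valB _ _ _ (ready_x rd) (ready_eM rd).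
  apply: runs_seq; first by apply: (IH1 O lft x) rd d_ok rd_d _; lia.
  have -> : add_true s d (eval x t e + eval x u e) = add_true (add_true s d (eval x t e)) d (eval x u e).
    by tracks; rewrite nseqD catA.
  by apply: (IH2 O lft x) (ready_weaken (ready_add _ rd (leqnn _) d_ok rd_d) (leqnn _) _) d_ok rd_d _; rewrite /V; lia.
- have [kv valB] := eval_bounded t; have [ku valBu] := eval_bounded u.
  pose V M := M + M.+2 ^ kv + M.+2 ^ ku + M.+2 ^ kv + M.+2 ^ kv.
  pose U M := unit_time K (V M).
  have [k Bk] : poly_bounded (fun M => M.+2 ^ k1 + ((V M).+2 ^ k2 + ((V M).+1 * (U M + U M + U M) + (U M + U M)))).
    by rewrite /U /unit_time /V; poly_bound.
  exists k => O lft x s e r fr d M rd d_ok rd_d le_K; apply: runs_le (Bk M).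
  have frr := ready_fresh rd.
  have v_le := valB _ _ _ (ready_x rd) (ready_eM rd); have w_le := valBu _ _ _ (ready_x rd) (ready_eM rd).
  set v := eval x t e in v_le *; set w := eval x u e in w_le *; set n := v - w.
  have le_nv : n <= v by exact: leq_subr.
  (* Raising [fr.+1] from [w] up to the height [v] of [fr] takes [v - w] rounds, and none if [w] is
     at least [v]: truncation comes for free. *)
  pose S k := add_true (add_true (add_true s fr v) fr.+1 (w + k)) d k.
  have rdS j : j <= n -> ready x e r fr.+2 (S j) (V M).
    move=> le_j; rewrite /S.
    by apply: ready_weaken (ready_add _ (ready_add _ (ready_add _ rd (leqnSn _) _ (frr _ _)) (leqnSn _) _ (frr _ _)) (leqnn _) _ rd_d) _ _; rewrite /V; lia.
  have Sfr j : S j fr = nseq v true.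
    by rewrite /S /add_true /set_nth_fun; (repeat case: eqP => ?); try lia; rewrite (ready_fr rd).
  have Sfr1 j : S j fr.+1 = nseq (w + j) true.
    by rewrite /S /add_true /set_nth_fun; (repeat case: eqP => ?); try lia; rewrite (ready_fr rd).
  apply: runs_seq; first by apply: (IH1 O lft x) (ready_weaken rd _ (leqnn _)) _ (frr _ _) _; lia.
  apply: runs_seq; first by apply: (IH2 O lft x) (ready_weaken (ready_add _ rd (leqnSn _) _ (frr _ _)) _ _) _ (frr _ _) _; rewrite /V; lia.
  apply: (runs_seq (s1 := S n)).
    have -> : add_true (add_true s fr v) fr.+1 w = S 0 by rewrite /S; tracks; rewrite addn0.
    apply: runs_le (runs_twhile (s := S) (r := n) (H := V M) (t := U M + U M) K_gt0 _ _ _ _ _ _ _) _ => //; try lia.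
    + by move=> j le_j; exact: ready_0 (rdS _ le_j).
    + by move=> j le_j; exact: ready_M (rdS _ le_j) _.
    + by move=> j le_j; rewrite Sfr Sfr1 size_nseq onthTE size_nseq; lia.
    + by rewrite Sfr Sfr1 size_nseq onthTE size_nseq; lia.
    + move=> j lt_j; have -> : S j.+1 = add_true (add_true (S j) fr.+1 1) d 1.
        by rewrite /S; tracks; rewrite -?catA -?nseqD ?addn1 ?addnS.
      have rdj := rdS _ (ltnW lt_j); have rdj1 := rdS _ lt_j.
      apply: runs_seq; apply: runs_inc; rewrite ?(ready_0 rdj) ?(ready_M rdj) //; try lia.
        by rewrite /add_true /set_nth_fun; case: eqP => [|_]; [lia | exact: ready_0 rdj].
      by rewrite /add_true /set_nth_fun; case: eqP => [|_]; [lia | exact: ready_M rdj _].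
    + by apply: leq_mul => //; rewrite ltnS /n /V; lia.
  have rdn := rdS _ (leqnn n).
  apply: (runs_seq (s1 := set_nth_fun (S n) fr [::])).
    by apply: runs_clear; rewrite ?(ready_0 rdn) ?(ready_M rdn) //; lia.
  have -> : add_true s d n = set_nth_fun (set_nth_fun (S n) fr [::]) fr.+1 [::].
    by rewrite /S; tracks; rewrite (ready_fr rd).
  apply: runs_clear; rewrite /set_nth_fun; try lia.
    by case: eqP => [|_]; [lia | exact: ready_0 rdn].
  by case: eqP => [|_]; [lia | exact: ready_M rdn _].
- have [kv valB] := eval_bounded t; have [ku valBu] := eval_bounded u.
  pose W M := (M + M.+2 ^ kv).+2 ^ ku.
  pose V M := M + M.+2 ^ kv + M.+2 ^ kv * W M + M.+2 ^ kv.
  pose U M := unit_time K (V M).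
  have [k Bk] : poly_bounded (fun M => M.+2 ^ k1 + ((V M).+1 * ((V M).+2 ^ k2 + U M + U M) + (U M + U M))).
    by rewrite /U /unit_time /V /W; poly_bound.
  exists k => O lft x s e r fr d M rd d_ok rd_d le_K; apply: runs_le (Bk M).
  have frr := ready_fresh rd.
  have v_le := valB _ _ _ (ready_x rd) (ready_eM rd).
  set v := eval x t e in v_le *.
  pose w i := eval x u (scons i e).
  have w_le i : i < v -> w i <= W M.
    move=> lt_i; apply: valBu; first by have := ready_x rd; lia.
    by case=> [|j] /=; [lia | have := ready_eM rd j; lia].
  pose a j := \sum_(i < j) w i.
  have a_le j : j <= v -> a j <= M.+2 ^ kv * W M.
    move=> le_j; apply: leq_trans (leq_mul (leq_trans le_j v_le) (leqnn _)).
    rewrite -[X in _ <= X * _]card_ord -sum_nat_const; apply: leq_sum => i _.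
    by apply: w_le; apply: leq_trans le_j.
  (* The loop counter in [fr.+1] is also the stack of the bound variable of [u], while [d]
     accumulates the partial sums [a k]. *)
  pose S k := add_true (add_true (add_true s fr v) fr.+1 k) d (a k).
  have rdS j : j <= v -> ready x e r fr.+2 (S j) (V M).
    move=> le_j; rewrite /S; have aj := a_le _ le_j.
    by apply: ready_weaken (ready_add _ (ready_add _ (ready_add _ rd (leqnSn _) _ (frr _ _)) (leqnSn _) _ (frr _ _)) (leqnn _) _ rd_d) _ _; rewrite /V; lia.
  have Sfr j : S j fr = nseq v true.
    by rewrite /S /add_true /set_nth_fun; (repeat case: eqP => ?); try lia; rewrite (ready_fr rd).
  have Sfr1 j : S j fr.+1 = nseq j true.
    by rewrite /S /add_true /set_nth_fun; (repeat case: eqP => ?); try lia; rewrite (ready_fr rd).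
  apply: runs_seq; first by apply: (IH1 O lft x) (ready_weaken rd _ (leqnn _)) _ (frr _ _) _; lia.
  rewrite -/(w _) -/(a v); apply: (runs_seq (s1 := S v)).
    have -> : add_true s fr v = S 0 by rewrite /S /a; tracks; rewrite big_ord0 ?cats0.
    apply: runs_le (runs_twhile (s := S) (r := v) (H := V M) (t := (V M).+2 ^ k2 + U M) K_gt0 _ _ _ _ _ _ _) _ => //; try lia.
    + by move=> j le_j; exact: ready_0 (rdS _ le_j).
    + by move=> j le_j; exact: ready_M (rdS _ le_j) _.
    + by move=> j le_j; rewrite Sfr Sfr1 size_nseq onthTE size_nseq; lia.
    + by rewrite Sfr Sfr1 size_nseq onthTE size_nseq; lia.
    + move=> j lt_j; have -> : S j.+1 = add_true (add_true (S j) d (w j)) fr.+1 1.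
        by rewrite /S /a; tracks; rewrite ?big_ord_recr -?catA -?nseqD ?addn1 ?addnS.
      have rdj := rdS _ (ltnW lt_j); have rdj1 := rdS _ lt_j.
      apply: runs_seq.
        apply: (IH2 O lft x _ (scons j e)); [|lia| |lia]; last by case=> [|i] //=; lia.
        case: rdj => p1 p2 p3 p4 p5 p6 p7; split => //.
        - by case=> [|i] /=.
        - by case=> [|i] /=; [rewrite Sfr1 size_nseq | apply: p3].
      apply: runs_inc; try lia.
        by rewrite /add_true /set_nth_fun; case: eqP => [|_]; [lia | exact: ready_0 rdj].
      by rewrite /add_true /set_nth_fun; case: eqP => [|_]; [lia | exact: ready_M rdj _].
    + by rewrite -addnA; apply: leq_mul => //; rewrite ltnS /V; lia.
  have rdn := rdS _ (leqnn v).
  apply: (runs_seq (s1 := set_nth_fun (S v) fr [::])).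
    by apply: runs_clear; rewrite ?(ready_0 rdn) ?(ready_M rdn) //; lia.
  have -> : add_true s d (a v) = set_nth_fun (set_nth_fun (S v) fr [::]) fr.+1 [::].
    by rewrite /S; tracks; rewrite (ready_fr rd).
  apply: runs_clear; rewrite /set_nth_fun; try lia.
    by case: eqP => [|_]; [lia | exact: ready_0 rdn].
  by case: eqP => [|_]; [lia | exact: ready_M rdn _].
Qed.

End Code.

(** * Reading the input and writing the output *)

Definition act w m : prog := Act (fun=> (w, m)).
Definition go m : prog := Act (fun s => (s, m)).

Lemma exec_w w m h T : exec (act w m) (h, T) (mv m h, upd T h w) 1.
Proof. exact: exec_act. Qed.

Lemma exec_go m h T : exec (go m) (h, T) (mv m h, T) 1.
Proof. by have := exec_act (fun s => (s, m)) h T; rewrite /= upd_id. Qed.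

Definition on_bit (p : bool -> prog) : prog :=
  If (fun s => s == Some true) (p true) (p false).

Lemma exec_on_bit p h (T : tape) b c t :
  T h = Some b -> exec (p b) (h, T) c t -> exec (on_bit p) (h, T) c t.+1.
Proof. by case: b => Th ex; [apply: exec_if_true | apply: exec_if_false]; rewrite ?Th. Qed.

Definition walk (b : option bool -> bool) m : prog := While b (mov m 1).

Lemma exec_right (b : option bool -> bool) h (T : tape) r : (forall j, j < r -> b (T (h + j))) -> ~~ b (T (h + r)) ->
  exec (walk b MRight) (h, T) (h + r, T) (r * 3).+1.
Proof.
move=> bT bF; have := @exec_walkR b 1 h T r; rewrite muln1; apply=> // j lt_j.
by rewrite muln1 bT.
Qed.

Lemma exec_left (b : option bool -> bool) h (T : tape) r : (forall j, j < r -> b (T (h + j.+1))) -> ~~ b (T h) ->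
  exec (walk b MLeft) (h + r, T) (h, T) (r * 3).+1.
Proof.
move=> bT bF; have := @exec_walkL b 1 h T r; rewrite muln1; apply=> // j lt_j.
by rewrite muln1 bT.
Qed.

(** * From the input word to the interleaved stacks *)

Section Spread.
Variable K : nat.
Hypothesis K_gt1 : 1 < K.
Let K_gt0 : 0 < K := ltnW K_gt1.

(** A walk to the left cannot notice cell 0, since a left move stays there. Shifting the input by
    one cell opens a blank that stops such walks. *)
Definition shift_right : prog :=
  Seq (walk isSome MRight) (Seq (go MLeft)
    (While isSome (on_bit (fun b =>
      Seq (act None MRight) (Seq (act (Some b) MLeft) (go MLeft)))))).

(* [x] with a blank inserted at position [m]. *)
Definition holed (x : seq bool) m : tape :=
  fun p => if p < m then onth x p else if p == m then None else onth x p.-1.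

Lemma exec_shift_right x : exec shift_right (0, onth x) (0, holed x 0) (size x * 8 + 3).
Proof.
have loop m : m <= size x ->
    exec (While isSome (on_bit (fun b => Seq (act None MRight) (Seq (act (Some b) MLeft) (go MLeft)))))
      (m.-1, holed x m) (0, holed x 0) (m * 5).+1.
  elim: m => [|m IH] le_m; first by apply: exec_while_false.
  have [b Eb] : exists b, onth x m = Some b.
    by case E: (onth x m) => [b|]; [exists b | have := onthTE x m; rewrite E le_m].
  have Tm : holed x m.+1 m = Some b by rewrite /holed ltnSn.
  apply: exec_le (exec_while_true (t := 4) (t' := (m * 5).+1) _ _ (IH (ltnW le_m))) _.
  - by rewrite /= Tm.
  - apply: (exec_on_bit (b := b)) => //=.
    apply: (exec_seq (t1 := 1) (exec_w _ _ _ _)); apply: (exec_seq (t1 := 1) (exec_w _ _ _ _)).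
    rewrite /=; have <- : upd (upd (holed x m.+1) m None) m.+1 (Some b) = holed x m.
      apply: functional_extensionality => p; rewrite /upd /holed.
      case: (ltngtP p m.+1) => [lt_p|lt_p|->]; last by rewrite /= ltnNge leqnSn gtn_eqF.
        by case: (ltngtP p m) => // lt_p'; lia.
      by rewrite ltnNge gtn_eqF //; case: ltngtP => //; lia.
    exact: exec_go.
  - by rewrite mulSn; lia.
have Tn : onth x = holed x (size x).
  apply: functional_extensionality => p; rewrite /holed; case: ltnP => // le_p.
  rewrite (onth_default le_p); case: eqP => // neq_p; rewrite onth_default //; lia.
apply: exec_le (exec_seq (exec_right (r := size x) _ _) (exec_seq (exec_go _ _ _) _)) _.
- by move=> j; rewrite add0n onthTE.
- by rewrite add0n onthTE ltnn.
- rewrite add0n /= {1}Tn; exact: loop.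
- by lia.
Qed.

(** Each round takes the leftmost remaining bit, found by walking left to a blank, so that the bits
    reach stack 1 in order. The cell between input and stacks stays blank as the stop for walks to
    the right and is marked only at the end. *)
Definition spread : prog :=
  Seq shift_right
  (Seq (go MRight) (Seq (walk isSome MRight) (Seq (go MRight) (Seq (act (Some true) MLeft) (Seq (go MLeft)
  (Seq (While isSome (Seq (walk isSome MLeft) (Seq (go MRight)
          (on_bit (fun b => Seq (act None MRight) (Seq (walk isSome MRight) (Seq (go MRight)
             (Seq (push K 1 b) (mov MLeft 2)))))))))
  (Seq (go MRight) (act (Some true) MRight)))))))).

Definition init_stacks (x : seq bool) : nat -> seq bool :=
  fun k => if k == 0 then [:: true] else if k == 1 then x else [::].

(** With the mark in the cell left of [O], the home marker is the only mark met by [find_left] whose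
    left neighbour is not blank; this ends the loop of [compact]. *)
Definition wall n : tape := fun p => if p == n then Some true else None.

Lemma exec_spread x : let n := size x in
  exec spread (0, onth x) (n.+2, lay K n.+2 (wall n.+1) (init_stacks x))
    (20 * unit_time K n * n.+2).
Proof.
move=> n; have En : size x = n by [].
clearbody n; set O := n.+2.
(* The part left of [O] once [i] bits have been moved; because of the shift, cell [p] carries bit
   [p.-1]. *)
pose A i : tape := fun p => if (i < p) && (p <= n) then onth x p.-1 else None.
pose L i := lay K O (A i) (init_stacks (take i x)).
have Tn : holed x 0 = lay K O (A 0) (fun=> [::]).
  apply: functional_extensionality => p; rewrite /holed /lay /A /= onth0n.
  case: p => [|p] //=; rewrite /O ltnS; case: ltnP => lt_p; last by rewrite onth_default // En ltnW.
  by case: ltnP => // le_p; rewrite onth_default // En.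
have TL : upd (holed x 0) O (Some true) = L 0.
  rewrite Tn; have := @upd_lay K O (A 0) K_gt0 (fun=> [::]) (init_stacks (take 0 x)) 0 0 (Some true).
  rewrite !addn0; apply=> //; first by case=> [|[|k]] //; rewrite /init_stacks take0.
  by case=> [|[|j]].
have LA i p : p < O -> L i p = A i p by rewrite /L /lay => ->.
have LO i : L i O = Some true.
  by have := lay_at O (A i) K_gt0 (init_stacks (take i x)) 0 K_gt0; rewrite !addn0.
have Aonth i p : i <= p < n -> exists b, onth x p = Some b /\ A i p.+1 = Some b.
  move=> /andP[le_i lt_p]; case E: (onth x p) => [b|]; last by have := onthTE x p; rewrite E En lt_p.
  by exists b; rewrite /A ltnS le_i lt_p.
rewrite /spread; set body := Seq (walk isSome MLeft) _.
have step i : i < n -> exec (walk isSome MLeft) (n, L i) (i, L i) ((n - i) * 3).+1.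
  move=> lt_i; rewrite -{1}(subnKC (ltnW lt_i)); apply: exec_left.
    move=> j lt_j; rewrite LA; last by rewrite /O; lia.
    by rewrite addnS; have [|b [_ ->]] := @Aonth i (i + j); first lia.
  by rewrite LA ?/A ?ltnn // /O; lia.
have loop d i : d + i = n ->
    exec (While isSome body) (n, L i) (n, L n) (d * (unit_time K n + n * 6 + 20)).+1.
  elim: d i => [|d IH] i Ei.
    have -> : i = n by lia.
    by have := @exec_while_false isSome body n (L n); rewrite LA ?/A ?ltnn // => /(_ isT) ex; apply: exec_le ex _.
  have lt_i : i < n by lia.
  have [|b [xi Ai]] := @Aonth i i; first by lia.
  have LnS : isSome (L i n).
    have [|b' [_ E]] := @Aonth i n.-1; first by lia.
    by rewrite LA // -(ltn_predK lt_i) E.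
  apply: exec_le (exec_while_true (t := unit_time K n + n * 6 + 19) LnS _ (IH i.+1 _)) _; first last.
  - by rewrite mulSn; lia.
  - by lia.
  apply: exec_le (exec_seq (step i lt_i) (exec_seq (exec_go _ _ _) (exec_on_bit (b := b) _ _))) _.
  - by rewrite /= LA // /O; lia.
  - apply: (exec_seq (exec_w _ _ _ _)).
    have -> : upd (L i) (mv MRight i) None = lay K O (A i.+1) (init_stacks (take i x)).
      apply: functional_extensionality => p; rewrite /upd /L /lay /=.
      case: eqP => [->|neq_p]; first by rewrite ifT ?/A ?ltnn // /O; lia.
      case: ltnP => // lt_p; rewrite /A; case: (ltngtP i.+1 p) => //; last by lia.
    set L' := lay K O (A i.+1) _.
    apply: (exec_seq (c1 := (n.+1, L')) (t1 := (n - i.+1) * 3 + 1)).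
      have -> : n.+1 = i.+2 + (n - i.+1) by lia.
      rewrite addn1; apply: exec_right.
        move=> j lt_j; rewrite /L' /lay ifT; last by rewrite /O /=; lia.
        by have [|b' [_ E]] := @Aonth i.+1 (i.+1 + j); [lia | rewrite /= addSn E].
      have -> : i.+2 + (n - i.+1) = n.+1 by lia.
      by rewrite /L' /lay ifT /A ?ltnn ?andbF.
    apply: (exec_seq (exec_go _ _ _)).
    apply: (exec_seq (c1 := (O, L i.+1)) (t1 := unit_time K n)).
      rewrite /L; have -> : init_stacks (take i.+1 x) = set_nth_fun (init_stacks (take i x)) 1 (rcons (take i x) b).
        apply: functional_extensionality => k; rewrite /init_stacks /set_nth_fun.
        case: k => [|[|k]] //=; rewrite (take_nth false) ?En //.
        by rewrite -odflt_onth xi.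
      apply: runs_push => //; rewrite /init_stacks /= size_take; case: ifP => _; lia.
    have := exec_movL 2 O (L i.+1); rewrite {2}/O subSS subSS subn0; exact.
  - by rewrite /=; lia.
have Lfin : upd (L n) n.+1 (Some true) = lay K O (wall n.+1) (init_stacks x).
  apply: functional_extensionality => p; rewrite /upd /L /lay take_oversize ?En //.
  case: eqP => [->|neq_p]; first by rewrite /O ltnSn /wall eqxx.
  case: ltnP => // lt_p; rewrite /wall /A; case: eqP => // _.
  by case: ltnP => //= ?; rewrite ifF //; lia.
apply: exec_le (exec_seq (exec_shift_right x) (exec_seq (exec_go _ _ _)
  (exec_seq (c1 := (n.+1, holed x 0)) (t1 := n * 3 + 1) _ (exec_seq (exec_go _ _ _)
  (exec_seq (exec_w _ _ _ _) (exec_seq (c1 := (n, L 0)) (t1 := 1) _ (exec_seq (loop n 0 (addn0 n)) (exec_seq (exec_go _ _ _) _)))))))) _.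
- rewrite addn1 -[n.+1]/(1 + n); apply: exec_right.
    by move=> j lt_j; rewrite add1n /holed /= onthTE En.
  by rewrite add1n /holed /= onthTE En ltnn.
- by rewrite /= -/O TL; exact: exec_go.
- by have := exec_w (Some true) MRight n.+1 (L n); rewrite Lfin; exact.
- rewrite En /unit_time; nia.
Qed.

End Spread.

(** * From a stack to the contiguous output word *)

Section Compact.
Variables (K n : nat).
Hypothesis K_gt2 : 2 < K.
Let K_gt0 : 0 < K := ltnW (ltnW K_gt2).
Local Notation O := n.+2.

Definition find_left : prog :=
  Seq (go MLeft) (Seq (walk blank MLeft) (go MLeft)).

(* Stack 2, with a final sentinel, is made contiguous from its top down; the blank
   cell to the left of a bit of stack 2 distinguishes it from the home marker. *)
Definition compact : prog :=
  Seq (goto K 2) (Seq (mov MLeft K) (Seq find_left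
  (Seq (While blank (Seq (go MRight) (Seq (on_bit (fun b =>
      Seq (act None MRight) (Seq (walk blank MRight) (Seq (go MLeft) (act (Some b) MStay)))))
      find_left)))
  (Seq (mov MRight 2) (Seq (walk blank MRight) (Seq (walk isSome MRight)
  (Seq (go MLeft) (Seq (act None MLeft) (Seq (walk isSome MLeft) (go MRight)))))))))).

Definition final_stacks (o : seq bool) : nat -> seq bool :=
  fun k => if k == 0 then [:: true] else if k == 2 then o else [::].

Variable o : seq bool.
Let o' := rcons o true.
Let m := size o.
Let F i := lay K O (wall n.+1) (final_stacks (take i o)).
(** While [i] bits are still interleaved, the other bits and the sentinel fill the cells from [st i]
    up to the fixed place [O + 2 + m * K] of the sentinel; [C i] is the tape at that moment. *)
Let st i := O + 2 + m * K - (m - i).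
Let C i : tape := fun p => if p < st i then F i p else onth (drop i o') (p - st i).

Lemma lay_final_blank i p : O < p -> (forall q, q < i -> p <> O + 2 + q * K) -> F i p = None.
Proof.
move=> lt_p hp; rewrite /F /lay ltnNge (ltnW lt_p) /= /final_stacks.
have := divn_eq (p - O) K; have := ltn_pmod (p - O) K_gt0.
set q := _ %/ _; set r := _ %% _ => lt_r Ep.
case: eqP => [r0|_].
  by case: q Ep => [|q] Ep; [lia | rewrite onth_default].
case: eqP => [r2|_]; last by rewrite onth0n.
rewrite onth_default // size_take_min; apply: leq_trans (geq_minl _ _) _.
by rewrite leqNgt; apply/negP => /hp; lia.
Qed.

Lemma st_gap i : i <= m -> O + 2 + i * K <= st i /\ (i < m -> O + 2 + i * K < st i).
Proof.
move=> le_i; rewrite /st.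
have -> : m * K = i * K + (m - i) * K by rewrite -mulnDl subnKC.
by nia.
Qed.

Lemma st_S i : i < m -> st i.+1 = (st i).+1.
Proof.
move=> lt_i; rewrite /st; have [h _] := st_gap (leqnn m); rewrite /st in h.
have : m <= m * K by rewrite leq_pmulr.
by lia.
Qed.

Lemma C_blank i p : i <= m -> O < p < st i -> (forall q, q < i -> p <> O + 2 + q * K) -> C i p = None.
Proof. by move=> le_i /andP[lt_Op lt_p] hp; rewrite /C lt_p lay_final_blank. Qed.

Lemma C_mark i : i <= m -> C i O = Some true /\ C i n.+1 = Some true.
Proof.
move=> le_i; have [gap _] := st_gap le_i.
rewrite /C !ifT; try by lia.
split; last by rewrite /F /lay ltnSn /wall eqxx.
by have := lay_at O (wall n.+1) K_gt0 (final_stacks (take i o)) 0 K_gt0; rewrite !addn0.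
Qed.

Lemma C_data i b : onth o i = Some b -> C i.+1 (O + 2 + i * K) = Some b.
Proof.
move=> oi; have lt_i : i < m by rewrite /m -onthTE oi.
have [gap _] := st_gap lt_i; rewrite mulSn in gap.
rewrite /C ifT; last by lia.
rewrite /F lay_at //= -oi !onthE map_take nth_take //.
Qed.

Lemma C_start i p : i <= m -> C i (st i + p) = onth (drop i o') p.
Proof. by move=> le_i; rewrite /C ltnNge leq_addr /= addKn. Qed.

(** The last nonblank cell before the block: the topmost bit not yet moved, or the home marker when
    none is left. *)
Definition mark i := if i is j.+1 then O + 2 + j * K else O.

Lemma mark_lt i : i <= m -> O <= mark i /\ mark i < st i.
Proof. by move=> le_i; have [] := st_gap le_i; case: i le_i => [|j] le_i; rewrite ?mulSn /=; lia. Qed.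

Lemma C_gap i p : i <= m -> mark i < p < st i -> C i p = None.
Proof.
move=> le_i hp; have [h1 h2] := mark_lt le_i.
apply: C_blank => // [|q lt_q Ep]; first by lia.
move: hp {h1 h2}; case: i le_i lt_q => [|j] //= le_i lt_q hp.
have : q * K <= j * K by rewrite leq_mul2r -ltnS lt_q orbT.
by lia.
Qed.

Lemma exec_find_left i : i <= m ->
  exec find_left (st i, C i) ((mark i).-1, C i) (m * K * 3 + 20).
Proof.
move=> le_i; have [c1 c2] := mark_lt le_i.
have Cc : isSome (C i (mark i)).
  case: i le_i {c1 c2} => [|j] le_j /=; first by have [->] := C_mark (leq0n m).
  by case E: (onth o j) => [b|]; [rewrite (C_data E) | have := onthTE o j; rewrite E le_j].
apply: exec_le (exec_seq (exec_go _ _ _) (exec_seq (c1 := (mark i, C i)) (t1 := (m * K + 5) * 3) _ (exec_go _ _ _))) _.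
- have -> : mv MLeft (st i) = mark i + ((st i).-1 - mark i) by rewrite /=; lia.
  apply: exec_le (exec_left _ _) _; last by rewrite /st; lia.
    by move=> j lt_j; rewrite C_gap //; lia.
  by rewrite /blank negbK.
- by lia.
Qed.

Lemma C_step i b : onth o i = Some b ->
  upd (upd (C i.+1) (O + 2 + i * K) None) (st i) (Some b) = C i.
Proof.
move=> oi; have lt_i : i < m by rewrite /m -onthTE oi.
have [gap gap'] := st_gap (ltnW lt_i); have {}gap' := gap' lt_i; have stS := st_S lt_i.
have -> : upd (C i.+1) (O + 2 + i * K) None =
   fun p => if p < (st i).+1 then F i p else onth (drop i.+1 o') (p - (st i).+1).
  apply: functional_extensionality => p; rewrite /upd /C stS.
  have Fup : upd (F i.+1) (O + 2 + i * K) None = F i.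
    apply: upd_lay => //; first by case=> [|[|[|k]]].
    move=> j; rewrite /final_stacks /= !onthE !map_take.
    case: eqP => [->|neq_j].
      by rewrite nth_default // size_take_min geq_minl.
    case: (ltnP j i) => lt_j; first by rewrite !nth_take // ltnW.
    by rewrite !nth_default // size_take_min; apply: leq_trans (geq_minl _ _) _; lia.
  rewrite -Fup /upd; case: eqP => [->|//].
  by rewrite ifT //; lia.
apply: functional_extensionality => p; rewrite /upd /C.
case: eqP => [->|neq_p].
  by rewrite ltnn subnn /o' onthE map_drop nth_drop addn0 -onthE -cats1 onth_cat -/m lt_i oi.
rewrite ltnS leq_eqVlt; case: eqP => [//|_] /=; case: ltnP => // le_p.
have -> : p - st i = (p - (st i).+1).+1 by lia.
by rewrite !onthE !map_drop !nth_drop addSnnS.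
Qed.

(** Thanks to the sentinel, the search for the block from the left ends even if [o] is empty.
    Erasing it afterwards leaves [o] followed by a blank, with the head on the first cell. *)
Lemma exec_compact : exists c, exec compact (O, lay K O (wall n.+1) (final_stacks o'))
  c ((m.+1 * K + 100) * 20 * m.+2) /\ (forall i, i <= size o -> c.2 (c.1 + i) = onth o i).
Proof.
have [gap0 gap0'] := st_gap (leqnn m).
have stm : st m = O + 2 + m * K by rewrite /st subnn subn0.
have szo' : size o' = m.+1 by rewrite size_rcons.
have drop_m : drop m o' = [:: true] by rewrite /o' -cats1 drop_size_cat.
have Cm : lay K O (wall n.+1) (final_stacks o') = C m.
  have <- : upd (F m) (O + 2 + m * K) (Some true) = lay K O (wall n.+1) (final_stacks o').
    apply: upd_lay => //; first by case=> [|[|[|k]]].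
    move=> j; rewrite /final_stacks /= take_oversize // /o' -cats1 onth_cat.
    case: ltngtP => [lt_j|lt_j|->]; rewrite ?subnn //.
    by rewrite !onth_default //=; lia.
  apply: functional_extensionality => p; rewrite /upd /C stm.
  case: eqP => [->|neq_p]; first by rewrite ltnn subnn drop_m.
  case: ltnP => // le_p; rewrite lay_final_blank ?drop_m; first by rewrite onth_default //=; lia.
    by lia.
  by move=> q lt_q; have : q * K <= m * K by [rewrite leq_mul2r ltnW ?orbT]; lia.
rewrite /compact; set body := Seq (go MRight) (Seq (on_bit _) find_left).
have loop i : i <= m -> exec (While blank body)
    ((mark i).-1, C i) (n.+1, C 0) (i * (m * K * 8 + 70)).+1.
  elim: i => [|i IH] le_i.
    by apply: exec_while_false; have [_ ->] := C_mark (leq0n m).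
  have [b oi] : exists b, onth o i = Some b.
    by case E: (onth o i) => [b|]; [exists b | have := onthTE o i; rewrite E le_i].
  have [gap gap'] := st_gap le_i; have [h1 h2] := mark_lt le_i; have stS := st_S le_i.
  have [gap1 gap1'] := st_gap (ltnW le_i); have {}gap1' := gap1' le_i.
  have mE : mark i.+1 = O + 2 + i * K by [].
  apply: exec_le (exec_while_true (t := m * K * 8 + 69) _ _ (IH (ltnW le_i))) _; first last.
  - by rewrite mulSn; lia.
  - apply: exec_le (exec_seq (exec_go _ _ _) (exec_seq (c1 := (st i, C i)) (t1 := m * K * 3 + 25) _ (exec_find_left (ltnW le_i)))) _; last by lia.
    have -> : mv MRight (mark i.+1).-1 = mark i.+1 by rewrite mE /=; lia.
    apply: exec_le (exec_on_bit (C_data oi) _) _.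
      apply: exec_seq (exec_w _ _ _ _) _.
      set T := upd _ _ _.
      apply: (exec_seq (c1 := (st i.+1, T)) (t1 := (st i - mark i.+1) * 3 + 1)).
        have -> : mv MRight (mark i.+1) = (mark i.+1).+1 by [].
        have {1}-> : st i.+1 = (mark i.+1).+1 + (st i - mark i.+1) by lia.
        rewrite addn1; apply: exec_right.
          move=> j lt_j; rewrite /T /upd; case: eqP => // _.
          by rewrite C_gap //; lia.
        have -> : (mark i.+1).+1 + (st i - mark i.+1) = st i.+1 by lia.
        rewrite /T /upd; case: eqP => [|_]; first by lia.
        by rewrite -[st i.+1]addn0 C_start // /blank negbK onthTE size_drop szo'; lia.
      apply: exec_seq (exec_go _ _ _) _.
      have E : upd T (st i) (Some b) = C i by exact: C_step.
      by rewrite stS -E; apply: exec_w.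
    by rewrite mE /st; lia.
  - rewrite C_blank //; first by rewrite mE /=; lia.
    move=> q lt_q; rewrite mE /= => E.
    have : i * K = q * K + 1 by lia.
    by case: (ltngtP i q) => [lt|lt|->]; [| have : q.+1 * K <= i * K by [rewrite leq_mul2r lt orbT] | ]; rewrite ?mulSn; lia.
have [st0 _] := st_gap (leq0n m); rewrite mul0n addn0 in st0.
have st0E : st 0 + m = O + 2 + m * K.
  by rewrite /st; have : m <= m * K by [rewrite leq_pmulr]; lia.
pose T := upd (C 0) (st 0 + m) None.
have To i : i <= m -> T (st 0 + i) = onth o i.
  move=> le_i; rewrite /T /upd eqn_add2l.
  case: eqP => [->|neq_i]; first by rewrite onth_default.
  by rewrite C_start // drop0 /o' -cats1 onth_cat ifT //; rewrite -/m; lia.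
exists (st 0, T); split; last exact: To.
apply: exec_le (exec_seq (exec_goto _ _ K_gt0 _ _) (exec_seq (c1 := (st m, C m)) (t1 := K.+1) _ (exec_seq (exec_find_left (leqnn m))
  (exec_seq (loop m (leqnn m)) (exec_seq (exec_movR _ _ _)
  (exec_seq (c1 := (st 0, C 0)) (t1 := m * K * 3 + 10) _ (exec_seq (c1 := ((st 0 + m).+1, C 0)) (t1 := m * 3 + 4) _
  (exec_seq (exec_go _ _ _) (exec_seq (exec_w _ _ _ _)
  (exec_seq (c1 := ((st 0).-1, T)) (t1 := m * 3 + 1) (t2 := 1) _ _)))))))))) _.
- by [].
- rewrite /= szo' Cm; have := exec_movL K (O + 2 + m.+1 * K) (C m).
  have -> : O + 2 + m.+1 * K - K = st m by rewrite stm mulSn; lia.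
  exact.
- have {1}-> : st 0 = n.+1 + 2 + (st 0 - O - 1) by lia.
  apply: exec_le (exec_right (r := st 0 - O - 1) _ _) _.
  + move=> j lt_j; rewrite C_gap //=; lia.
  + have -> : n.+1 + 2 + (st 0 - O - 1) = st 0 + 0 by lia.
    by rewrite C_start // drop0 /blank negbK onthTE szo'.
  + by rewrite /st; lia.
- have -> : (st 0 + m).+1 = st 0 + m.+1 by lia.
  apply: exec_le (exec_right (r := m.+1) _ _) _; last by lia.
    by move=> j lt_j; rewrite C_start // drop0 onthTE szo'.
  by rewrite C_start // drop0 onthTE szo' ltnn.
- have -> : mv MLeft (mv MLeft (st 0 + m).+1) = (st 0).-1 + m by rewrite /=; lia.
  rewrite -[upd _ _ _]/T addn1; apply: exec_left.
    move=> j lt_j; have -> : (st 0).-1 + j.+1 = st 0 + j by lia.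
    by rewrite To ?onthTE // ltnW.
  by rewrite /T /upd; case: eqP => [|_]; [lia | rewrite C_gap //=; lia].
- by have := exec_go MRight (st 0).-1 T; rewrite /= prednK //; lia.
- by rewrite szo'; nia.
Qed.
End Compact.

(** For [n >= 2] the inequality [n + 2 <= n ^ 2] changes the base; for [n <= 1] powers of [n] do not
    help and the constant [3 ^ k] is used. Strictness is what [tm_of_run] asks for. *)
Lemma poly_bounded_time f : poly_bounded f -> exists k, forall n, f n < n ^ k + k.
Proof.
move=> [k fk]; exists (k * 2 + 3 ^ k).+1 => n; apply: leq_ltn_trans (fk n) _.
case: n => [|[|n]].
- have : 2 ^ k <= 3 ^ k by case: k {fk} => // k; rewrite leq_exp2r.
  by lia.
- by lia.
- have : n.+4 ^ k <= n.+2 ^ (k * 2).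
    rewrite mulnC expnM; case: k {fk} => // k; rewrite leq_exp2r //; nia.
  have : n.+2 ^ (k * 2) <= n.+2 ^ (k * 2 + 3 ^ k).+1 by rewrite leq_exp2l //; lia.
  by lia.
Qed.

Lemma ready_init x :
  ready x (fun=> 0) (fun=> 3) 5 (init_stacks x) (size x).+1.
Proof. by split=> //; case=> [|[|i]] //=; rewrite /init_stacks /=; lia. Qed.

Lemma term_in_P t : in_P (fun x => eval x t (fun=> 0) != 0).
Proof.
pose K := 5 + width t.
have K_gt1 : 1 < K by rewrite /K; lia.
have [k codeE] := code_ok K_gt1 t.
(* Stack 3 is empty and represents every variable as 0. Visiting stack 4 at the height of stack 3
   leaves the head on the bottom cell of the result, which is [Some true] exactly for a nonzero
   value. *)
pose p := Seq (spread K) (Seq (code K t (fun=> 3) 5 4) (visit K 3 4)).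
have [d Bd] : exists d, forall n, 20 * unit_time K n * n.+2 + ((n.+1).+2 ^ k + K.+2 * 4) < n ^ d + d.
  by apply: poly_bounded_time; rewrite /unit_time; poly_bound.
exists (tm_of p), d => x /=; set v := eval x t (fun=> 0).
set n := size x; pose s1 := add_true (init_stacks x) 4 v.
have exC : runs K n.+2 (wall n.+1) (code K t (fun=> 3) 5 4) (init_stacks x) s1 ((n.+1).+2 ^ k).
  exact: codeE (ready_init x) _ _ _.
have exV := exec_visit n.+2 (wall n.+1) (ltnW K_gt1) s1 (isT : 3 < K) (isT : 4 < K).
have exAll := exec_seq (exec_spread K_gt1 x) (exec_seq exC exV).
have := tm_of_run exAll (Bd n); rewrite -/p => /(congr1 (fun c => c.1.1)) /= ->; split=> //.
rewrite (lay_at _ _ (ltnW K_gt1)) // /s1 /add_true /set_nth_fun /=.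
by clear -v; clearbody v; case: v.
Qed.

Lemma term_computes N F : exists M, poly_computes M
  (fun x => mkseq (fun i => eval x F (scons i (fun=> 0)) != 0) (eval x N (fun=> 0))).
Proof.
pose K := 7 + (width N + width F).
have K_gt2 : 2 < K by rewrite /K; lia.
have K_gt1 := ltnW K_gt2; have K_gt0 := ltnW K_gt1.
have [kN codeN] := code_ok K_gt1 N.
have [kF codeF] := code_ok K_gt1 F.
have [vN valN] := eval_bounded N.
have [vF valF] := eval_bounded F.
(* Stack 4 holds the length, 5 the index (variable 0 of [F]), 6 the value of [F] and 2 the output.
   As stack 3 is empty, the [tif] asks whether stack 6 is empty. Clearing stack 1 blanks the left
   neighbours of the output cells, on which [compact] relies. *)
pose p := Seq (spread K) (Seq (code K N (fun=> 3) 6 4)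
  (Seq (twhile K 5 4 isSome (Seq (code K F (scons 5 (fun=> 3)) 7 6)
     (Seq (tif K 3 6 isSome (push K 2 true) (push K 2 false)) (Seq (clear K 6) (inc K 5)))))
  (Seq (Seq (clear K 4) (Seq (clear K 5) (Seq (clear K 1) (push K 2 true)))) (compact K)))).
pose V n := n.+1 + n.+1.+2 ^ vN.
pose W n := V n + (V n).+2 ^ vF.
pose U n := unit_time K (W n).
pose B n := 20 * unit_time K n * n.+2 + ((n.+1).+2 ^ kN +
  ((V n).+1 * ((V n).+2 ^ kF + ((U n + U n) + (U n + U n)) + U n) +
  ((U n + (U n + (U n + U n))) + ((V n).+1 * K + 100) * 20 * (V n).+2))).
have [d Bd] : exists d, forall n, B n < n ^ d + d.
  by apply: poly_bounded_time; rewrite /B /U /unit_time /W /V; poly_bound.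
exists (tm_of p), d => x /=; set v := eval x N (fun=> 0).
set n := size x; pose O := n.+2.
have v_le : v <= n.+1.+2 ^ vN by apply: valN => //; apply: ltnW.
have vV : n + v < V n by rewrite /V; lia.
pose f i := eval x F (scons i (fun=> 0)).
have f_le i : i < v -> f i <= (V n).+2 ^ vF.
  by move=> lt_i; apply: valF => [|[|j]] //=; rewrite /V -/n; lia.
pose S k : nat -> seq bool := fun c =>
  if c == 4 then nseq v true else if c == 5 then nseq k true else
  if c == 2 then mkseq (fun i => f i != 0) k else init_stacks x c.
have rdS k : k <= v -> ready x (scons k (fun=> 0)) (scons 5 (fun=> 3)) 7 (S k) (V n).
  move=> le_k; split=> //.
  - by case.
  - by case=> [|i] //=; rewrite /S /= size_nseq.
  - by do 7!case=> //.
  - move: (V n) vV => Vn vV; case=> [|[|[|[|[|[|i]]]]]] //=; rewrite /S /= ?size_nseq ?size_mkseq //;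
      rewrite ?/init_stacks /= -?/n; lia.
have VW : V n <= W n by rewrite leq_addr.
have SM k c : k <= v -> size (S k c) <= W n.
  by move=> le_k; apply: leq_trans VW; apply: ready_M (rdS k le_k) c.
have exN : runs K O (wall n.+1) (code K N (fun=> 3) 6 4) (init_stacks x) (S 0) (n.+1.+2 ^ kN).
  have -> : S 0 = add_true (init_stacks x) 4 v.
    by apply: functional_extensionality; rewrite /S /add_true /set_nth_fun; do 6!case=> //.
  apply: codeN => //; last by rewrite /K; lia.
  by apply: ready_weaken (ready_init x) _ _.
have exL : runs K O (wall n.+1) (twhile K 5 4 isSome (Seq (code K F (scons 5 (fun=> 3)) 7 6)
     (Seq (tif K 3 6 isSome (push K 2 true) (push K 2 false)) (Seq (clear K 6) (inc K 5)))))
   (S 0) (S v) ((V n).+1 * ((V n).+2 ^ kF + ((U n + U n) + (U n + U n)) + U n)).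
  apply: runs_le (runs_twhile (s := S) (r := v) (H := W n)
    (t := (V n).+2 ^ kF + ((U n + U n) + (U n + U n))) K_gt0 _ _ _ _ _ _ _) _ => //.
  - by move=> k le_k; apply: SM.
  - by move=> k lt_k; rewrite /S /= onthTE !size_nseq.
  - by rewrite /S /= onthTE !size_nseq ltnn.
  - move=> k lt_k; have rdk := rdS k (ltnW lt_k).
    apply: runs_seq; first by apply: (codeF _ _ x) rdk _ _ _ => //; [case | rewrite /K; lia].
    rewrite -/(f k); set s1 := add_true _ 6 (f k).
    have s1M c : size (s1 c) <= W n.
      rewrite /s1 /add_true /set_nth_fun; case: eqP => _; last by apply: SM; apply: ltnW.
      by rewrite /S /= size_nseq /W; have := f_le _ lt_k; lia.
    apply: (runs_seq (s1 := set_nth_fun s1 2 (rcons (s1 2) (f k != 0)))).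
      case: (posnP (f k)) => [fk0|fk_gt0].
        apply: runs_tif_false => //; first by rewrite /s1 /add_true /set_nth_fun /= fk0.
        exact: runs_push.
      apply: runs_tif_true => //; first by rewrite /s1 /add_true /set_nth_fun /=; case: (f k) fk_gt0.
      exact: runs_push.
    apply: (runs_seq (s1 := set_nth_fun (set_nth_fun s1 2 (rcons (s1 2) (f k != 0))) 6 [::])).
      by apply: runs_clear => //; apply: (s1M 6).
    have -> : S k.+1 = add_true (set_nth_fun (set_nth_fun s1 2 (rcons (s1 2) (f k != 0))) 6 [::]) 5 1.
      apply: functional_extensionality; rewrite /s1 /add_true /set_nth_fun /S.
      by case=> [|[|[|[|[|[|[|c]]]]]]] //=; rewrite ?mkseqS ?cats1 ?rcons_nseq.
    by apply: runs_inc => //; apply: (s1M 5).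
  - by rewrite leq_mul // ltnS /V; lia.
have exC : runs K O (wall n.+1) (Seq (clear K 4) (Seq (clear K 5) (Seq (clear K 1) (push K 2 true))))
    (S v) (final_stacks (rcons (mkseq (fun i => f i != 0) v) true)) (U n + (U n + (U n + U n))).
  apply: runs_seq; first by apply: runs_clear => //; apply: SM.
  apply: runs_seq; first by apply: runs_clear => //; apply: (SM v 5).
  apply: runs_seq; first by apply: runs_clear => //; apply: (SM v 1).
  set s3 := set_nth_fun _ 1 _.
  have -> : final_stacks (rcons (mkseq (fun i => f i != 0) v) true) = set_nth_fun s3 2 (rcons (s3 2) true).
    by apply: functional_extensionality; rewrite /s3 /S /set_nth_fun /final_stacks /=; do 6!case=> //.
  by apply: runs_push => //; apply: (SM v 2).
have [[h T] [exF To]] := exec_compact n K_gt2 (mkseq (fun i => f i != 0) v).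
have exAll := exec_seq (exec_spread K_gt1 x) (exec_seq exN (exec_seq exL (exec_seq exC exF))).
have exB : exec p (0, onth x) (h, T) (B n).
  apply: exec_le exAll _; rewrite /B -/n size_mkseq !leq_add2l.
  have le_v : v <= V n by lia.
  by apply: leq_mul; [apply: leq_mul => //; rewrite leq_add2r leq_mul2r !ltnS le_v orbT | lia].
have run := tm_of_run exB (Bd n).
split; last exact: cfg_output_abs run To.
by move/(congr1 (fun c => c.1.1)): run => /= ->.
Qed.

(** * Definable functions *)

Definition definable (f : seq bool -> (nat -> nat) -> nat) : Prop :=
  exists t, forall x e, f x e = eval x t e.

Definition up (r : nat -> nat) : nat -> nat := fun k => if k is k'.+1 then (r k').+1 else 0.

Fixpoint ren (r : nat -> nat) (t : term) : term :=
  match t with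
  | TVar k => TVar (r k)
  | TOne => TOne
  | TLen => TLen
  | TBit t => TBit (ren r t)
  | TAdd t u => TAdd (ren r t) (ren r u)
  | TSub t u => TSub (ren r t) (ren r u)
  | TSum t u => TSum (ren r t) (ren (up r) u)
  end.

Lemma eval_ren x t r e : eval x (ren r t) e = eval x t (fun k => e (r k)).
Proof.
elim: t r e => //= [t IH|t IHt u IHu|t IHt u IHu|t IHt u IHu] r e; rewrite ?IH ?IHt ?IHu //.
apply: eq_bigr => i _; rewrite IHu; congr eval.
by apply: functional_extensionality => -[|k].
Qed.

Lemma definable_ren f r : definable f -> definable (fun x e => f x (fun k => e (r k))).
Proof. by case=> t ft; exists (ren r t) => x e; rewrite eval_ren -ft. Qed.

Lemma definable_ext f g : definable f -> (forall x e, g x e = f x e) -> definable g.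
Proof. by case=> t ft gf; exists t => x e; rewrite gf ft. Qed.

Lemma definable_var k : definable (fun x e => e k).
Proof. by exists (TVar k). Qed.

Lemma definable_len : definable (fun x e => size x).
Proof. by exists TLen. Qed.

Lemma definable_bit f : definable f -> definable (fun x e => nth false x (f x e)).
Proof. by case=> t ft; exists (TBit t) => x e; rewrite ft. Qed.

Lemma definable_add f g : definable f -> definable g -> definable (fun x e => f x e + g x e).
Proof. by case=> t ft [u gu]; exists (TAdd t u) => x e; rewrite ft gu. Qed.

Lemma definable_sub f g : definable f -> definable g -> definable (fun x e => f x e - g x e).
Proof. by case=> t ft [u gu]; exists (TSub t u) => x e; rewrite ft gu. Qed.

Lemma definable_sum f g : definable f ->
  definable (fun x e => g x (e 0) (fun k => e k.+1)) ->
  definable (fun x e => \sum_(i < f x e) g x i e).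
Proof.
case=> t ft [u gu]; exists (TSum t u) => x e; rewrite ft /=.
by apply: eq_bigr => i _; rewrite -gu.
Qed.

Lemma definable_mul f g : definable f -> definable g -> definable (fun x e => f x e * g x e).
Proof.
move=> df dg; apply: definable_ext (definable_sum (g := fun x _ e => g x e) df _) _.
  exact: (definable_ren succn).
by move=> x e /=; rewrite sum_nat_const card_ord.
Qed.

Lemma definable_const c : definable (fun x e => c).
Proof.
elim: c => [|c IH]; first by exists (TSub TOne TOne).
by apply: definable_ext (definable_add IH (_ : definable (fun _ _ => 1))) _ => [|x e];
  [exists TOne | rewrite addn1].
Qed.

Lemma definable_S f : definable f -> definable (fun x e => (f x e).+1).
Proof.
by move=> df; apply: definable_ext (definable_add df (definable_const 1)) _ => x e; rewrite addn1.
Qed.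

Lemma definable_pred f : definable f -> definable (fun x e => (f x e).-1).
Proof.
by move=> df; apply: definable_ext (definable_sub df (definable_const 1)) _ => x e; rewrite subn1.
Qed.

Lemma definable_exp f c : definable f -> definable (fun x e => f x e ^ c).
Proof.
move=> df; elim: c => [|c IH]; first exact: definable_const 1.
by apply: definable_ext (definable_mul df IH) _ => x e; rewrite expnS.
Qed.

Lemma definable_negb (b : seq bool -> (nat -> nat) -> bool) :
  definable (fun x e => b x e) -> definable (fun x e => ~~ b x e).
Proof.
by move=> db; apply: definable_ext (definable_sub (definable_const 1) db) _ => x e; case: (b x e).
Qed.

Lemma definable_ltn f g : definable f -> definable g -> definable (fun x e => f x e < g x e).
Proof.
move=> df dg; apply: definable_ext (definable_sub (definable_const 1)
  (definable_sub (definable_const 1) (definable_sub dg df))) _ => x e.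
by case: ltnP => h; lia.
Qed.

Lemma definable_leq f g : definable f -> definable g -> definable (fun x e => f x e <= g x e).
Proof. by move=> df dg; apply: definable_ltn df (definable_S dg). Qed.

Lemma definable_andb (b c : seq bool -> (nat -> nat) -> bool) :
  definable (fun x e => b x e) -> definable (fun x e => c x e) ->
  definable (fun x e => b x e && c x e).
Proof.
by move=> db dc; apply: definable_ext (definable_mul db dc) _ => x e; rewrite mulnb.
Qed.

Lemma definable_orb (b c : seq bool -> (nat -> nat) -> bool) :
  definable (fun x e => b x e) -> definable (fun x e => c x e) ->
  definable (fun x e => b x e || c x e).
Proof.
move=> /definable_negb db /definable_negb dc.
by apply: definable_ext (definable_negb (definable_andb db dc)) _ => x e; rewrite negb_and !negbK.
Qed.

Lemma definable_implyb (b c : seq bool -> (nat -> nat) -> bool) :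
  definable (fun x e => b x e) -> definable (fun x e => c x e) ->
  definable (fun x e => b x e ==> c x e).
Proof.
move=> /definable_negb db dc.
by apply: definable_ext (definable_orb db dc) _ => x e; rewrite implybE.
Qed.

Lemma definable_eqn f g : definable f -> definable g -> definable (fun x e => f x e == g x e).
Proof.
move=> df dg; apply: definable_ext (definable_andb (definable_leq df dg) (definable_leq dg df)) _.
by move=> x e; rewrite eqn_leq.
Qed.

Lemma definable_eqb (b c : seq bool -> (nat -> nat) -> bool) :
  definable (fun x e => b x e) -> definable (fun x e => c x e) ->
  definable (fun x e => b x e == c x e).
Proof.
move=> db dc; apply: definable_ext (definable_eqn db dc) _ => x e.
by case: (b x e); case: (c x e).
Qed.

Lemma definable_if (b : seq bool -> (nat -> nat) -> bool) f g :
  definable (fun x e => b x e) -> definable f -> definable g ->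
  definable (fun x e => if b x e then f x e else g x e).
Proof.
move=> db df dg; apply: definable_ext (definable_add (definable_mul db df)
  (definable_mul (definable_negb db) dg)) _ => x e.
by case: (b x e); rewrite ?mul1n ?mul0n ?addn0.
Qed.

Lemma definable_has f (b : seq bool -> nat -> (nat -> nat) -> bool) : definable f ->
  definable (fun x e => b x (e 0) (fun k => e k.+1)) ->
  definable (fun x e => has (fun i => b x i e) (iota 0 (f x e))).
Proof.
move=> df db; apply: definable_ext (definable_ltn (definable_const 0)
  (definable_sum (g := fun x i e => b x i e) df db)) _ => x e /=.
congr nat_of_bool; rewrite lt0n sum_nat_eq0 negb_forall; apply/hasP/existsP => [[i]|[i /=]].
  by rewrite mem_iota => lt_i bi; exists (Ordinal lt_i); rewrite /= bi.
by rewrite eqb0 negbK => bi; exists (nat_of_ord i); rewrite ?mem_iota ?ltn_ord.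
Qed.

Lemma definable_all f (b : seq bool -> nat -> (nat -> nat) -> bool) : definable f ->
  definable (fun x e => b x (e 0) (fun k => e k.+1)) ->
  definable (fun x e => all (fun i => b x i e) (iota 0 (f x e))).
Proof.
move=> df db; apply: definable_ext (definable_negb
  (definable_has (b := fun x i e => ~~ b x i e) df (definable_negb db))) _ => x e.
by rewrite -all_predC; congr nat_of_bool; apply: eq_all => i /=; rewrite negbK.
Qed.

Lemma definable_count f (b : seq bool -> nat -> (nat -> nat) -> bool) : definable f ->
  definable (fun x e => b x (e 0) (fun k => e k.+1)) ->
  definable (fun x e => count (fun i => b x i e) (iota 0 (f x e))).
Proof.
move=> df db; apply: definable_ext (definable_sum (g := fun x i e => b x i e) df db) _ => x e /=.
by rewrite -sum1_count big_mkcond -[in iota 0 _](subn0 (f x e)) -/(index_iota _ _) big_mkord.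
Qed.

(** Terms have no binder besides the sum, so a value is bound by a sum over [i <= f] in which only
    the summand with [i = f] survives. *)
Lemma definable_let f g : definable f ->
  definable (fun x e => g x (e 0) (fun k => e k.+1)) -> definable (fun x e => g x (f x e) e).
Proof.
move=> df dg; apply: definable_ext (definable_sum
  (g := fun x i e => (i == f x e) * g x i e) (definable_S df) _) _.
  by apply: definable_mul => //; apply: definable_eqn (definable_var 0) (definable_ren succn df).
move=> x e /=; rewrite big_ord_recr /= eqxx mul1n big1 // => i _.
by rewrite ltn_eqF.
Qed.

(** The quotient counts the positive multiples of [g] up to [f]; [f] candidates suffice. The extra
    factor gives 0 for divisor 0. *)
Lemma definable_div f g : definable f -> definable g -> definable (fun x e => f x e %/ g x e).
Proof.
move=> df dg; apply: definable_ext (definable_mul (definable_ltn (definable_const 0) dg)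
  (definable_sum (g := fun x i e => i.+1 * g x e <= f x e) df _)) _.
  apply: definable_leq; last exact: (definable_ren succn).
  apply: definable_mul; last exact: (definable_ren succn).
  exact: definable_S (definable_var 0).
move=> x e /=; case: (posnP (g x e)) => [->|g_gt0]; first by rewrite divn0.
rewrite mul1n; set n := f x e; set d := g x e in g_gt0 *.
have E m : \sum_(i < m) (i.+1 * d <= n) = minn m (n %/ d).
  elim: m => [|m IH]; first by rewrite big_ord0 min0n.
  by rewrite big_ord_recr /= IH -leq_divRL //; case: leqP; lia.
by rewrite E; have := leq_div n d; lia.
Qed.

Lemma definable_mod f g : definable f -> definable g -> definable (fun x e => f x e %% g x e).
Proof.
move=> df dg; apply: definable_ext (definable_sub df (definable_mul (definable_div df dg) dg)) _.
by move=> x e; rewrite {2}(divn_eq (f x e) (g x e)) addKn.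
Qed.

(** The table [s] is fixed and only the index depends on the input, so the lookup is a finite case
    distinction. *)
Lemma definable_nth (T : Type) (x0 : T) (s : seq T) (g : T -> seq bool -> (nat -> nat) -> nat) f :
  (forall c, definable (g c)) -> definable f ->
  definable (fun x e => g (nth x0 s (f x e)) x e).
Proof.
move=> dg df; elim: s f df => [|c s IH] f df.
  by apply: definable_ext (dg x0) _ => x e; rewrite nth_nil.
apply: definable_ext (definable_if (definable_eqn df (definable_const 0)) (dg c)
  (IH _ (definable_pred df))) _ => x e.
by case: (f x e).
Qed.

Lemma definable_subst1 F f : definable (fun x e => F x (e 0)) -> definable f ->
  definable (fun x e => F x (f x e)).
Proof. by move=> dF df; apply: (definable_let (g := fun x i e => F x i)). Qed.

Lemma definable_subst2 F f g : definable (fun x e => F x (e 0) (e 1)) ->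
  definable f -> definable g -> definable (fun x e => F x (f x e) (g x e)).
Proof.
move=> dF df dg; apply: (definable_let (g := fun x i e => F x i (g x e)) df).
apply: (definable_let (g := fun x i e => F x (e 0) i)); last first.
  exact: (definable_ren (fun k => if k is 0 then 1 else 0) dF).
exact: (definable_ren succn).
Qed.

Lemma definable_subst3 F f g h : definable (fun x e => F x (e 0) (e 1) (e 2)) ->
  definable f -> definable g -> definable h ->
  definable (fun x e => F x (f x e) (g x e) (h x e)).
Proof.
move=> dF df dg dh; apply: (definable_let (g := fun x i e => F x i (g x e) (h x e)) df).
apply: (definable_let (g := fun x i e => F x (e 0) i (h x (fun k => e k.+1)))).
  exact: (definable_ren succn).
apply: (definable_let (g := fun x i e => F x (e 1) (e 0) i)); last first.
  exact: (definable_ren (fun k => if k is 0 then 2 else if k is 1 then 1 else 0) dF).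
exact: (definable_ren (fun k => k.+2)).
Qed.

Ltac definable_tac :=
  cbv beta;
  lazymatch goal with
  | |- definable (fun _ _ => ?c) => apply: definable_const
  | |- definable (fun _ e => e _) => apply: definable_var
  | |- definable (fun x _ => size x) => apply: definable_len
  | |- definable (fun x e => S (@?f x e)) => refine (@definable_S f _); definable_tac
  | |- definable (fun x e => predn (@?f x e)) => refine (@definable_pred f _); definable_tac
  | |- definable (fun x e => addn (@?f x e) (@?g x e)) =>
      refine (@definable_add f g _ _); definable_tac
  | |- definable (fun x e => muln (@?f x e) (@?g x e)) =>
      refine (@definable_mul f g _ _); definable_tac
  | |- definable (fun x e => subn (@?f x e) (@?g x e)) =>
      refine (@definable_sub f g _ _); definable_tac
  | |- definable (fun x e => divn (@?f x e) (@?g x e)) =>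
      refine (@definable_div f g _ _); definable_tac
  | |- definable (fun x e => modn (@?f x e) (@?g x e)) =>
      refine (@definable_mod f g _ _); definable_tac
  | |- definable (fun x e => expn (@?f x e) ?c) => refine (@definable_exp f c _); definable_tac
  | |- definable (fun x e => nat_of_bool (nth false x (@?f x e))) =>
      refine (@definable_bit f _); definable_tac
  | |- definable (fun x e => nat_of_bool (negb (@?b x e))) =>
      refine (@definable_negb b _); definable_tac
  | |- definable (fun x e => nat_of_bool (andb (@?b x e) (@?c x e))) =>
      refine (@definable_andb b c _ _); definable_tac
  | |- definable (fun x e => nat_of_bool (orb (@?b x e) (@?c x e))) =>
      refine (@definable_orb b c _ _); definable_tac
  | |- definable (fun x e => nat_of_bool (implb (@?b x e) (@?c x e))) =>
      refine (@definable_implyb b c _ _); definable_tac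
  | |- definable (fun x e => nat_of_bool (leq (@?f x e) (@?g x e))) =>
      refine (@definable_leq f g _ _); definable_tac
  | |- definable (fun x e => nat_of_bool (@eq_op bool (@?b x e) (@?c x e))) =>
      refine (@definable_eqb b c _ _); definable_tac
  | |- definable (fun x e => nat_of_bool (@eq_op _ (@?f x e) (@?g x e))) =>
      first [refine (@definable_eqn f g _ _) | refine (@definable_eqb f g _ _)]; definable_tac
  | |- definable (fun x e => if _ then _ else _) => apply: definable_if; definable_tac
  | |- definable (fun x e => nat_of_bool (all (fun i => @?b x e i) (iota 0 (@?f x e)))) =>
      refine (@definable_all f (fun x i e => b x e i) _ _); definable_tac
  | |- definable (fun x e => nat_of_bool (has (fun i => @?b x e i) (iota 0 (@?f x e)))) =>
      refine (@definable_has f (fun x i e => b x e i) _ _); definable_tac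
  | |- definable (fun x e => count (fun i => @?b x e i) (iota 0 (@?f x e))) =>
      refine (@definable_count f (fun x i e => b x e i) _ _); definable_tac
  | |- _ => try assumption
  end.

(** * Degrees and colour classes *)

Section Degrees.
Variables (V : finType) (e : rel V).
Hypotheses (e_sym : symmetric e) (e_irr : irreflexive e).

Definition cdeg (T : eqType) (f : {set V} -> T) (i : T) (v : V) : nat :=
  #|[set y | e v y & f [set v; y] == i]|.

Lemma in_edge_set (X : {set V}) v :
  (X \in edge_set e) && (v \in X) = [exists y, e v y && (X == [set v; y])].
Proof.
apply/andP/existsP => [[/imset2P[a b _]]|[y /andP[evy /eqP ->]]].
  rewrite inE => /andP[_ eab] ->; rewrite !inE => /orP[] /eqP->.
    by exists b; rewrite eab eqxx.
  by exists a; rewrite e_sym eab setUC eqxx.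
by split; [apply/imset2P; exists v y; rewrite ?inE | rewrite set21].
Qed.

Lemma edeg_cdeg (T : eqType) (f : {set V} -> T) i v :
  edeg [set X in edge_set e | f X == i] v = cdeg f i v.
Proof.
rewrite /edeg /cdeg.
have inj : {in [set y | e v y & f [set v; y] == i] &, injective (fun y => [set v; y])}.
  move=> y z; rewrite !inE => /andP[evy _] /andP[evz _] /setP E.
  have := E y; rewrite !inE eqxx orbT => /esym/orP[] /eqP // Ey.
  by rewrite Ey e_irr in evy.
rewrite -(card_in_imset inj); apply: eq_card => X; rewrite !inE.
rewrite andbAC in_edge_set; apply/andP/imsetP => [[/existsP[y /andP[evy /eqP->]] fX]|[y]].
  by exists y; rewrite ?inE ?evy.
by rewrite inE => /andP[evy fy] ->; split=> //; apply/existsP; exists y; rewrite evy eqxx.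
Qed.

(** Endpoints are the vertices of positive degree, whence the alternative 0 for all others. *)
Lemma semiregular_edgesE (F : {set {set V}}) : semiregular_edges F <->
  exists d, forall v, [|| edeg F v == 0, edeg F v == d | edeg F v == d.+1].
Proof.
have endE v : (v \in endpoints F) = (edeg F v != 0).
  rewrite -lt0n card_gt0; apply/bigcupP/set0Pn => -[X].
    by move=> FX vX; exists X; rewrite inE FX.
  by rewrite inE => /andP[FX vX]; exists X.
split=> -[d Fd]; exists d => v.
  by case: eqP => //= /eqP; rewrite -endE => /Fd[] ->; rewrite eqxx ?orbT.
by rewrite endE => /negbTE v0; move: (Fd v); rewrite v0 /= => /orP[] /eqP; [left | right].
Qed.

Lemma sr_partitionableE k : sr_partitionable e k <-> exists f : {set V} -> 'I_k,
  forall i, exists d, forall v, [|| cdeg f i v == 0, cdeg f i v == d | cdeg f i v == d.+1].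
Proof.
split=> -[f fP]; exists f => i; have := fP i; rewrite semiregular_edgesE => -[d fd].
  by exists d => v; rewrite -edeg_cdeg.
by exists d => v; rewrite edeg_cdeg.
Qed.

Lemma cdeg_count (T : eqType) (f : {set V} -> T) i v (s : seq V) :
  (forall y, e v y = (y \in s)) -> uniq s ->
  cdeg f i v = count (fun y => f [set v; y] == i) s.
Proof.
move=> es us; rewrite -size_filter.
have <- := card_uniqP (filter_uniq (fun y => f [set v; y] == i) us).
by apply: eq_card => y; rewrite inE mem_filter es andbC.
Qed.

(** A partition into one class says that the graph itself is semiregular, a condition on plain
    degrees. *)
Lemma sr_is2E : sr_is e 2 <-> sr_partitionable e 2 /\
  ~ exists d, forall v, let k := #|[set y | e v y]| in [|| k == 0, k == d | k == d.+1].
Proof.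
have deg (f : {set V} -> 'I_1) v : cdeg f ord0 v = #|[set y | e v y]|.
  by apply: eq_card => y; rewrite !inE ord1 andbT.
split=> -[h2 h]; split=> //.
  case=> d dP; apply: (h 1) => //; rewrite sr_partitionableE.
  by exists (fun=> ord0) => i; exists d => v; rewrite ord1 deg; apply: dP.
(* There is no map into ['I_0], because [{set V}] always contains [set0]. *)
case=> [|[|//]] _; first by case=> f _; case: (f set0).
rewrite sr_partitionableE => -[f fP]; apply: h; have [d dP] := fP ord0.
by exists d => v /=; have := dP v; rewrite deg.
Qed.

End Degrees.

(** * The graph of a 3CNF formula *)

(** Cyclic successor, and below it cyclic predecessor, within each block of [R] consecutive
    numbers. *)
Definition next_in R w := if w.+1 %% R == 0 then w.+1 - R else w.+1.
Definition prev_in R w := if w %% R == 0 then w + R.-1 else w.-1.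

Section NextPrev.
Variable R : nat.
Hypothesis R_gt0 : 0 < R.

Lemma next_in_block q r : r < R -> next_in R (q * R + r) = if r.+1 == R then q * R else q * R + r.+1.
Proof.
move=> lt_r; rewrite /next_in -addnS modnMDl.
case: (eqVneq r.+1 R) => [->|neq_r]; first by rewrite modnn eqxx addnK.
by rewrite modn_small // ltn_neqAle neq_r.
Qed.

Lemma block w : exists q r, [/\ w = q * R + r, r < R & w %/ R = q].
Proof. by exists (w %/ R), (w %% R); rewrite -divn_eq ltn_pmod. Qed.

Lemma next_in_div w : next_in R w %/ R = w %/ R.
Proof.
have [q [r [-> lt_r _]]] := block w; rewrite next_in_block // divnMDl // (divn_small lt_r) addn0.
case: (eqVneq r.+1 R) => [_|neq_r]; first by rewrite mulnK.
by rewrite divnMDl // divn_small ?addn0 // ltn_neqAle neq_r.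
Qed.

Lemma prev_inK w : next_in R (prev_in R w) = w.
Proof.
rewrite /prev_in; have [q [r [-> lt_r _]]] := block w.
rewrite modnMDl (modn_small lt_r); case: (eqVneq r 0) => [->|neq_r].
  by rewrite addn0 next_in_block prednK ?eqxx.
rewrite -lt0n in neq_r; have -> : (q * R + r).-1 = q * R + r.-1 by lia.
rewrite next_in_block prednK //; last by apply: ltnW.
by rewrite (ltn_eqF lt_r).
Qed.

Lemma next_inK w : prev_in R (next_in R w) = w.
Proof.
have [q [r [-> lt_r _]]] := block w; rewrite next_in_block // /prev_in.
case: (eqVneq r.+1 R) => [<-|neq_r]; first by rewrite modnMl eqxx.
by rewrite modnMDl modn_small ?addnS // ltn_neqAle neq_r.
Qed.

Lemma next_in_neq w : 1 < R -> (w == next_in R w) = false.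
Proof.
move=> R_gt1; have [q [r [-> lt_r _]]] := block w; rewrite next_in_block //.
by case: (eqVneq r.+1 R) => E; apply/eqP; lia.
Qed.

End NextPrev.

Lemma type3 x : exists w, x = 3 * w \/ x = 3 * w + 1 \/ x = 3 * w + 2.
Proof. by exists (x %/ 3); have := divn_eq x 3; have := ltn_pmod x (isT : 0 < 3); lia. Qed.

Lemma mod3 w c : c < 3 -> (3 * w + c) %% 3 = c /\ (3 * w + c) %/ 3 = w.
Proof. by move=> lt_c; lia. Qed.

Lemma slot_divmod k s : s < 6 -> (k * 6 + s) %/ 6 = k /\ (k * 6 + s) %% 6 = s.
Proof. by move=> lt_s; rewrite divnMDl // modnMDl divn_small // modn_small // addn0. Qed.

Section Gadget.
Variables (NA NC : nat) (lit : nat -> nat -> nat).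

Definition n_vars := NA.*2 + NC.*2.
Definition n_cons := NA + NC.
Definition row := 6 * n_cons.
Definition n_wires := n_vars * row.
(** The successor makes [inord] available. The last vertex and those [3 * k + 2] with [k >= n_cons]
    are isolated. *)
Definition n_vertices := (3 * n_wires).+1.

(* Variables [2 a] and [2 a + 1] are the literals of atom [a]; 0 and 1 stand for true and
   false.  Two true slots of [2 a, 2 a + 1, 0, 1] make the literals opposite, and three
   true slots of a clause with two fresh variables and false make one literal true. *)
Definition arity k := if k < NA then 4 else 6.
Definition cvar k s :=
  if k < NA then nth 0 [:: k.*2; k.*2.+1; 0; 1] s
  else let c := k - NA in
    nth 0 [:: lit c 0; lit c 1; lit c 2; NA.*2 + c.*2; (NA.*2 + c.*2).+1; 1] s.

(* Vertex [3 w] with [w = v * row + p] is the occurrence of variable [v] reserved for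
   slot [p %% 6] of constraint [p %/ 6]; [3 w + 1] links it to the next occurrence of
   [v] (cyclically), and [3 k + 2] is constraint [k]. *)
Definition used w := let p := w %% row in
  (p %% 6 < arity (p %/ 6)) && (w %/ row == cvar (p %/ 6) (p %% 6)).

Definition arc i j := let w := i %/ 3 in
  [&& i %% 3 == 0, w < n_wires &
     ((j %% 3 == 1) && ((j %/ 3 == w) || (j %/ 3 == prev_in row w)))
  || [&& j %% 3 == 2, j %/ 3 == w %% row %/ 6 & used w]].

Definition adj i j := arc i j || arc j i.

Definition occ k s := cvar k s * row + (k * 6 + s).

(** [adj] is an arithmetic formula, suited to definability; the explicit lists serve to count
    degrees, in the graph and in each class. *)
Definition nbrs x := let w := x %/ 3 in
  if x %% 3 == 0 then
    (if w < n_wires then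
      [:: 3 * w + 1, 3 * prev_in row w + 1 & if used w then [:: 3 * (w %% row %/ 6) + 2] else [::]]
     else [::])
  else if x %% 3 == 1 then (if w < n_wires then [:: 3 * w; 3 * next_in row w] else [::])
  else if w < n_cons then [seq 3 * occ w s | s <- iota 0 (arity w)] else [::].

Hypotheses (NA_gt0 : 0 < NA) (NC_gt0 : 0 < NC).
Hypothesis lit_lt : forall c s, c < NC -> s < 3 -> lit c s < NA.*2.

Lemma cvar_lt k s : k < n_cons -> s < arity k -> cvar k s < n_vars.
Proof.
rewrite /arity /cvar /n_cons /n_vars => lt_k; case: (ltnP k NA) => le_k.
  by case: s => [|[|[|[|s]]]] //=; lia.
have lt_c : k - NA < NC by lia.
have [[l0 l1] l2] := (lit_lt lt_c (isT : 0 < 3), lit_lt lt_c (isT : 1 < 3), lit_lt lt_c (isT : 2 < 3)).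
by case: s => [|[|[|[|[|[|s]]]]]] //=; lia.
Qed.

Lemma row_gt1 : 5 < row.
Proof. by rewrite /row /n_cons; lia. Qed.

Lemma row_gt0 : 0 < row.
Proof. by apply: leq_trans row_gt1. Qed.

Local Hint Resolve row_gt0 : core.

Lemma arity_le k : 3 < arity k <= 6.
Proof. by rewrite /arity; case: ifP. Qed.

Lemma next_lt w : (next_in row w < n_wires) = (w < n_wires).
Proof. by rewrite /n_wires -(ltn_divLR (next_in _ _)) // -(ltn_divLR w) // next_in_div. Qed.

Lemma prev_lt w : (prev_in row w < n_wires) = (w < n_wires).
Proof. by rewrite -next_lt prev_inK. Qed.

Lemma slot_lt k s : k < n_cons -> s < 6 -> k * 6 + s < row.
Proof. by rewrite /row; nia. Qed.

Lemma occ_divmod k s : k < n_cons -> s < 6 ->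
  occ k s %/ row = cvar k s /\ occ k s %% row = k * 6 + s.
Proof.
move=> lt_k lt_s; have lt := slot_lt lt_k lt_s.
by rewrite /occ divnMDl // modnMDl divn_small // modn_small // addn0.
Qed.

Lemma occ_used k s : k < n_cons -> s < arity k -> used (occ k s).
Proof.
move=> lt_k lt_s; have lt6 : s < 6 by have := arity_le k; lia.
have [E1 E2] := occ_divmod lt_k lt6; have [E3 E4] := slot_divmod k lt6.
by rewrite /used E1 E2 E3 E4 lt_s eqxx.
Qed.

Lemma occ_lt k s : k < n_cons -> s < arity k -> occ k s < n_wires.
Proof.
move=> lt_k lt_s; rewrite /n_wires -ltn_divLR //.
have lt6 : s < 6 by have := arity_le k; lia.
by have [-> _] := occ_divmod lt_k lt6; apply: cvar_lt.
Qed.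

Lemma used_occ w : w < n_wires -> used w ->
  let k := w %% row %/ 6 in k < n_cons /\ exists2 s, s < arity k & w = occ k s.
Proof.
move=> lt_w /andP[lt_s /eqP E] /=; set k := _ %/ 6 in lt_s E *.
split; first by rewrite /k ltn_divLR // mulnC ltn_pmod.
exists (w %% row %% 6) => //.
by rewrite /occ -E -divn_eq -divn_eq.
Qed.

Lemma arcE w j : w < n_wires -> arc (3 * w) j =
  (j == 3 * w + 1) || (j == 3 * prev_in row w + 1) || used w && (j == 3 * (w %% row %/ 6) + 2).
Proof.
move=> lt_w; rewrite /arc mulKn // modnMr lt_w /=.
set k := _ %/ 6; set p := prev_in _ _; case: (used w); rewrite ?andbT ?andbF ?orbF /=; lia.
Qed.

Lemma arc_out x j : arc x j -> exists2 w, w < n_wires & x = 3 * w.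
Proof. by case/and3P => /eqP x3 lt_w _; exists (x %/ 3) => //; lia. Qed.

Lemma nbrs_uniq x : uniq (nbrs x).
Proof.
rewrite /nbrs; case: eqP => x0.
  case: ifP => // lt_w.
  (* A block has more than one wire, so the two links at an occurrence are distinct. *)
  have neq : x %/ 3 != prev_in row (x %/ 3).
    apply/eqP => E; have := next_in_neq row_gt0 (x %/ 3) (ltnW (ltnW (ltnW (ltnW row_gt1)))).
    by rewrite {2}E prev_inK // eqxx.
  have ne : 3 * (x %/ 3) + 1 != 3 * prev_in row (x %/ 3) + 1 by rewrite eqn_add2r eqn_pmul2l.
  by case: ifP => _ /=; rewrite !inE ?(negbTE ne) //=; lia.
case: ifP => x1; case: ifP => // lt_w.
  by rewrite /= inE andbT eqn_pmul2l // next_in_neq // ltnW // ltnW // ltnW // ltnW // row_gt1.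
rewrite map_inj_in_uniq ?iota_uniq // => s t; rewrite !mem_iota /= !add0n => lt_s lt_t E.
have le6 := arity_le (x %/ 3).
have := (occ_divmod (s := s) lt_w); have := (occ_divmod (s := t) lt_w).
have -> : occ (x %/ 3) s = occ (x %/ 3) t by lia.
by move=> /(_ ltac:(lia))[_ ->] /(_ ltac:(lia))[_]; lia.
Qed.

Lemma nbrs_wire w : w < n_wires -> nbrs (3 * w) =
  [:: 3 * w + 1, 3 * prev_in row w + 1 & if used w then [:: 3 * (w %% row %/ 6) + 2] else [::]].
Proof. by move=> lt_w; rewrite /nbrs modnMr mulKn // lt_w. Qed.

Lemma nbrs_link w : w < n_wires -> nbrs (3 * w + 1) = [:: 3 * w; 3 * next_in row w].
Proof. by move=> lt_w; rewrite /nbrs; have [-> ->] := mod3 w (isT : 1 < 3); rewrite lt_w. Qed.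

Lemma nbrs_con k : k < n_cons ->
  nbrs (3 * k + 2) = [seq 3 * occ k s | s <- iota 0 (arity k)].
Proof. by move=> lt_k; rewrite /nbrs; have [-> ->] := mod3 k (isT : 2 < 3); rewrite lt_k. Qed.

Lemma arc_nbrs x y : arc x y -> y \in nbrs x /\ x \in nbrs y.
Proof.
move=> axy; have [w lt_w Ex] := arc_out axy; move: axy; rewrite Ex arcE // nbrs_wire //.
case/orP => [/orP[] /eqP ->|/andP[uw /eqP ->]].
- by rewrite nbrs_link // !inE !eqxx.
- by rewrite nbrs_link ?prev_lt // prev_inK // !inE !eqxx !orbT.
- have [lt_k [s lt_s Ew]] := used_occ lt_w uw; rewrite uw nbrs_con // !inE eqxx !orbT; split=> //.
  by apply/mapP; exists s; rewrite ?mem_iota // {1}Ew.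
Qed.

Lemma adj_nbrs x y : adj x y = (y \in nbrs x).
Proof.
apply/idP/idP; first by case/orP => /arc_nbrs[].
rewrite /adj; have [w [->|[->|->]]] := type3 x.
- rewrite /nbrs modnMr mulKn //=; case: ifP => // lt_w yn; rewrite arcE //.
  move: yn; rewrite !inE; case: (used w); rewrite ?inE ?in_nil ?orbF ?andbF ?andbT /=.
    by case/or3P => ->; rewrite ?orbT.
  by case/orP => ->; rewrite ?orbT.
- rewrite /nbrs; have [-> ->] := mod3 w (isT : 1 < 3) => /=; case: ifP => // lt_w.
  rewrite !inE => /orP[] /eqP ->; first by rewrite [arc (3 * w) _]arcE // eqxx orbT.
  by rewrite [arc (3 * _) _]arcE ?next_lt // next_inK // eqxx !orbT.
- rewrite /nbrs; have [-> ->] := mod3 w (isT : 2 < 3) => /=; case: ifP => // lt_k.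
  case/mapP => s; rewrite mem_iota => /= lt_s ->.
  have lt6 : s < 6 by have := arity_le w; lia.
  rewrite [arc (3 * _) _]arcE ?occ_lt // occ_used //.
  by have [_ ->] := occ_divmod lt_k lt6; have [-> _] := slot_divmod w lt6; rewrite eqxx !orbT.
Qed.

Lemma nbrs_lt x y : y \in nbrs x -> y < n_vertices.
Proof.
have con_lt k : k < n_cons -> 3 * k + 2 < n_vertices.
  (* Constraints are numbered within the range of the wires, of which there are at least as many. *)
  move=> lt_k; have := leq_trans lt_k (_ : n_cons <= n_wires).
  rewrite /n_vertices => h; suff : k < n_wires by lia.
  by apply: h; rewrite /n_wires /row /n_vars; nia.
rewrite -adj_nbrs /adj => /orP[] axy; have [w lt_w E] := arc_out axy; last by rewrite E /n_vertices; lia.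
move: axy; rewrite E arcE // => /orP[/orP[] /eqP ->|/andP[uw /eqP ->]].
- by rewrite /n_vertices; lia.
- by have := prev_lt w; rewrite lt_w /n_vertices; lia.
- by apply: con_lt; have [] := used_occ lt_w uw.
Qed.

Lemma size_nbrs x : size (nbrs x) <= 6.
Proof.
rewrite /nbrs; case: (x %% 3 == 0); first by case: (x %/ 3 < n_wires) => //=; case: (used _).
case: (x %% 3 == 1); first by case: (x %/ 3 < n_wires).
by case: ifP => // _; rewrite size_map size_iota; have := arity_le (x %/ 3); lia.
Qed.

Definition graph : rel 'I_n_vertices := fun i j => adj i j.

Lemma graph_sym : symmetric graph.
Proof. by move=> i j; rewrite /graph /adj orbC. Qed.

Lemma graph_irr : irreflexive graph.
Proof.
move=> i; rewrite /graph /adj orbb; apply/negP => aii.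
by have [w lt_w E] := arc_out aii; move: aii; rewrite E arcE //; lia.
Qed.

Lemma graph_bipartite : bipartite graph.
Proof.
have parity x y : arc x y -> (x %% 3 == 0) && (y %% 3 != 0).
  move=> axy; have [w lt_w E] := arc_out axy; move: axy; rewrite E arcE //.
  by case/orP => [/orP[] /eqP ->|/andP[_ /eqP ->]]; lia.
by exists [set i : 'I_n_vertices | i %% 3 == 0] => x y; rewrite !inE =>
  /orP[] /parity/andP[-> /negbTE->].
Qed.

Local Notation vx := (@inord (3 * n_wires)).

Lemma cdeg_graph (T : eqType) (f : {set 'I_n_vertices} -> T) c (v : 'I_n_vertices) :
  cdeg graph f c v = count (fun y => f [set v; vx y] == c) (nbrs v).
Proof.
rewrite (@cdeg_count _ _ _ f c v (map vx (nbrs v))).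
- by rewrite count_map.
- move=> y; rewrite /graph adj_nbrs; apply/idP/mapP => [yn|[z zn ->]].
    by exists (nat_of_ord y); rewrite ?inord_val.
  by rewrite inordK //; apply: nbrs_lt zn.
- rewrite map_inj_in_uniq ?nbrs_uniq // => y z /nbrs_lt ly /nbrs_lt lz E.
  by rewrite -(inordK ly) -(inordK lz) E.
Qed.

Lemma deg_graph (v : 'I_n_vertices) : #|[set y | graph v y]| = size (nbrs v).
Proof.
have := cdeg_graph (fun=> tt) tt v; rewrite (eq_count (a2 := predT)) // count_predT => <-.
by apply: eq_card => y; rewrite !inE eqxx andbT.
Qed.

Lemma graph_maxdeg : maxdeg_le graph 6.
Proof. by move=> x; rewrite deg_graph size_nbrs. Qed.

End Gadget.

Definition lit_val (a : nat -> bool) l := a l./2 (+) odd l.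

Definition satisfiable NC (lit : nat -> nat -> nat) : Prop := exists a : nat -> bool,
  a 0 /\ forall c, c < NC -> exists2 s, s < 3 & lit_val a (lit c s).

(* This fixes the degrees of both colour classes of the graph to 2 and 3, from a link, an
   occurrence and constraints of arity 4 and 6, with an edge from the occurrence to the
   link and to the constraint of arity 4.  Degrees are at most 6, so that [d] and [d']
   may be truncated at 7. *)
Lemma degree_forcing d d' zS oS zU oU zC oC zD oD :
  let ok e z := [|| z == 0, z == e | z == e.+1] in
  zS + oS = 2 -> zU + oU = 3 -> zC + oC = 4 -> zD + oD = 6 ->
  ok d zS -> ok d' oS -> ok d zU -> ok d' oU ->
  (0 < zS) && (0 < zU) || (0 < oS) && (0 < oU) ->
  ok d zC -> ok d' oC ->
  (0 < zU) && (0 < zC) || (0 < oU) && (0 < oC) ->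
  ok d zD -> ok d' oD -> d = 2 /\ d' = 2.
Proof.
move=> ok ES EU EC ED.
have okE e z : z < 7 -> ok (minn e 7) z = ok e z.
  by move=> lt_z; rewrite /ok; lia.
have lt8 e : minn e 7 \in iota 0 8 by rewrite mem_iota /= add0n ltnS geq_minr.
have two e : minn e 7 == 2 -> e = 2 by move/eqP; lia.
have -> : oS = 2 - zS by lia.
have -> : oU = 3 - zU by lia.
have -> : oC = 4 - zC by lia.
have -> : oD = 6 - zD by lia.
have mS : zS \in iota 0 3 by rewrite mem_iota; lia.
have mU : zU \in iota 0 4 by rewrite mem_iota; lia.
have mC : zC \in iota 0 5 by rewrite mem_iota; lia.
have mD : zD \in iota 0 7 by rewrite mem_iota; lia.
(* With complementary degrees eliminated, [8 * 8 * 3 * 4 * 5 * 7] cases remain and are checked by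
   computation. *)
have : all (fun e => all (fun e' => all (fun a => all (fun b => all (fun c => all (fun k =>
    [&& ok e a, ok e' (2 - a), ok e b, ok e' (3 - b),
        (0 < a) && (0 < b) || (0 < 2 - a) && (0 < 3 - b), ok e c, ok e' (4 - c),
        (0 < b) && (0 < c) || (0 < 3 - b) && (0 < 4 - c), ok e k & ok e' (6 - k)]
    ==> (e == 2) && (e' == 2)) (iota 0 7)) (iota 0 5)) (iota 0 4)) (iota 0 3)) (iota 0 8)) (iota 0 8).
  by vm_compute.
move=> /allP/(_ _ (lt8 d))/allP/(_ _ (lt8 d'))/allP/(_ _ mS)/allP/(_ _ mU).
move=> /allP/(_ _ mC)/allP/(_ _ mD) + h1 h2 h3 h4 h5 h6 h7 h8 h9 h10.
rewrite !okE; first by rewrite h1 h2 h3 h4 h5 h6 h7 h8 h9 h10 => /andP[/two-> /two->].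
all: clear -ES EU EC ED; lia.
Qed.

(** * Partitions of the graph against satisfying assignments *)

Section Correct.
Variables (NA NC : nat) (lit : nat -> nat -> nat).
Hypotheses (NA_gt0 : 0 < NA) (NC_gt0 : 0 < NC).
Hypothesis lit_lt : forall c s, c < NC -> s < 3 -> lit c s < NA.*2.

Local Notation row := (row NA NC).
Local Notation n_wires := (n_wires NA NC).
Local Notation n_cons := (n_cons NA NC).
Local Notation arity := (arity NA).
Local Notation cvar := (cvar NA lit).
Local Notation occ := (occ NA NC lit).
Local Notation used := (used NA NC lit).
Local Notation nbrs := (nbrs NA NC lit).
Local Notation graph := (@graph NA NC lit).
Local Notation V := 'I_(n_vertices NA NC).
Local Notation vx := (@inord (3 * n_wires)).

Definition balanced (b : nat -> bool) := forall k, k < n_cons ->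
  count (fun s => b (cvar k s)) (iota 0 (arity k)) = (arity k)./2.

Lemma balanced_sat b : balanced b -> satisfiable NC lit.
Proof.
(* Being balanced is invariant under complement, so variable 1 may be taken to be false. *)
move=> bal; wlog b1 : b bal / b 1 = false => [wl|].
  case b1: (b 1); last exact: wl bal b1.
  apply: (wl (fun v => ~~ b v)); last by rewrite b1.
  move=> k lt_k; have := bal k lt_k; have := count_predC (fun s => b (cvar k s)) (iota 0 (arity k)).
  rewrite size_iota; set x := count _ _; set y := count _ _ => E Ex.
  rewrite -[LHS]/y.
  by move: E Ex; rewrite /arity; case: ifP => _ /=; lia.
have neg k : k < NA -> b k.*2.+1 = ~~ b k.*2.
  have four k' : k' < NA -> b k'.*2 + b k'.*2.+1 + b 0 + b 1 = 2.
    move=> lt_k; have := bal k' (leq_trans lt_k (leq_addr _ _)).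
    by rewrite /arity /cvar lt_k /= addn0 !addnA.
  (* For atom 0 the slots are 0, 1, 0, 1, so variables 0 and 1 are opposite; then every other pair
     [k.*2], [k.*2.+1] shares one remaining true slot. *)
  have := four 0 NA_gt0; rewrite b1 /= => h0 /four; rewrite b1.
  by move: h0; case: (b 0) => //= _; case: (b k.*2); case: (b _.+1).
have val l : l < NA.*2 -> lit_val (fun k => b k.*2) l = b l.
  move=> lt_l; rewrite /lit_val -[in RHS](odd_double_half l).
  case: (odd l); last by rewrite addbF.
  by rewrite addbT add1n neg //; lia.
exists (fun k => b k.*2); split.
  by have := neg 0 NA_gt0; rewrite b1; case: (b 0.*2).
move=> c lt_c; have := bal (NA + c); rewrite /n_cons ltn_add2l => /(_ lt_c).
rewrite /arity /cvar ltnNge leq_addr /= addKn b1.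
case E0: (b (lit c 0)); first by exists 0 => //; rewrite val ?lit_lt.
case E1: (b (lit c 1)); first by exists 1 => //; rewrite val ?lit_lt.
case E2: (b (lit c 2)); first by exists 2 => //; rewrite val ?lit_lt.
(* If all three literals were false, only the two free slots could be true, one short of three. *)
by case: (b _); case: (b _).
Qed.

Lemma sat_balanced : satisfiable NC lit -> exists b, balanced b.
Proof.
case=> a [a0 sat].
pose t c := lit_val a (lit c 0) + lit_val a (lit c 1) + lit_val a (lit c 2).
(* With [t] true literals, [t] from 1 to 3, the free variables must supply [3 - t]: one is true for
   [t <= 2], the other for [t <= 1]. *)
pose b v := if v < NA.*2 then lit_val a v else
  let d := v - NA.*2 in if odd d then t d./2 <= 1 else t d./2 <= 2.
exists b => k lt_k; rewrite /arity /cvar; case: (ltnP k NA) => le_k.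
  rewrite /= /b /lit_val !ifT; try lia.
  by rewrite /= !odd_double uphalf_double doubleK /= a0; case: (a k).
have lt_c : k - NA < NC by move: lt_k; rewrite /n_cons; lia.
set c := k - NA in lt_c *; have lt s := lit_lt (s := s) lt_c.
have [s lt_s cs] := sat c lt_c.
have := lt 0 isT; have := lt 1 isT; have := lt 2 isT => l2 l1 l0.
have bA : b (NA.*2 + c.*2) = (t c <= 2).
  by rewrite /b ltnNge leq_addr /= addKn odd_double doubleK.
have bB : b (NA.*2 + c.*2).+1 = (t c <= 1).
  by rewrite /b ltnNge -addnS leq_addr /= addKn /= odd_double uphalf_double.
have b1 : b 1 = false by rewrite /b ifT; [rewrite /lit_val /= a0 | lia].
rewrite /= bA bB b1 /b l0 l1 l2.
have : 0 < t c by rewrite /t; case: s lt_s cs => [|[|[|s]]] // _ ->; lia.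
by rewrite /t; do 3!case: (lit_val _ _).
Qed.

(** Exactly one end of an edge is an occurrence, a multiple of 3; the edge takes the colour of the
    variable of that occurrence. *)
Definition paint (b : nat -> bool) (X : {set V}) : bool :=
  [exists y in X, (y %% 3 == 0) && b (y %/ 3 %/ row)].

Lemma paintE b (x y : V) w : x = 3 * w :> nat -> y %% 3 != 0 -> paint b [set x; y] = b (w %/ row).
Proof.
move=> Ex y3; apply/existsP/idP => [[z]|bw].
  rewrite !inE => /andP[/orP[] /eqP -> /andP[z3]]; first by rewrite Ex mulKn.
  by rewrite z3 in y3.
by exists x; rewrite !inE eqxx Ex modnMr mulKn.
Qed.

(** Both classes use [d = 2]: links and occurrences have all their 2 or 3 edges in one class, and a
    balanced constraint splits as 2 + 2 or 3 + 3. *)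
Lemma balanced_partition b : balanced b -> sr_partitionable graph 2.
Proof.
move=> bal; rewrite (sr_partitionableE (@graph_sym _ _ _) (graph_irr lit NA_gt0 NC_gt0)).
pose f X : 'I_2 := if paint b X then ord_max else ord0.
exists f => i; exists 2 => v.
have -> : cdeg graph f i v = cdeg graph (paint b) (i == ord_max) v.
  apply: eq_card => y; rewrite !inE /f; congr (_ && _).
  by case: (paint b _); case: i => -[|[|]].
rewrite cdeg_graph //; move: (i == ord_max) => c.
have vn y : y \in nbrs v -> vx y = y :> nat by move=> yn; rewrite inordK //; apply: nbrs_lt yn.
have [w [Ev|[Ev|Ev]]] := type3 v.
- case: (ltnP w n_wires) => lt_w; last by rewrite /nbrs Ev modnMr mulKn // ltnNge lt_w.
  rewrite (@eq_in_count _ _ (fun=> b (w %/ row) == c)) => [|y yn].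
    rewrite Ev nbrs_wire //; case: (_ == c); last by case: (used w).
    by rewrite count_predT; case: (used w).
  rewrite (paintE _ Ev) // vn //; move: yn; rewrite Ev nbrs_wire // !inE.
  by case: (used w); rewrite ?inE ?in_nil; move=> h; lia.
- case: (ltnP w n_wires) => lt_w; last first.
    by rewrite /nbrs Ev; have [-> ->] := mod3 w (isT : 1 < 3); rewrite ltnNge lt_w.
  rewrite (@eq_in_count _ _ (fun=> b (w %/ row) == c)) => [|y yn].
    by rewrite Ev nbrs_link //; case: (_ == c).
  rewrite setUC; have := vn y yn; move: yn; rewrite Ev nbrs_link // !inE => /orP[] /eqP -> Ey;
    rewrite (paintE _ Ey) ?Ev ?next_in_div //; try lia.
  exact: row_gt0.
- case: (ltnP w n_cons) => lt_k; last first.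
    by rewrite /nbrs Ev; have [-> ->] := mod3 w (isT : 2 < 3); rewrite /= ltnNge lt_k.
  rewrite {1 2 3}Ev nbrs_con // count_map (@eq_in_count _ _ (fun s => b (cvar w s) == c)) => [|s]; last first.
    rewrite mem_iota => /= lt_s; have lt6 : s < 6 by have := arity_le NA w; lia.
    rewrite setUC (@paintE _ _ _ (occ w s)).
    + by have [-> _] := occ_divmod lit NA_gt0 NC_gt0 lt_k lt6.
    + by rewrite vn // Ev nbrs_con //; apply/mapP; exists s; rewrite ?mem_iota.
    + by rewrite Ev; lia.
  have := bal w lt_k; have := count_predC (fun s => b (cvar w s)) (iota 0 (arity w)).
  rewrite size_iota; set x := count _ _; set y := count _ _ => E Ex.
  have -> : count (fun s => b (cvar w s) == c) (iota 0 (arity w)) = if c then x else y.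
    by case: c; apply: eq_count => s /=; case: (b _).
  by move: E Ex; rewrite /arity; case: ifP => _ /=; case: c; lia.
Qed.

Lemma partition_balanced : sr_partitionable graph 2 -> exists b, balanced b.
Proof.
rewrite (sr_partitionableE (@graph_sym _ _ _) (graph_irr lit NA_gt0 NC_gt0)) => -[f fP].
have [d0 d0P] := fP ord0; have [d1 d1P] := fP ord_max.
pose g x y := f [set vx x; vx y] == ord_max.
have gC x y : g x y = g y x by rewrite /g setUC.
pose ones x := count (g x) (nbrs x).
pose zeros x := count (fun y => ~~ g x y) (nbrs x).
have sum x : zeros x + ones x = size (nbrs x) by rewrite addnC count_predC.
have one_ok x : x < n_vertices NA NC -> [|| ones x == 0, ones x == d1 | ones x == d1.+1].
  by move=> lt_x; have := d1P (vx x); rewrite cdeg_graph // inordK.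
have zero_ok x : x < n_vertices NA NC -> [|| zeros x == 0, zeros x == d0 | zeros x == d0.+1].
  move=> lt_x; have := d0P (vx x); rewrite cdeg_graph // inordK //.
  rewrite (@eq_count _ _ (fun y => ~~ g x y)) // => y; rewrite /g.
  by case: (f _) => -[|[|]].
have nbrsC x y : (y \in nbrs x) = (x \in nbrs y) by rewrite -!adj_nbrs // /adj orbC.
have pos x y : y \in nbrs x ->
    (0 < zeros x) && (0 < zeros y) || (0 < ones x) && (0 < ones y).
  move=> xy; have yx : x \in nbrs y by rewrite nbrsC.
  rewrite /zeros /ones -!has_count.
  case gxy: (g x y); [apply/orP; right | apply/orP; left]; apply/andP; split; apply/hasP.
  - by exists y.
  - by exists x; rewrite // gC.
  - by exists y; rewrite ?gxy.
  - by exists x; rewrite // gC gxy.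
have wires_gt0 : 0 < n_wires by rewrite muln_gt0 row_gt0 // /n_vars; lia.
have lt_w w c : w < n_wires -> c < 3 -> 3 * w + c < n_vertices NA NC by rewrite /n_vertices; lia.
have con_nbr k s : k < n_cons -> s < arity k -> 3 * occ k s \in nbrs (3 * k + 2).
  by move=> lt_k lt_s; rewrite nbrs_con //; apply/mapP; exists s; rewrite ?mem_iota.
have lt_con k : k < n_cons -> 3 * k + 2 < n_vertices NA NC.
  move=> lt_k; apply: (@nbrs_lt _ _ lit NA_gt0 NC_gt0 lit_lt (3 * occ k 0)).
  by rewrite nbrsC con_nbr //; have := arity_le NA k; case: (arity k).
have con0 : 0 < n_cons by rewrite /n_cons; lia.
have conA : NA < n_cons by rewrite /n_cons; lia.
have arity0 : arity 0 = 4 by rewrite /arity NA_gt0.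
have arityA : arity NA = 6 by rewrite /arity ltnn.
have occ0 : occ 0 0 = 0 by rewrite /occ /cvar NA_gt0.
have used0 : used 0 by rewrite -occ0 occ_used // arity0.
(* The vertices used are link 1, occurrence 0, and the constraints 2 (arity 4) and [3 * NA + 2]
   (arity 6); occurrence 0 is joined to both 1 and 2. *)
have [E0 E1] : d0 = 2 /\ d1 = 2.
  have h1 := lt_w _ 1 wires_gt0 isT; have h0 := lt_w _ 0 wires_gt0 isT.
  have h2 := lt_con _ con0; have hA := lt_con _ conA.
  have e1 : 0 \in nbrs 1 by rewrite nbrsC (nbrs_wire lit wires_gt0) inE.
  have e2 : 2 \in nbrs 0 by rewrite nbrsC; have := con_nbr 0 0 con0; rewrite arity0 occ0 => /(_ isT).
  have S1 := sum 1; rewrite (nbrs_link lit wires_gt0) in S1.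
  have S0 := sum 0; rewrite (nbrs_wire lit wires_gt0) used0 in S0.
  have S2 := sum 2; rewrite (nbrs_con lit con0) size_map size_iota arity0 in S2.
  have SA := sum (3 * NA + 2); rewrite (nbrs_con lit conA) size_map size_iota arityA in SA.
  exact: (degree_forcing S1 S0 S2 SA (zero_ok _ h1) (one_ok _ h1) (zero_ok _ h0) (one_ok _ h0)
    (pos _ _ e1) (zero_ok _ h2) (one_ok _ h2) (pos _ _ e2) (zero_ok _ hA) (one_ok _ hA)).
rewrite {}E0 {}E1 {d0P d1P} in zero_ok one_ok.
(* Degrees in a class are 0, 2 or 3, and two nonzero ones add up to at least 4. *)
have mono x y z : x < n_vertices NA NC -> size (nbrs x) <= 3 ->
    y \in nbrs x -> z \in nbrs x -> g x y = g x z.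
  move=> lt_x sz yx zx; have := sum x; have := zero_ok x lt_x; have := one_ok x lt_x.
  case: (posnP (ones x)) => [ones0 _ _ _|ones_gt0 h1 h2 Es].
    have /hasPn none : ~~ has (g x) (nbrs x) by rewrite has_count -leqNgt -/(ones x) ones0.
    by rewrite (negbTE (none _ yx)) (negbTE (none _ zx)).
  have /hasPn none : ~~ has (fun y => ~~ g x y) (nbrs x).
    by rewrite has_count -leqNgt -/(zeros x); lia.
  by rewrite (negbNE (none _ yx)) (negbNE (none _ zx)).
pose color w := g (3 * w) (3 * w + 1).
have mono_w w y : w < n_wires -> y \in nbrs (3 * w) -> g (3 * w) y = color w.
  move=> lt yw; apply: mono => //.
  - by have := lt_w w 0 lt isT; rewrite addn0.
  - by rewrite nbrs_wire //=; case: (used w).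
  - by rewrite nbrs_wire // inE eqxx.
have color_next w : w < n_wires -> color (next_in row w) = color w.
  move=> lt; have lt' : next_in row w < n_wires by rewrite next_lt.
  rewrite -(mono_w _ (3 * w + 1) lt'); last by rewrite nbrsC nbrs_link // !inE eqxx orbT.
  rewrite /color [in RHS]gC gC; apply: mono; rewrite ?nbrs_link ?inE ?eqxx ?orbT //.
  exact: lt_w.
have color_row v p : v < n_vars NA NC -> p < row -> color (v * row + p) = color (v * row).
  move=> lt_v; elim: p => [|p IH] lt_p; first by rewrite addn0.
  have lt_p' := ltnW lt_p; have R0 := row_gt0 NA_gt0 NC_gt0.
  have <- : next_in row (v * row + p) = v * row + p.+1.
    by rewrite next_in_block // (ltn_eqF lt_p).
  rewrite color_next; first exact: IH.
  by rewrite /n_wires -ltn_divLR // divnMDl // divn_small // addn0.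
exists (fun v => color (v * row)) => k lt_k.
(* From summands 0, 2 and 3, the number 4 arises only as 2 + 2 and 6 only as 3 + 3. *)
have E : ones (3 * k + 2) = (arity k)./2.
  have := sum (3 * k + 2); have := zero_ok _ (lt_con k lt_k); have := one_ok _ (lt_con k lt_k).
  by rewrite nbrs_con // size_map size_iota /arity; case: (k < NA) => /=; lia.
rewrite -E /ones nbrs_con // count_map; apply: eq_in_count => s.
rewrite mem_iota => /= lt_s; rewrite gC mono_w ?occ_lt //; last by rewrite nbrsC con_nbr.
have lt6 : s < 6 by have := arity_le NA k; lia.
rewrite /occ color_row //; first exact: cvar_lt.
exact: slot_lt.
Qed.

Theorem graph_sr2 : sr_is graph 2 <-> satisfiable NC lit.
Proof.
rewrite (sr_is2E (@graph_sym _ _ _) (graph_irr lit NA_gt0 NC_gt0)); split.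
  by case=> /partition_balanced[b /balanced_sat].
case/sat_balanced => b /balanced_partition part; split=> // -[d dP].
have wires_gt0 : 0 < n_wires by rewrite muln_gt0 row_gt0 // /n_vars; lia.
have conA : NA < n_cons by rewrite /n_cons; lia.
(* A link of degree 2 and a constraint of degree 6 refute semiregularity of the whole graph. *)
have lt1 : 3 * 0 + 1 < n_vertices NA NC by rewrite /n_vertices; lia.
have ltA : 3 * NA + 2 < n_vertices NA NC.
  apply: (@nbrs_lt _ _ lit NA_gt0 NC_gt0 lit_lt (3 * occ NA 0)).
  rewrite -adj_nbrs // /adj orbC -/(adj _ _ _ _ _) adj_nbrs // nbrs_con //.
  by apply/mapP; exists 0; rewrite ?mem_iota //=; case: (arity NA) (arity_le NA NA).
have := dP (vx (3 * NA + 2)); have := dP (vx (3 * 0 + 1)).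
rewrite !deg_graph // !inordK // nbrs_link // nbrs_con // size_map size_iota.
by rewrite /arity ltnn /=; lia.
Qed.

End Correct.

(** * Clauses for a Turing machine computation *)

Lemma size_pair_enc x c : size (pair_enc x c) = 2 * size x + 2 + size c.
Proof.
rewrite /pair_enc !size_cat addnA; congr (_ + _ + _).
by elim: x => //= b x ->; lia.
Qed.

Lemma onth_pair_enc x c p : onth (pair_enc x c) p =
  if p < 2 * size x then Some ((p %% 2 == 1) && nth false x (p %/ 2))
  else if p < 2 * size x + 2 then Some true else onth c (p - (2 * size x + 2)).
Proof.
rewrite /pair_enc; elim: x p => [|b x IH] p.
  by rewrite muln0 add0n; case: p => [|[|p]] //=; rewrite subn2.
rewrite [size (b :: x)]/=; have -> : 2 * (size x).+1 = (2 * size x).+2 by lia.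
case: p => [|[|p]] //; rewrite -[LHS]/(onth (pair_enc x c) p) IH.
rewrite !addSn !subSS !ltnS -[p.+2]addn2 modnDr.
by have -> : (p + 2) %/ 2 = (p %/ 2).+1 by lia.
Qed.

Local Arguments lit_val : simpl never.

Section CookLevin.
Variables (M : TM) (kc kM : nat).

Definition sym (s : option bool) : nat := if s is Some b then b else 2.
Definition st (q : tm_state M) : nat := enum_rank q.

Definition cert_len (x : seq bool) := size x ^ kc + kc.
Definition input_len (x : seq bool) := 2 * size x + 2 + cert_len x.
Definition run_time (x : seq bool) := input_len x ^ kM + kM.
(** One bound for times and cells: it exceeds the run time, hence every cell the head can reach by
    then, and the length of any input with a certificate. *)
Definition side (x : seq bool) := run_time x + input_len x + 2.
Definition atom_kinds := 4 + #|tm_state M|.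

(** The successor reserves atom 0 for the constant true of [satisfiable]. *)
Definition atom (x : seq bool) t p j := ((t * side x + p) * atom_kinds + j).+1.
Definition at_sym x t p s := atom x t p (sym s).
Definition at_away x t p := atom x t p 3.
Definition at_head x t p q := atom x t p (4 + st q).
Definition n_atoms x := (side x * side x * atom_kinds).+1.

(** Letting halted machines stand still allows one common final time for certificates of all
    lengths. *)
Definition next (q : tm_state M) (s : option bool) :=
  if tm_halt q then (q, s, MStay) else tm_delta q s.

Definition pos v := 2 * v.
Definition neg v := 2 * v + 1.

Definition kind : Type := ('I_8 * tm_state M * option bool)%type.

(* These clauses only propagate true facts, so they need not express that a cell or the
   head has a unique state.  They say in turn: a cell away from the head is kept; the
   scanned cell is overwritten; the head moves ([mv MLeft 0 = 0], as for [tm_step]); the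
   head is at one place only; the initial head; the initial cells, with a choice for
   those of the certificate; blanks after the certificate; acceptance.  Literal 0 is
   true and literal 1 is false. *)
Definition klits (k : kind) x t p p' : seq nat :=
  let: (g, q, s) := k in
  let: (q', w, m) := next q s in
  match nat_of_ord g with
  | 0 => [:: neg (at_away x t p); neg (at_sym x t p s);
             if t.+1 < side x then pos (at_sym x t.+1 p s) else 0]
  | 1 => [:: neg (at_head x t p q); neg (at_sym x t p s);
             if t.+1 < side x then pos (at_sym x t.+1 p w) else 0]
  | 2 => [:: neg (at_head x t p q); neg (at_sym x t p s);
             if (t.+1 < side x) && (p.+1 < side x)
             then pos (at_head x t.+1 (mv m p) q') else 0]
  | 3 => [:: neg (at_head x t p q); if p == p' then 0 else pos (at_away x t p'); 1]
  | 4 => [:: pos (at_head x 0 0 (tm_start M)); 1; 1]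
  | 5 => [:: pos (atom x 0 p
               (if p < 2 * size x then ((p %% 2 == 1) && nth false x (p %/ 2) : nat)
                else if p < 2 * size x + 2 then 1 else if p < input_len x then 0 else 2));
             if (2 * size x + 2 <= p) && (p < input_len x) then pos (at_sym x 0 p (Some true)) else 1;
             if (2 * size x + 2 <= p) && (p < input_len x) then pos (at_sym x 0 p None) else 1]
  | 6 => [:: if 2 * size x + 2 <= p then neg (at_sym x 0 p None) else 0; 1;
             if p.+1 < side x then pos (at_sym x 0 p.+1 None) else 0]
  | _ => [:: if tm_accept q then 0 else neg (at_head x (run_time x) p q); 1; 1]
  end.

Definition kinds : seq kind := enum {: 'I_8 * tm_state M * option bool}.
Definition kind0 : kind := (ord0, tm_start M, None).

(** A clause number is read in mixed radix, with the kind as lowest digit, then [p'], [p] and [t].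
    Clauses that would refer to a place outside the grid contain the true literal 0. *)
Definition lit x c s :=
  let d := c %/ size kinds in
  nth 1 (klits (nth kind0 kinds (c %% size kinds)) x
    (d %/ side x %/ side x) (d %/ side x %% side x) (d %% side x)) s.

Definition n_clauses x := side x * side x * side x * size kinds.

Lemma size_klits k x t p p' : size (klits k x t p p') = 3.
Proof.
by case: k => [[g q] s]; rewrite /klits; case: (next q s) => -[q' w] m;
  case: g => [[|[|[|[|[|[|[|g]]]]]]]].
Qed.

Lemma size_kinds : 0 < size kinds.
Proof. by rewrite -cardE; apply/card_gt0P; exists kind0. Qed.

Lemma side_gt1 x : 1 < side x.
Proof. by rewrite /side addn2. Qed.

Lemma clausesP (a : nat -> bool) x :
  (forall c, c < n_clauses x -> exists2 s, s < 3 & lit_val a (lit x c s)) <->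
  (forall k t p p', t < side x -> p < side x -> p' < side x ->
     has (lit_val a) (klits k x t p p')).
Proof.
have S0 : 0 < side x by rewrite ltnW ?side_gt1.
have K0 := size_kinds; split=> [sat k t p p' lt_t lt_p lt_p'|sat c lt_c].
  pose i := index k kinds.
  have lt_i : i < size kinds by rewrite index_mem mem_enum.
  pose d := (t * side x + p) * side x + p'.
  have [|s lt_s] := sat (d * size kinds + i).
    rewrite /n_clauses -ltn_divLR // divnMDl // divn_small // addn0.
    rewrite /d -ltn_divLR // divnMDl // divn_small // addn0.
    by rewrite -ltn_divLR // divnMDl // divn_small // addn0.
  rewrite /lit divnMDl // modnMDl (divn_small lt_i) (modn_small lt_i) addn0.
  rewrite /d divnMDl // modnMDl (divn_small lt_p') (modn_small lt_p') addn0.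
  rewrite divnMDl // modnMDl (divn_small lt_p) (modn_small lt_p) addn0.
  rewrite nth_index ?mem_enum // => vs.
  by apply/(has_nthP 1); exists s; rewrite ?size_klits.
have := sat (nth kind0 kinds (c %% size kinds)) (c %/ size kinds %/ side x %/ side x)
  (c %/ size kinds %/ side x %% side x) (c %/ size kinds %% side x).
rewrite !ltn_mod !ltn_divLR // S0 => /(_ lt_c isT isT) /(has_nthP 1)[s].
by rewrite size_klits => lt_s vs; exists s.
Qed.

Lemma lit_val_pos a v : lit_val a (pos v) = a v.
Proof. by rewrite /lit_val /pos mul2n odd_double doubleK addbF. Qed.

Lemma lit_val_neg a v : lit_val a (neg v) = ~~ a v.
Proof. by rewrite /lit_val /neg mul2n addn1 /= odd_double uphalf_double addbT. Qed.

Lemma atom_lt x t p j : t < side x -> p < side x -> j < atom_kinds ->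
  (atom x t p j).+1 <= n_atoms x.
Proof.
move=> lt_t lt_p lt_j; rewrite /atom /n_atoms !ltnS.
have S0 : 0 < side x by rewrite ltnW ?side_gt1.
rewrite -ltn_divLR; last by [].
by rewrite divnMDl // divn_small // addn0 -ltn_divLR // divnMDl // divn_small // addn0.
Qed.

Lemma sym_lt s : sym s < 3. Proof. by case: s => // -[]. Qed.
Lemma sym_inj : injective sym. Proof. by case=> [[]|] [[]|]. Qed.
Lemma st_inj : injective st. Proof. by move=> q r /ord_inj/enum_rank_inj. Qed.

Lemma at_sym_lt x t p s : t < side x -> p < side x -> at_sym x t p s < n_atoms x.
Proof. by move=> lt lp; apply: atom_lt => //; apply: leq_trans (sym_lt s) _. Qed.
Lemma at_away_lt x t p : t < side x -> p < side x -> at_away x t p < n_atoms x.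
Proof. by move=> lt lp; apply: atom_lt. Qed.
Lemma at_head_lt x t p q : t < side x -> p < side x -> at_head x t p q < n_atoms x.
Proof. by move=> lt lp; apply: atom_lt => //; rewrite ltn_add2l /st ltn_ord. Qed.

Lemma mv_lt m p P : p.+1 < P -> mv m p < P.
Proof. by case: m => /=; lia. Qed.

Lemma klits_lt k x t p p' : t < side x -> p < side x -> p' < side x ->
  all (fun l => l < (n_atoms x).*2) (klits k x t p p').
Proof.
move=> lt_t lt_p lt_p'; have S1 := side_gt1 x; have S0 := ltnW S1.
have P v : v < n_atoms x -> pos v < (n_atoms x).*2 by rewrite /pos; lia.
have N v : v < n_atoms x -> neg v < (n_atoms x).*2 by rewrite /neg; lia.
have T0 : 0 < (n_atoms x).*2 by rewrite /n_atoms.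
have T1 : 1 < (n_atoms x).*2 by rewrite /n_atoms; lia.
have lt_run : run_time x < side x by rewrite /side; lia.
case: k => [[g q] s]; rewrite /klits; case: (next q s) => -[q' w] m.
have ifT0 (b : bool) v : (b -> v < n_atoms x) -> (if b then pos v else 0) < (n_atoms x).*2.
  by case: b => // h; rewrite P ?h.
have ifT1 (b : bool) v : (b -> v < n_atoms x) -> (if b then pos v else 1) < (n_atoms x).*2.
  by case: b => // h; rewrite P ?h.
case: g => [[|[|[|[|[|[|[|g]]]]]]]] _ /=; rewrite ?T0 ?T1 ?andbT.
- by rewrite !N ?at_sym_lt ?at_away_lt //= ifT0 // => lt1; apply: at_sym_lt.
- by rewrite !N ?at_sym_lt ?at_head_lt //= ifT0 // => lt1; apply: at_sym_lt.
- rewrite !N ?at_sym_lt ?at_head_lt //= ifT0 // => /andP[lt1 lt2].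
  by apply: at_head_lt => //; apply: mv_lt.
- by rewrite N ?at_head_lt //; case: ifP => // _; rewrite P ?at_away_lt.
- by rewrite P ?at_head_lt.
- rewrite !ifT1 /= ?andbT; try by move=> _; apply: at_sym_lt.
  apply: P; apply: atom_lt => //; rewrite /atom_kinds.
  by do ?case: ifP => _; rewrite //; case: (_ && _).
- rewrite ifT0 ?andbT => [|lt1]; last exact: at_sym_lt.
  by case: ifP => // _; rewrite N ?at_sym_lt.
- by case: ifP => // _; rewrite N ?at_head_lt.
Qed.

Lemma lit_lt x c s : c < n_clauses x -> s < 3 -> lit x c s < (n_atoms x).*2.
Proof.
move=> lt_c lt_s; have S0 : 0 < side x by rewrite ltnW ?side_gt1.
have K0 := size_kinds.
have := @klits_lt (nth kind0 kinds (c %% size kinds)) x (c %/ size kinds %/ side x %/ side x)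
  (c %/ size kinds %/ side x %% side x) (c %/ size kinds %% side x).
rewrite !ltn_mod !ltn_divLR // S0 => /(_ lt_c isT isT) /allP; apply.
by rewrite mem_nth ?size_klits.
Qed.

Definition config_at (y : seq bool) t := iter t (@astep M) (tm_start M, 0, onth y).

Lemma astepE q h T : @astep M (q, h, T) =
  let: (q', w, m) := next q (T h) in (q', mv m h, upd T h w).
Proof. by rewrite /astep /next; case: ifP => // _; rewrite upd_id. Qed.

Lemma pos_le y t : (config_at y t).1.2 <= t.
Proof.
elim: t => // t; rewrite /config_at iterS; case: (iter t _ _) => [[q h] T] /= le_h.
by case: ifP => _; [exact: leqW | case: tm_delta => [[q' w] []] /=; lia].
Qed.

Variable Lv : seq bool -> Prop.
Hypothesis M_decides : forall y, let c := tm_run M y (size y ^ kM + kM) in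
  tm_halt (cfg_state c) /\ (tm_accept (cfg_state c) <-> Lv y).

Lemma accept_run x c : size c <= cert_len x ->
  tm_accept (config_at (pair_enc x c) (run_time x)).1.1 <-> Lv (pair_enc x c).
Proof.
move=> le_c; set y := pair_enc x c; have [halted <-] := M_decides y.
have le_t : size y ^ kM + kM <= run_time x.
  rewrite /run_time leq_add2r; case: kM => [|k]; first by rewrite !expn0.
  by rewrite leq_exp2r // /y size_pair_enc /input_len leq_add2l.
(* [run_time] is computed for the longest certificate; on a shorter one the machine has halted
   earlier and its configuration no longer changes. *)
rewrite /config_at -(subnK le_t) iterD -cfg_abs_run /cfg_abs.
set c0 := tm_run _ _ _ in halted *; set q := cfg_state c0 in halted *.
suff -> : forall k, iter k (@astep M) (q, cfg_pos c0, cfg_tape c0) = (q, cfg_pos c0, cfg_tape c0) by [].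
by elim=> //= k ->; rewrite /astep halted.
Qed.

Lemma sat_accept x : satisfiable (n_clauses x) (lit x) ->
  exists2 c, size c <= cert_len x & Lv (pair_enc x c).
Proof.
case=> a [a0 /clausesP cl].
have S1 := side_gt1 x; have S0 : 0 < side x := ltnW S1.
have v0 : lit_val a 0 by rewrite /lit_val a0.
have v1 : lit_val a 1 = false by rewrite /lit_val /= a0.
pose base := 2 * size x + 2.
have input_lt : input_len x < side x by rewrite /side; lia.
pose C p s := a (atom x 0 p s).
pose good p := C p 0 || C p 1.
(* Nothing forbids several symbols in a cell. The certificate is cut at the first cell with neither
   bit, where the cell clause leaves only the blank, and a cell with both bits is read as 1. *)
pose L := find (fun i => ~~ good (base + i)) (iota 0 (cert_len x)).
have L_le : L <= cert_len x by rewrite -[X in _ <= X](size_iota 0); apply: find_size.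
pose c := mkseq (fun i => C (base + i) 1) L.
have sz_c : size c = L by rewrite size_mkseq.
exists c; first by rewrite sz_c.
have cell p := cl (inord 5, tm_start M, None) 0 p 0 S0.
have prop p := cl (inord 6, tm_start M, None) 0 p 0 S0.
rewrite /klits in cell prop; rewrite !inordK //= in cell prop.
case: (next _ _) cell prop => [[_ _] _] cell prop.
have blank p : base + L <= p -> p < side x -> C p 2.
  elim: p => [|p IH] le_p lt_p; first by rewrite /base in le_p; lia.
  case: (ltngtP (base + L) p.+1) le_p => // [lt_p'|Ep] _.
    have := prop p (ltnW lt_p) S0; rewrite /= v1 lt_p ifT; last by rewrite /base in lt_p'; lia.
    by rewrite lit_val_neg lit_val_pos /at_sym -/(C p 2) IH //; [rewrite orbF | lia..].
  have n1 : (base + L < 2 * size x) = false by rewrite /base; lia.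
  have n2 : (base + L < base) = false by lia.
  have n3 : (base + L < input_len x) = (L < cert_len x) by rewrite /input_len -/base ltn_add2l.
  have := cell p.+1 lt_p S0; rewrite /= -/base -Ep n1 n2 n3 leq_addr /=.
  case: (ltngtP L (cert_len x)) L_le => // [lt_L|EL] _.
    have : ~~ good (base + L).
      have := nth_find 0 (_ : has (fun i => ~~ good (base + i)) (iota 0 (cert_len x))).
      by rewrite -/L nth_iota // add0n; apply; rewrite has_find size_iota.
    rewrite negb_or => /andP[g0 g1]; rewrite !lit_val_pos /at_sym.
    by rewrite -/(C _ _) -/(C _ 1) -/(C _ 2) (negbTE g0) (negbTE g1) !orbF.
  by rewrite v1 !orbF lit_val_pos.
have init p : p < side x -> C p (sym (onth (pair_enc x c) p)).
  move=> lt_p; rewrite onth_pair_enc; have := cell p lt_p S0; rewrite /= -/base.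
  case: (ltnP p (2 * size x)) => [lt1|le1].
    have -> : (base <= p) = false by rewrite /base; lia.
    by rewrite v1 !orbF lit_val_pos.
  case: (ltnP p base) => [lt2|le2].
    by rewrite v1 !orbF lit_val_pos.
  case: (ltnP (p - base) L) => [lt3|le3].
    move=> _; have g : good p.
      have := before_find 0 (lt3 : _ < find _ _); rewrite nth_iota ?add0n ?subnKC //; last by lia.
      by move/negbFE.
    rewrite onthE (nth_map false) ?sz_c // nth_mkseq // subnKC //=.
    by case E: (C p 1) g; rewrite /good ?E ?orbF.
  rewrite onth_default ?sz_c // => _; apply: blank => //; lia.
pose cf t := config_at (pair_enc x c) t.
(* Only the facts of the actual run are shown to be true; other atoms may be true as well, but the
   clauses against rejecting states already contradict a true fact. *)
have facts t : t <= run_time x -> a (at_head x t (cf t).1.2 (cf t).1.1) /\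
    (forall p, p < side x -> a (at_sym x t p ((cf t).2 p))).
  elim: t => [|t IH] le_t.
    split=> [|p lt_p]; last exact: init.
    have := cl (inord 4, tm_start M, None) 0 0 0 S0 S0 S0; rewrite /klits inordK //=.
    by case: (next _ _) => [[_ _] _]; rewrite /= v1 !orbF lit_val_pos.
  have [head syms] := IH (ltnW le_t); have := pos_le (pair_enc x c) t.
  rewrite /cf /config_at iterS -/(config_at _ t) -/(cf t) in head syms *.
  case: (cf t) head syms => [[q h] T] head syms le_h; rewrite astepE.
  rewrite /= in head syms le_h.
  have lt_run : run_time x < side x by rewrite /side; lia.
  have lt_t : t.+1 < side x by lia.
  have lt_t' := ltnW lt_t; have lt_h : h < side x by lia.
  have write := cl (inord 1, q, T h) t h 0 lt_t' lt_h S0.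
  have move := cl (inord 2, q, T h) t h 0 lt_t' lt_h S0.
  rewrite /klits !inordK //= in write move.
  case: (next q (T h)) write move => [[q' w] m] /=.
  have lt_h1 : h.+1 < side x by lia.
  rewrite lt_t lt_h1 /= !lit_val_neg !lit_val_pos head (syms h lt_h) /= !orbF => write move.
  split=> // p lt_p; rewrite /upd; case: eqP => [->//|/eqP neq_p].
  have away := cl (inord 3, q, None) t h p lt_t' lt_h lt_p.
  have keep := cl (inord 0, q, T p) t p 0 lt_t' lt_p S0.
  rewrite /klits !inordK //= in away keep.
  case: (next q None) away => [[_ _] _]; case: (next q (T p)) keep => [[_ _] _] /=.
  rewrite eq_sym (negbTE neq_p) lt_t v1 !lit_val_neg !lit_val_pos head (syms p lt_p) /= !orbF.
  by move=> + a_away; rewrite a_away.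
apply/accept_run; first by rewrite sz_c.
have lt_run : run_time x < side x by rewrite /side; lia.
have [head _] := facts _ (leqnn _); rewrite -/(cf _).
have := pos_le (pair_enc x c) (run_time x); rewrite -/(cf _).
case: (cf _) head => [[q h] T] /= head le_h.
have := cl (inord 7, q, None) 0 h 0 S0 (leq_ltn_trans le_h lt_run) S0; rewrite /klits inordK //=.
case: (next _ _) => [[_ _] _] /=; case: ifP => //.
by rewrite v1 lit_val_neg head.
Qed.

Lemma accept_sat x c : size c <= cert_len x -> Lv (pair_enc x c) ->
  satisfiable (n_clauses x) (lit x).
Proof.
move=> le_c /(accept_run le_c); pose cf t := config_at (pair_enc x c) t.
rewrite -/(cf _) => acc.
have S1 := side_gt1 x; have S0 : 0 < side x := ltnW S1.
(* The digits of [w] recover [t], [p] and the kind of the atom, which then gets its truth value in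
   the actual run. *)
pose a v := if v is w.+1 then
    let j := w %% atom_kinds in let p := w %/ atom_kinds %% side x in
    let t := w %/ atom_kinds %/ side x in
    if j < 3 then sym ((cf t).2 p) == j
    else if j == 3 then (cf t).1.2 != p
    else ((cf t).1.2 == p) && (st (cf t).1.1 == j - 4)
  else true.
have aE t p j : p < side x -> j < atom_kinds -> a (atom x t p j) =
    if j < 3 then sym ((cf t).2 p) == j else if j == 3 then (cf t).1.2 != p
    else ((cf t).1.2 == p) && (st (cf t).1.1 == j - 4).
  move=> lt_p lt_j; rewrite /a /atom.
  rewrite divnMDl // modnMDl (divn_small lt_j) (modn_small lt_j) addn0.
  by rewrite divnMDl // modnMDl (divn_small lt_p) (modn_small lt_p) addn0.
have symE t p s : p < side x -> a (at_sym x t p s) = ((cf t).2 p == s).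
  move=> lt_p; rewrite aE ?sym_lt //; last by apply: leq_trans (sym_lt s) _.
  by rewrite (inj_eq sym_inj).
have awayE t p : p < side x -> a (at_away x t p) = ((cf t).1.2 != p).
  by move=> lt_p; rewrite aE.
have headE t p q : p < side x -> a (at_head x t p q) = ((cf t).1.2 == p) && ((cf t).1.1 == q).
  move=> lt_p; rewrite aE // /atom_kinds; last by rewrite ltn_add2l /st ltn_ord.
  by rewrite addKn (inj_eq st_inj).
have a0 : a 0 by [].
clearbody a; exists a; split=> //; apply/clausesP => -[[g q] s] t p p' lt_t lt_p lt_p'.
have v1 : lit_val a 1 = false by rewrite /lit_val /= a0.
have v0 : lit_val a 0 by rewrite /lit_val a0.
have step : cf t.+1 = @astep M (cf t) by rewrite /cf /config_at iterS.
rewrite /klits; case E: (next q s) => [[q' w] m].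
case: g => [[|[|[|[|[|[|[|g]]]]]]] _] /=; rewrite ?v1 ?orbF.
- rewrite !lit_val_neg awayE // symE // negbK; case: ifP => // lt1; last by rewrite v0 !orbT.
  rewrite lit_val_pos symE // step; case: (cf t) => [[q1 h] T]; rewrite astepE /=.
  case: (next _ _) => [[q2 w2] m2] /=; rewrite /upd (eq_sym h).
  by case: eqP => //= _; case: eqP.
- rewrite !lit_val_neg headE // symE //; case: ifP => // lt1; last by rewrite v0 !orbT.
  rewrite lit_val_pos symE // step; case: (cf t) => [[q1 h] T]; rewrite astepE /=.
  case: eqP => //= ->; case: eqP => //= ->; case: eqP => //= ->.
  by rewrite E /= /upd eqxx.
- rewrite !lit_val_neg headE // symE //; case: ifP => // [/andP[lt1 lt2]|_]; last by rewrite v0 !orbT.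
  rewrite lit_val_pos headE ?mv_lt // step; case: (cf t) => [[q1 h] T]; rewrite astepE /=.
  case: eqP => //= ->; case: eqP => //= ->; case: eqP => //= ->.
  by rewrite E /= !eqxx.
- rewrite lit_val_neg headE //; case: ifP => [_|neq_p]; first by rewrite v0 orbT.
  by rewrite lit_val_pos awayE //; case: eqP => //= ->; rewrite neq_p orbT.
- by rewrite lit_val_pos headE //= !eqxx.
- have lt3 k : k < 3 -> k < atom_kinds by move=> lt_k; apply: leq_trans lt_k _.
  rewrite !lit_val_pos; have tp : (cf 0).2 p = onth (pair_enc x c) p by [].
  rewrite onth_pair_enc in tp.
  case: (ltnP p (2 * size x)) tp => [lt1|le1] tp.
    set b := (p %% 2 == 1) && _ in tp *.
    have lt_b : b < 3 by case: (b).
    by rewrite (aE 0 p b lt_p (lt3 _ lt_b)) lt_b tp /= eqxx.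
  case: (ltnP p (2 * size x + 2)) tp => [lt2|le2] tp.
    by rewrite aE ?lt3 // tp /=.
  case: (ltnP p (input_len x)) => [lt3'|le3] /=.
    rewrite !lit_val_pos !symE // aE ?lt3 // tp /=.
    by case: (onth _ _) => [[]|].
  rewrite v1 aE ?lt3 // tp /= onth_default //.
  by move: le3; rewrite /input_len; lia.
- case: ifP => [le1|_]; last by rewrite v0.
  case: ifP => [lt2|_]; last by rewrite v0 !orbT.
  rewrite lit_val_neg lit_val_pos !symE //.
  rewrite -[(cf 0).2]/(onth (pair_enc x c)) !onth_pair_enc !ifF; try lia.
  case: (onth c (p - _) =P None) => //= E'.
  have := onthNE c (p - (2 * size x + 2)); rewrite E' /= => /esym le_c'.
  by rewrite onth_default //; lia.
- case: ifP => [|nacc]; first by rewrite v0.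
  rewrite lit_val_neg headE //; apply/negP => /andP[_ /eqP Eq].
  by rewrite Eq nacc in acc.
Qed.

Lemma satisfiableP x : satisfiable (n_clauses x) (lit x) <->
  exists c, size c <= cert_len x /\ Lv (pair_enc x c).
Proof.
split=> [/sat_accept[c le_c Lc]|[c [le_c Lc]]]; first by exists c.
exact: accept_sat Lc.
Qed.

End CookLevin.

(** * Hardness *)

Lemma allpairs_iota (T : Type) (E : nat -> nat -> T) m n :
  [seq E i j | i <- iota 0 m, j <- iota 0 n] = mkseq (fun k => E (k %/ n) (k %% n)) (m * n).
Proof.
elim: m => [|m IH]; first by [].
rewrite -addn1 iotaD map_cat flatten_cat IH mulnDl mul1n /mkseq iotaD map_cat; congr (_ ++ _).
rewrite /= cats0 add0n -[in iota (m * n) _](addn0 (m * n)) iotaDl -map_comp.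
apply/eq_in_map => j.
rewrite mem_iota /= => lt_j; have n_gt0 : 0 < n by apply: leq_ltn_trans lt_j.
by rewrite divnMDl // modnMDl divn_small // modn_small // addn0.
Qed.

Lemma adj_enc_mkseq n (E : nat -> nat -> bool) :
  adj_enc (fun i j : 'I_n => E i j) = mkseq (fun k => E (k %/ n) (k %% n)) (n * n).
Proof.
by rewrite -allpairs_iota /adj_enc -val_enum_ord allpairs_mapl allpairs_mapr.
Qed.

Lemma size_adj_enc n (e : rel 'I_n) : size (adj_enc e) = n * n.
Proof. by rewrite /adj_enc size_allpairs size_enum_ord. Qed.

Lemma nth_adj_enc n (e : rel 'I_n) (i j : 'I_n) : nth false (adj_enc e) (i * n + j) = e i j.
Proof.
case: n => [|n] in e i j *; first by case: i.
have -> : e = (fun a b => e (inord a) (inord b)).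
  by apply: functional_extensionality => a; apply: functional_extensionality => b; rewrite !inord_val.
rewrite (adj_enc_mkseq n.+1 (fun a b => e (inord a) (inord b))) nth_mkseq; last first.
  by rewrite -ltn_divLR // divnMDl // divn_small // addn0.
by rewrite divnMDl // modnMDl divn_small // modn_small // addn0.
Qed.

Lemma adj_enc_inj n (e e' : rel 'I_n) : adj_enc e = adj_enc e' -> e = e'.
Proof.
move=> E; apply: functional_extensionality => i; apply: functional_extensionality => j.
by rewrite -!nth_adj_enc E.
Qed.

Lemma definable_nth_cons f l s : definable s -> definable f ->
  definable (fun x e => nth 0 (l x e) (s x e).-1) ->
  definable (fun x e => nth 0 (f x e :: l x e) (s x e)).
Proof.
move=> ds df dl; apply: definable_ext (definable_if (definable_eqn ds (definable_const 0)) df dl) _.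
by move=> x e; case: (s x e).
Qed.

Lemma definable_nth_nil s : definable (fun x e => nth 0 [::] (s x e)).
Proof. by apply: definable_ext (definable_const 0) _ => x e; rewrite nth_nil. Qed.

Lemma definable_double f : definable f -> definable (fun x e => (f x e).*2).
Proof.
by move=> df; apply: definable_ext (definable_mul (definable_const 2) df) _ => x e; rewrite mul2n.
Qed.

(** * The reduction as a term *)

Section GraphDefinable.
Variables (NA NC : seq bool -> nat) (lit : seq bool -> nat -> nat -> nat).
Hypotheses (dNA : definable (fun x _ => NA x)) (dNC : definable (fun x _ => NC x)).
Hypothesis dlit : forall s, s < 3 -> definable (fun x e => lit x (e 0) s).

Lemma definable_row : definable (fun x _ => row (NA x) (NC x)).
Proof. rewrite /row /n_cons; definable_tac. Qed.

Lemma definable_wires : definable (fun x _ => n_wires (NA x) (NC x)).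
Proof.
have dr := definable_row; rewrite /n_wires /n_vars; definable_tac; exact: definable_double.
Qed.

Lemma definable_vertices : definable (fun x _ => n_vertices (NA x) (NC x)).
Proof. have dw := definable_wires; rewrite /n_vertices; definable_tac. Qed.

Lemma definable_arity : definable (fun x e => arity (NA x) (e 0)).
Proof. by rewrite /arity; definable_tac. Qed.

Lemma definable_cvar : definable (fun x e => cvar (NA x) (lit x) (e 0) (e 1)).
Proof.
have dd : definable (fun x e => e 0 - NA x) by definable_tac.
have dl s (lt_s : s < 3) : definable (fun x e => lit x (e 0 - NA x) s).
  exact: (definable_subst1 (F := fun x c => lit x c s) (dlit lt_s)).
rewrite /cvar; apply: definable_if; first by definable_tac.
  by do ?apply: definable_nth_cons; try apply: definable_nth_nil; definable_tac; apply: definable_double; definable_tac.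
do ?apply: definable_nth_cons; try apply: definable_nth_nil; try exact: dl; definable_tac;
  by apply: definable_double; definable_tac.
Qed.

Lemma definable_used : definable (fun x e => used (NA x) (NC x) (lit x) (e 0)).
Proof.
have dr := definable_row; rewrite /used; cbv zeta.
have dk : definable (fun x e => e 0 %% row (NA x) (NC x) %/ 6) by definable_tac.
have ds : definable (fun x e => e 0 %% row (NA x) (NC x) %% 6) by definable_tac.
have da := definable_subst1 (F := fun x k => arity (NA x) k) definable_arity dk.
have dc := definable_subst2 (F := fun x k s => cvar (NA x) (lit x) k s) definable_cvar dk ds.
definable_tac.
Qed.

Lemma definable_arc : definable (fun x e => arc (NA x) (NC x) (lit x) (e 0) (e 1)).
Proof.
have dr := definable_row; have dw := definable_wires; rewrite /arc; cbv zeta.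
have du := definable_subst1 (F := fun x w => used (NA x) (NC x) (lit x) w) definable_used
  (definable_div (definable_var 0) (definable_const 3)).
rewrite /prev_in; definable_tac.
Qed.

Lemma definable_adj : definable (fun x e => adj (NA x) (NC x) (lit x) (e 0) (e 1)).
Proof.
have d01 := definable_arc.
have d10 := definable_subst2 (F := fun x i j => arc (NA x) (NC x) (lit x) i j) d01
  (definable_var 1) (definable_var 0).
rewrite /adj; definable_tac.
Qed.

Lemma graph_computes : exists M, poly_computes M
  (fun x => adj_enc (@graph (NA x) (NC x) (lit x))).
Proof.
have dn := definable_vertices.
have [tN tNE] : definable (fun x _ => n_vertices (NA x) (NC x) * n_vertices (NA x) (NC x)).
  by definable_tac.
have [tF tFE] := definable_subst2 (F := fun x i j => adj (NA x) (NC x) (lit x) i j) definable_adj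
  (definable_div (definable_var 0) dn) (definable_mod (definable_var 0) dn).
have [M [k Mk]] := term_computes tN tF; exists M, k => x /=.
have /= [halted out] := Mk x; split=> //; rewrite out.
rewrite (adj_enc_mkseq _ (adj (NA x) (NC x) (lit x))) -tNE.
by apply: eq_mkseq => i; rewrite -tFE /= eqb0 negbK.
Qed.

End GraphDefinable.

Section LitDefinable.
Variables (M : TM) (kc kM : nat).

Lemma definable_input_len : definable (fun x _ => input_len kc x).
Proof. rewrite /input_len /cert_len; definable_tac. Qed.

Lemma definable_run_time : definable (fun x _ => run_time kc kM x).
Proof. have di := definable_input_len; rewrite /run_time; definable_tac. Qed.

Lemma definable_side : definable (fun x _ => side kc kM x).
Proof.
have di := definable_input_len; have dr := definable_run_time; rewrite /side; definable_tac.
Qed.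

Lemma definable_atom t p j : definable t -> definable p -> definable j ->
  definable (fun x e => atom M kc kM x (t x e) (p x e) (j x e)).
Proof.
by move=> dt dp dj; have ds := definable_side; rewrite /atom; definable_tac.
Qed.

(** The list of clause kinds depends on [M] only and [s] is fixed, so a literal is a finite case
    distinction between explicit terms in [t], [p] and [p']. *)
Lemma definable_lit s : s < 3 -> definable (fun x e => lit M kc kM x (e 0) s).
Proof.
have ds := definable_side; move=> lt_s.
rewrite /lit; cbv zeta.
set K := size _.
have kE (k : kind M) : definable (fun x e => nth 1 (klits kc kM k x (e 0) (e 1) (e 2)) s).
  have di := definable_input_len; have dr := definable_run_time.
  case: k => [[g q] b]; rewrite /klits; case: (next q b) => -[q' w] m.
  have dm : definable (fun x e => mv m (e 1)) by case: m => /=; definable_tac.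
  case: g => [[|[|[|[|[|[|[|g]]]]]]] lt_g]; case: s lt_s => [|[|[|s]]] //= _;
    rewrite /neg /pos /at_sym /at_head /at_away; cbv beta iota fix delta [nth]; try (case: (tm_accept q));
    definable_tac; refine (definable_atom _ _ _); definable_tac.
  1-2: refine (@definable_bit (fun x e => e 1 %/ 2) _); definable_tac.
pose d (e : nat -> nat) := e 0 %/ K.
have dd : definable (fun _ e => d e) by rewrite /d; definable_tac.
apply: (@definable_nth _ (kind0 M) (kinds M) (fun k x e =>
  nth 1 (klits kc kM k x (d e %/ side kc kM x %/ side kc kM x)
    (d e %/ side kc kM x %% side kc kM x) (d e %% side kc kM x)) s)) => [k|]; last by definable_tac.
by apply: (definable_subst3 (F := fun x t p p' => nth 1 (klits kc kM k x t p p') s) (kE k)); definable_tac.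
Qed.

End LitDefinable.

Theorem SR2_NP_hard : NP_hard SR2_BIP6.
Proof.
move=> L [Lv [kc [[M [kM M_decides]] LE]]].
exists (fun x => adj_enc (@graph (n_atoms M kc kM x) (n_clauses M kc kM x) (lit M kc kM x))); split.
  apply: graph_computes; [| |exact: definable_lit].
  - have ds := definable_side kc kM; rewrite /n_atoms; definable_tac.
  - have ds := definable_side kc kM; rewrite /n_clauses; definable_tac.
move=> x; rewrite LE -(satisfiableP kc M_decides).
have NA_gt0 : 0 < n_atoms M kc kM x by [].
have NC_gt0 : 0 < n_clauses M kc kM x.
  have S0 : 0 < side kc kM x by rewrite ltnW ?side_gt1.
  by rewrite /n_clauses !muln_gt0 S0 size_kinds.
have lt := @lit_lt M kc kM x; rewrite -(graph_sr2 NA_gt0 NC_gt0 lt).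
split=> [sr|[n [e [[E _ _] [_ _ sr]]]]].
  eexists; eexists; split; first by split; [reflexivity | exact: graph_sym | exact: graph_irr].
  by split; [exact: graph_bipartite | exact: graph_maxdeg | exact: sr].
(* The code has the square of the number of vertices as its length, so equal codes come from graphs
   of equal size, and then from the same graph. *)
have En : n_vertices (n_atoms M kc kM x) (n_clauses M kc kM x) = n.
  by have /eqP := congr1 size E; rewrite !size_adj_enc !mulnn eqn_exp2r // => /eqP.
move: e E sr; rewrite -En => e /adj_enc_inj <-; exact.
Qed.

(** * Membership in NP *)

Definition semi n (g : nat -> nat) : bool :=
  has (fun d => all (fun i => [|| g i == 0, g i == d | g i == d.+1]) (iota 0 n)) (iota 0 n.+1).

Section Verifier.
Variables (y : seq bool) (n : nat).

(* [y] encodes an adjacency matrix of size [n * n], and a certificate made of one side of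
   the bipartition ([n] bits) and of a symmetric matrix of colours. *)
Definition in_edge i j := nth false y (2 * (i * n + j) + 1).
Definition in_side i := nth false y (2 * (n * n) + 2 + i).
Definition in_color i j := nth false y (2 * (n * n) + 2 + n + (i * n + j)).

(** The first test pins down [n]: in [pair_enc x c], position [2 * size x] is the first even one
    that holds true, so [n * n = size x]. The last test excludes a single class and needs no
    certificate. *)
Definition verify : bool :=
  [&& all (fun i => ~~ nth false y (2 * i)) (iota 0 (n * n)) && nth false y (2 * (n * n)),
      all (fun i => all (fun j => in_edge i j == in_edge j i) (iota 0 n)) (iota 0 n),
      all (fun i => ~~ in_edge i i) (iota 0 n),
      all (fun i => all (fun j => in_edge i j ==> ~~ (in_side i == in_side j)) (iota 0 n)) (iota 0 n),
      all (fun i => count (fun j => in_edge i j) (iota 0 n) <= 6) (iota 0 n),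
      all (fun i => all (fun j => in_color i j == in_color j i) (iota 0 n)) (iota 0 n),
      semi n (fun i => count (fun j => in_edge i j && in_color i j) (iota 0 n)),
      semi n (fun i => count (fun j => in_edge i j && ~~ in_color i j) (iota 0 n)) &
      ~~ semi n (fun i => count (fun j => in_edge i j) (iota 0 n))].

End Verifier.

Definition verified y := has (fun n => verify y n) (iota 0 (size y).+1).

Lemma definable_verified : definable (fun y _ => verified y).
Proof.
rewrite /verified /verify /semi /in_edge /in_side /in_color.
definable_tac.
Qed.

Lemma all_ord n (P : pred nat) : all P (iota 0 n) = [forall i : 'I_n, P i].
Proof.
rewrite -val_enum_ord all_map; apply/allP/forallP => h i; first by apply: h; rewrite mem_enum.
by move=> _; apply: h.
Qed.

Lemma card_ord_count n (P : pred nat) : #|[set i : 'I_n | P i]| = count P (iota 0 n).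
Proof.
by rewrite -sum1dep_card -sum1_count -[in iota 0 n](subn0 n) -/(index_iota 0 n) big_mkord.
Qed.

Lemma semiP n (g : nat -> nat) : (forall i, i < n -> g i <= n) ->
  semi n g <-> exists d, forall i : 'I_n, [|| g i == 0, g i == d | g i == d.+1].
Proof.
move=> gn; split=> [/hasP[d _]|[d]].
  by rewrite all_ord => /forallP h; exists d.
move=> h; apply/hasP; case: (leqP d n) => [le_d|lt_d].
  by exists d; rewrite ?mem_iota // all_ord; apply/forallP.
(* A [d] above [n] exceeds all values, so they are all 0 and [d = 0] does as well. *)
exists 0; rewrite ?mem_iota // all_ord; apply/forallP => i.
by have := h i; have := gn i (ltn_ord i); lia.
Qed.

Lemma nth_pair_enc x c p : nth false (pair_enc x c) p =
  if p < 2 * size x then (p %% 2 == 1) && nth false x (p %/ 2)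
  else if p < 2 * size x + 2 then true else nth false c (p - (2 * size x + 2)).
Proof. by rewrite -odflt_onth onth_pair_enc; do 2!case: ifP => // _; rewrite odflt_onth. Qed.

Lemma deg_le n (P : pred nat) : count P (iota 0 n) <= n.
Proof. by rewrite -[X in _ <= X](size_iota 0 n) count_size. Qed.

Section Decode.
Variables (n : nat) (e : rel 'I_n) (c : seq bool).
Hypotheses (e_sym : symmetric e) (e_irr : irreflexive e).
Let y := pair_enc (adj_enc e) c.

Lemma in_edgeE (i j : 'I_n) : in_edge y n i j = e i j.
Proof.
have lt_k : i * n + j < n * n.
  by have := ltn_ord i; have := ltn_ord j; nia.
rewrite /in_edge nth_pair_enc size_adj_enc ifT; last by lia.
have -> : (2 * (i * n + j) + 1) %% 2 == 1 by lia.
have -> : (2 * (i * n + j) + 1) %/ 2 = i * n + j by lia.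
by rewrite nth_adj_enc.
Qed.

Lemma in_sideE i : in_side y n i = nth false c i.
Proof.
rewrite /in_side nth_pair_enc size_adj_enc !ifF; try by lia.
by congr nth; lia.
Qed.

Lemma in_colorE i j : in_color y n i j = nth false c (n + (i * n + j)).
Proof.
rewrite /in_color nth_pair_enc size_adj_enc !ifF; try by lia.
by congr nth; lia.
Qed.

Lemma marker : all (fun i => ~~ nth false y (2 * i)) (iota 0 (n * n)) && nth false y (2 * (n * n)).
Proof.
apply/andP; split; last by rewrite nth_pair_enc size_adj_enc ltnn ifT //; lia.
apply/allP => i; rewrite mem_iota => /= lt_i; rewrite nth_pair_enc size_adj_enc ifT; last lia.
by have -> : (2 * i %% 2 == 1) = false by lia.
Qed.

Definition cert_color (i j : 'I_n) : bool := nth false c (n + (i * n + j)).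

Lemma verifyE : verify y n =
  [&& [forall i, forall j, e i j ==> ~~ (nth false c (i : 'I_n) == nth false c (j : 'I_n))],
      [forall i, #|[set j | e i j]| <= 6],
      [forall i, forall j, cert_color i j == cert_color j i],
      semi n (fun i => count (fun j => in_edge y n i j && in_color y n i j) (iota 0 n)),
      semi n (fun i => count (fun j => in_edge y n i j && ~~ in_color y n i j) (iota 0 n)) &
      ~~ semi n (fun i => count (fun j => in_edge y n i j) (iota 0 n))].
Proof.
rewrite /verify marker /=.
rewrite (_ : all _ _ = true) /=; last first.
  rewrite all_ord; apply/forallP => i; rewrite all_ord; apply/forallP => j.
  by rewrite !in_edgeE e_sym.
rewrite (_ : all _ _ = true) /=; last first.
  by rewrite all_ord; apply/forallP => i; rewrite in_edgeE e_irr.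
congr [&& _, _, _ & _].
- rewrite all_ord; apply: eq_forallb => i; rewrite all_ord; apply: eq_forallb => j.
  by rewrite in_edgeE !in_sideE.
- rewrite all_ord; apply: eq_forallb => i; rewrite -card_ord_count.
  by congr (_ <= _); apply: eq_card => j; rewrite !inE in_edgeE.
- rewrite all_ord; apply: eq_forallb => i; rewrite all_ord; apply: eq_forallb => j.
  by rewrite !in_colorE.
Qed.

Lemma semi_deg : semi n (fun i => count (fun j => in_edge y n i j) (iota 0 n)) <->
  exists d, forall v, let k := #|[set w | e v w]| in [|| k == 0, k == d | k == d.+1].
Proof.
rewrite semiP; last by move=> i _; apply: deg_le.
have E (v : 'I_n) : count (fun j => in_edge y n v j) (iota 0 n) = #|[set w | e v w]|.
  by rewrite -card_ord_count; apply: eq_card => j; rewrite !inE in_edgeE.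
by split=> -[d h]; exists d => v; move: (h v); rewrite E.
Qed.

Lemma semi_cdeg (f : {set 'I_n} -> bool) b : (forall i j, e i j -> f [set i; j] = cert_color i j) ->
  semi n (fun i => count (fun j => in_edge y n i j && (if b then in_color y n i j else ~~ in_color y n i j)) (iota 0 n)) <->
  exists d, forall v, [|| cdeg e f b v == 0, cdeg e f b v == d | cdeg e f b v == d.+1].
Proof.
move=> fE; rewrite semiP; last by move=> i _; apply: deg_le.
have E (v : 'I_n) : count (fun j => in_edge y n v j && (if b then in_color y n v j else ~~ in_color y n v j)) (iota 0 n) = cdeg e f b v.
  rewrite -card_ord_count; apply: eq_card => j; rewrite !inE in_edgeE in_colorE.
  by case evj: (e v j) => //=; rewrite fE // -/(cert_color v j); case: b; case: (cert_color v j).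
by split=> -[d h]; exists d => v; move: (h v); rewrite E.
Qed.

End Decode.

Lemma sr_partitionable2E n (e : rel 'I_n) : symmetric e -> irreflexive e ->
  sr_partitionable e 2 <-> exists f : {set 'I_n} -> bool,
    forall b, exists d, forall v, [|| cdeg e f b v == 0, cdeg e f b v == d | cdeg e f b v == d.+1].
Proof.
move=> e_sym e_irr; rewrite (sr_partitionableE e_sym e_irr); split=> -[f fP].
  exists (fun X => f X == ord_max) => b; have [d dP] := fP (if b then ord_max else ord0).
  exists d => v; have := dP v.
  have -> // : cdeg e f (if b then ord_max else ord0) v = cdeg e (fun X => f X == ord_max) b v.
  apply: eq_card => w; rewrite !inE; congr (_ && _).
  by case: b {dP}; case: (f [set v; w]) => -[|[|]].
exists (fun X => if f X then ord_max else ord0) => i; have [d dP] := fP (i == ord_max).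
exists d => v; have := dP v.
have -> // : cdeg e f (i == ord_max) v = cdeg e (fun X => if f X then ord_max else ord0) i v.
apply: eq_card => w; rewrite !inE; congr (_ && _).
by case: (f _); case: i {dP} => -[|[|]].
Qed.

Lemma eq_set2 (T : finType) (i j a b : T) :
  [set i; j] = [set a; b] -> (i = a /\ j = b) \/ (i = b /\ j = a).
Proof.
move/setP => E; have := E i; have := E j; have := E a; have := E b.
rewrite !inE !eqxx !orbT /= => hb ha /esym/orP[] /eqP hj /esym/orP[] /eqP hi; subst; auto.
  by case/orP: hb => /eqP ->; auto.
by case/orP: ha => /eqP ->; auto.
Qed.

Lemma verified_sound x c : verified (pair_enc x c) -> SR2_BIP6 x.
Proof.
set y := pair_enc x c; case/hasP => n _ vn.
have sz : size x = n * n.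
  have /andP[/andP[/allP lo hi] _] := vn; rewrite nth_pair_enc in hi.
  case: (ltngtP (size x) (n * n)) => // lt.
    have := lo (size x); rewrite mem_iota => /(_ lt).
    by rewrite nth_pair_enc ltnn ifT //; lia.
  by rewrite ifT in hi; [have E : (2 * (n * n) %% 2 == 1) = false by [lia]; rewrite E in hi | lia].
pose e : rel 'I_n := fun i j => nth false x (i * n + j).
have Ex : x = adj_enc e.
  rewrite (adj_enc_mkseq n (fun i j => nth false x (i * n + j))).
  apply: (@eq_from_nth _ false); first by rewrite size_mkseq.
  by move=> k lt_k; rewrite nth_mkseq -?sz // -divn_eq.
clearbody e; subst x.
have e_sym : symmetric e.
  move=> i j; have /and3P[_ h _] := vn; move: h; rewrite all_ord => /forallP/(_ i).
  by rewrite all_ord => /forallP/(_ j); rewrite !in_edgeE => /eqP.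
have e_irr : irreflexive e.
  move=> i; have /and4P[_ _ h _] := vn; move: h; rewrite all_ord => /forallP/(_ i).
  by rewrite in_edgeE => /negbTE.
rewrite (verifyE c e_sym e_irr) in vn.
case/and5P: vn => bip deg6 colC s1 /andP[s0 ns].
exists n, e; split=> //; split.
- exists [set i : 'I_n | nth false c i] => i j eij; rewrite !inE.
  by have /forallP/(_ i)/forallP/(_ j) := bip; rewrite eij.
- by move=> i; apply: (forallP deg6).
rewrite sr_is2E // sr_partitionable2E //; split; last by rewrite -(semi_deg e c); apply/negP.
(* The certificate colours ordered pairs; the symmetry test makes the colour of an edge well
   defined. *)
pose f X := [exists i, exists j, (X == [set i; j]) && cert_color c (i : 'I_n) (j : 'I_n)].
have fE i j : e i j -> f [set i; j] = cert_color c i j.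
  move=> eij; apply/existsP/idP => [[a /existsP[b /andP[/eqP/eq_set2 E cab]]]|cij].
    case: E => -[-> ->] //; have /forallP/(_ b)/forallP/(_ a)/eqP-> := colC.
    exact: cab.
  by exists i; apply/existsP; exists j; rewrite eqxx.
exists f => -[]; rewrite -(semi_cdeg _ fE).
  exact: s1.
exact: s0.
Qed.

Lemma verified_complete x : SR2_BIP6 x ->
  exists2 c, size c <= size x ^ 2 + 2 & verified (pair_enc x c).
Proof.
case=> n [e [[-> e_sym e_irr] [[A bip] deg6 sr]]].
move: sr; rewrite sr_is2E // sr_partitionable2E // => -[[f fP] not1].
pose c := [seq i \in A | i <- enum 'I_n] ++ adj_enc (fun i j : 'I_n => f [set i; j]).
have szA : size [seq i \in A | i <- enum 'I_n] = n by rewrite size_map size_enum_ord.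
have cA (i : 'I_n) : nth false c i = (i \in A).
  by rewrite nth_cat szA ltn_ord (nth_map i) ?size_enum_ord // nth_ord_enum.
have cF i j : cert_color c i j = f [set i; j].
  by rewrite /cert_color nth_cat szA ltnNge leq_addr /= addKn nth_adj_enc.
have n_le : n <= n * n by case: (n) => // k; rewrite leq_pmulr.
exists c.
  (* With [m = n * n], the length [n + m] is at most [2 * m], which is at most [m ^ 2 + 2]. *)
  rewrite size_cat szA !size_adj_enc -mulnn; move: (n * n) n_le => m n_le.
  by case: m n_le => [|[|m]] n_le; nia.
apply/hasP; exists n.
  by rewrite mem_iota size_pair_enc size_adj_enc /=; lia.
rewrite verifyE //; apply/and5P; split.
- apply/forallP => i; apply/forallP => j; apply/implyP => eij; rewrite !cA.
  exact: bip.
- by apply/forallP => i; apply: deg6.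
- by apply/forallP => i; apply/forallP => j; rewrite !cF setUC.
- by apply/(semi_cdeg (f := f) true) => // i j _; rewrite cF.
- apply/andP; split; first by apply/(semi_cdeg (f := f) false) => // i j _; rewrite cF.
  by apply/negP => /semi_deg.
Qed.

Theorem SR2_in_NP : in_NP SR2_BIP6.
Proof.
exists (fun y => verified y), 2; split.
  have [t tE] := definable_verified.
  have [M [k Mk]] := term_in_P t; exists M, k => x.
  by have := Mk x; rewrite /= -tE eqb0 negbK.
move=> x; split=> [/verified_complete[c le_c vc]|[c [_ vc]]]; first by exists c.
exact: verified_sound vc.
Qed.

Theorem theorem3 : NP_complete SR2_BIP6.
Proof. by split; [exact: SR2_in_NP | exact: SR2_NP_hard]. Qed.
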